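(* Let $\beta\in[0,\frac1{\mathrm e}]$ and let $\lambda_1\le\lambda_2$ be the two roots in $[0,1]$ of $-\lambda\ln\lambda=\beta$ (with $0\ln0=0$). Let $\kappa\approx0.804$ be the positive solution of $\sum_{k=1}^\infty\frac{\kappa^k}{k!\,k}=1$. Then for every number of values $n$ there is an algorithm for optimal stopping with a predicted prior that is $\alpha$-consistent and $\beta$-robust for the MaxProb objective, where $$\alpha=\beta+\int_{\lambda_1}^{\lambda_2}\int_s^1\frac{\mathrm e^{-\frac{\kappa t}{1-s}}}{t}\,\mathrm dt\,\mathrm ds.$$
   Context: Optimal stopping with a predicted prior: let $\mathcal D$ be the set of probability distributions on $[0,\infty)$ (identified with their cdfs). There are $n$ values $x_1,\dots,x_n$ drawn i.i.d. from an unknown prior $F\in\mathcal D$; each value $x_i$ has an arrival time $t_i$ drawn independently and uniformly from $[0,1]$, independent of the values. Values are revealed in increasing order of arrival time; upon seeing a value, an online algorithm must irrevocably accept it (and stop) or reject it; at most one value can be accepted. The algorithm knows $n$ and a predicted prior $\tilde F\in\mathcal D$ and may use the observed history and internal randomness. Let $x_{\mathrm{ALG}}$ be the accepted value ($0$ if none) and $x_{\mathrm{OPT}}=\max_i x_i$. For the MaxProb objective the competitive ratio is $\Pr[x_{\mathrm{ALG}}=x_{\mathrm{OPT}}]$. An algorithm is $\Gamma$-competitive if its ratio is at least $\Gamma$. It is $\alpha$-consistent if for every $F\in\mathcal D$ it is $\alpha$-competitive when $\tilde F=F$, and $\beta$-robust if for every $F\in\mathcal D$ it is $\beta$-competitive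 regardless of which $\tilde F\in\mathcal D$ is given. *)

(* Defs.v *)
From HB Require Import structures.
From mathcomp Require Import all_boot all_order all_algebra.
From mathcomp Require Import all_classical all_reals all_analysis.
Set Implicit Arguments. Unset Strict Implicit. Unset Printing Implicit Defensive.
Import Order.TTheory GRing.Theory Num.Theory.
Import numFieldNormedType.Exports.
Local Open Scope classical_set_scope.
Local Open Scope ring_scope.

Section OptStop.
Variable R : realType.

Definition nonneg_dist (F : probability R R) : Prop :=
  F `[0%R, +oo[%classic = 1%E.

(** An algorithm (for a fixed number n of values) is a decision rule:
    [decide Ft h w] says whether to accept the current value, given the
    predicted prior [Ft], the history [h] of (arrival time, value) pairs seen
    so far in arrival order (the last one is the current value), and the
    internal random seed [w] (uniform on [0,1]).  We require the decision
    rule to be jointly Borel measurable in (history, seed). *)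
Record algorithm := Algorithm {
  decide : probability R R -> seq (R * R) -> R -> bool }.

Definition alg_measurable (A : algorithm) : Prop :=
  forall (Ft : probability R R) (k : nat),
    measurable [set p : (k.+1).-tuple (R * R) * R |
                 decide A Ft (tval p.1) p.2].

Fixpoint run (A : algorithm) (Ft : probability R R) (w : R)
    (hist rest : seq (R * R)) : R :=
  match rest with
  | [::] => 0
  | a :: rest' =>
      let h := rcons hist a in
      if decide A Ft h w then a.2 else run A Ft w h rest'
  end.

(** Arrival order: sort (time, value) pairs by arrival time (stable sort,
    ties -- a null event -- broken by index). *)
Definition arrivals (s : seq (R * R)) : seq (R * R) :=
  sort (fun a b => a.1 <= b.1) s.

Definition x_opt (s : seq (R * R)) : R := \big[Num.max/0]_(p <- s) p.2.

Definition x_alg (A : algorithm) (Ft : probability R R) (w : R)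
    (s : seq (R * R)) : R := run A Ft w [::] (arrivals s).

Definition success (A : algorithm) (Ft : probability R R) (w : R)
    (s : seq (R * R)) : bool := x_alg A Ft w s == x_opt s.

(** Expectation over n i.i.d. pairs (t_i, x_i) with x_i ~ F and t_i uniform
    on [0,1], all independent (iterated integral of the product measure). *)
Fixpoint iterE (F : probability R R) (n : nat)
    (g : seq (R * R) -> \bar R) : \bar R :=
  match n with
  | 0 => g [::]
  | n'.+1 =>
      (\int[F]_x \int[lebesgue_measure]_(t in `[0%R, 1%R])
          iterE F n' (fun s => g ((t, x) :: s)))%E
  end.

Definition success_prob (A : algorithm) (n : nat)
    (Ft F : probability R R) : \bar R :=
  (\int[lebesgue_measure]_(w in `[0%R, 1%R])
     iterE F n (fun s => ((success A Ft w s)%:R)%:E))%E.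

Definition consistent (A : algorithm) (n : nat) (alpha : \bar R) : Prop :=
  forall F : probability R R, nonneg_dist F ->
    (alpha <= success_prob A n F F)%E.

Definition robust (A : algorithm) (n : nat) (beta : \bar R) : Prop :=
  forall F Ft : probability R R, nonneg_dist F -> nonneg_dist Ft ->
    (beta <= success_prob A n Ft F)%E.

Definition negxlnx (x : R) : R := if x == 0 then 0 else - (x * ln x).

Definition kappa_series (k : R) : R^nat :=
  fun m => \sum_(1 <= j < m) k ^+ j / (j`!%:R * j%:R).

Definition alpha_bound (beta l1 l2 kappa : R) : \bar R :=
  (beta%:E + \int[lebesgue_measure]_(s in `[l1, l2])
     \int[lebesgue_measure]_(t in `[s, 1%R])
        (expR (- (kappa * t / (1 - s))) / t)%:E)%E.

End OptStop.

(* Main.v *)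
(** The algorithm turns a value [x] into a randomized quantile [u] of the predicted prior
    (atoms are split by independent uniform tie-breakers) and accepts a record of
    lexicographic rank [(x, tie-breaker)] at time [t] when [thr u <= t], where [thr] is
    nonincreasing in [u] with values in [[l1, l2]].

    Fix the values and order the items by decreasing rank, with thresholds
    [th_1 <= th_2 <= ...] and independent uniform arrival times [T_k].  The best item is
    accepted iff [th_1 <= T_1] and the best item arriving before [T_1], if any, arrives
    before its own threshold.  Given [T_1 = t] this has probability at least [th_1 / t],
    so success has probability at least [- th_1 ln th_1 >= beta] whatever the values are.

    More precisely this conditional probability is the average over [s] in [[0, t]] of
    [(1 - t) ^ #{k >= 2 | th_k <= s}].  When the prediction is correct the quantiles are
    independent and uniform, hence the counts are binomial, and weighted AM-GM bounds
    the result from below by the Poisson limit [n -> oo].  With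
    [P(thr > s) ^ n = exp (- kappa / (1 - s))] on [[l1, l2[], the equation defining
    [kappa] cancels every term but those of [alpha]. *)

Require Import Defs.
From HB Require Import structures.
From mathcomp Require Import all_boot all_order all_algebra.
From mathcomp Require Import all_classical all_reals all_analysis.
From mathcomp Require Import measurable_realfun measurable_fun_approximation.
From mathcomp Require Import ring lra.
Import Order.TTheory GRing.Theory Num.Theory.
Import numFieldNormedType.Exports.
Local Open Scope classical_set_scope.
Local Open Scope ring_scope.
Set Implicit Arguments. Unset Strict Implicit. Unset Printing Implicit Defensive.

(** * Products of probabilities and iterated expectations *)

Import HBNNSimple.

(** The decision rule owns one uniform seed, while splitting atoms takes one tie-breaker per value.
    The seed is therefore compared with [psto], the conditional probability, given the observed
    pairs, that the rule with tie-breakers has already stopped. Its increment at an item is the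
    chance of stopping there, so the tie-breakers never have to be drawn.

    How kappa cancels: put [Q s = exp (- kappa / (1 - s))]. For [l1 <= s < l2] and [s < t] the
    success density is at least [Q(s)^t / t + (Q(s)^t - Q(s)) / (1 - t)], minus a loss [q(t)^n / t].
    Integrated over [s < t], the loss is [q(t)^n], that is [Q t] on [[l1, l2[] and 1 below [l1].
    Integrated over [t], the second gain is, with [v = (1 - t) / (1 - s)], the product of [Q s] and
    the series of kappa, that is [Q s]. So gain and loss match on [[l1, l2[], and the first gain is
    the integrand of alpha. The range [s < l1] earns [l1 + beta] against a loss of [l1].

    Losses are always moved to the other side: every integrand is then nonnegative and Tonelli's
    theorem needs no integrability. *)

Section infra.
Local Open Scope ereal_scope.

(* Unlike [ge0_le_integral], this needs no measurability. *)
Lemma integral_mono d (T : measurableType d) (R : realType)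
    (mu : {measure set T -> \bar R}) (D : set T) (f g : T -> \bar R) :
  (forall x, D x -> 0 <= f x) -> (forall x, D x -> f x <= g x) ->
  \int[mu]_(x in D) f x <= \int[mu]_(x in D) g x.
Proof.
move=> f0 fg; rewrite !ge0_integralE//; last first.
  by move=> x Dx; exact: le_trans (f0 _ Dx) (fg _ Dx).
apply: ge_ereal_sup => _ [h hf <-]; apply: ereal_sup_ubound; exists h => // x.
apply: le_trans (hf x) _; rewrite /patch; case: ifPn => // xD.
by apply: fg; move: xD; rewrite inE.
Qed.

Lemma product_prob (d1 d2 : measure_display) (T1 : measurableType d1) (T2 : measurableType d2)
    (R : realType) (P : probability T1 R) (Q : probability T2 R) :
  exists PQ : probability (T1 * T2)%type R, forall f : (T1 * T2)%type -> \bar R,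
    measurable_fun [set: (T1 * T2)%type] f -> (forall x, 0 <= f x) ->
    \int[PQ]_z f z = \int[P]_x \int[Q]_y f (x, y).
Proof.
pose m : {measure set (T1 * T2)%type -> \bar R} := (P \x Q).
have m1 : m setT = 1.
  rewrite -setXTT [LHS]product_measure1E//.
  by transitivity (P setT * Q setT); rewrite // !probability_setT mule1.
pose M := HB.pack_for (probability (T1 * T2)%type R) (Measure.sort m)
  (Measure_isProbability.Build _ _ _ m m1).
by exists M => f mf f0; rewrite -fubini_tonelli1.
Qed.

Lemma map_prob (d1 d2 : measure_display) (T1 : measurableType d1) (T2 : measurableType d2)
    (R : realType) (P : probability T1 R) (phi : T1 -> T2) :
  measurable_fun setT phi ->
  exists Q : probability T2 R, forall f : T2 -> \bar R,
    measurable_fun setT f -> (forall x, 0 <= f x) ->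
    \int[Q]_z f z = \int[P]_x f (phi x).
Proof.
move=> mphi.
pose phi' : {mfun T1 >-> T2} := HB.pack phi (isMeasurableFun.Build _ _ _ _ phi mphi).
exists (distribution P phi') => f mf f0.
by rewrite ge0_integral_distribution.
Qed.

End infra.

Section nest.
Local Open Scope ereal_scope.
Context d (T : measurableType d) (R : realType).
Implicit Types (P : probability T R) (n : nat).

(** Expectation over [n] independent draws, kept on lists so that concatenating, filtering and
    permuting draws remain list operations. [nest_prob] goes back to a law on tuples when Tonelli's
    theorem is wanted. *)
Fixpoint nest P n (g : seq T -> \bar R) : \bar R :=
  if n is n'.+1 then \int[P]_z nest P n' (fun s => g (z :: s)) else g [::].

(** [integral_mono] asks for a nonnegative smaller function, so the induction has to carry
    nonnegativity along. *)
Lemma le_nest P n (g1 g2 : seq T -> \bar R) :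
  (forall s, size s = n -> 0 <= g1 s) -> (forall s, size s = n -> g1 s <= g2 s) ->
  nest P n g1 <= nest P n g2 /\ 0 <= nest P n g1.
Proof.
elim: n g1 g2 => [|n IH] g1 g2 g0 g12 /=; first by split; [exact: g12|exact: g0].
have h z : nest P n (fun s => g1 (z :: s)) <= nest P n (fun s => g2 (z :: s)) /\
    0 <= nest P n (fun s => g1 (z :: s)).
  by apply: IH => s sn; [apply: g0|apply: g12]; rewrite /= sn.
split; first by apply: integral_mono => z _; have [] := h z.
by apply: integral_ge0 => z _; have [] := h z.
Qed.

Lemma nest_ge0 P n (g : seq T -> \bar R) :
  (forall s, size s = n -> 0 <= g s) -> 0 <= nest P n g.
Proof. by move=> g0; have [] := @le_nest P n g g g0 (fun _ _ => lexx _). Qed.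

Lemma nest_mono P n (g1 g2 : seq T -> \bar R) :
  (forall s, size s = n -> 0 <= g1 s) -> (forall s, size s = n -> g1 s <= g2 s) ->
  nest P n g1 <= nest P n g2.
Proof. by move=> g0 g12; have [] := le_nest P g0 g12. Qed.

Lemma eq_nest P n (g1 g2 : seq T -> \bar R) :
  (forall s, size s = n -> g1 s = g2 s) -> nest P n g1 = nest P n g2.
Proof.
elim: n g1 g2 => [|n IH] g1 g2 g12 /=; first exact: g12.
by apply: eq_integral => z _; apply: IH => s sn; apply: g12; rewrite /= sn.
Qed.

Lemma nest_cst P n (c : \bar R) : nest P n (fun=> c) = c.
Proof.
elim: n => //= n ->; rewrite integral_cst//.
by rewrite -[RHS]mule1 -(@probability_setT _ _ _ P).
Qed.

Lemma nest_cat P m n (g : seq T -> \bar R) :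
  nest P (m + n) g = nest P m (fun s1 => nest P n (fun s2 => g (s1 ++ s2))).
Proof. by elim: m g => //= m IH g; apply: eq_integral => z _; rewrite IH. Qed.

Definition tmeas n (g : seq T -> \bar R) :=
  measurable_fun [set: n.-tuple T] (fun y => g (tval y)).

(** The law on [n.+1]-tuples is the image under cons of the product of [P] with the law on
    [n]-tuples. A nested integral thus becomes a single one, to which Tonelli's theorem applies. *)
Lemma nest_prob P n : exists Q : probability (n.-tuple T) R,
  forall g, tmeas n g -> (forall s, 0 <= g s) -> nest P n g = \int[Q]_y g (tval y).
Proof.
elim: n => [|n [Q HQ]].
  exists (\d_([tuple] : 0.-tuple T)) => g mg g0 /=.
  by rewrite (integral_dirac _ measurableT) // diracT mul1e.
have [PQ HPQ] := product_prob P Q.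
pose phi (p : T * n.-tuple T) := [tuple of p.1 :: p.2].
have mphi : measurable_fun [set: (T * n.-tuple T)%type] phi.
  by apply: measurable_cons.
have [Q' HQ'] := map_prob PQ mphi.
exists Q' => g mg g0; rewrite HQ'// HPQ//; last first.
  by apply: (measurableT_comp mg mphi).
rewrite /=; apply: eq_integral => z _; rewrite HQ//.
have mz : measurable_fun [set: n.-tuple T] (fun y : n.-tuple T => (z, y)).
  exact: measurable_pair1.
exact: (measurableT_comp mg (measurableT_comp mphi mz)).
Qed.

Lemma tmeas_cons n (g : seq T -> \bar R) z :
  tmeas n.+1 g -> tmeas n (fun s => g (z :: s)).
Proof.
move=> mg; have mz : measurable_fun [set: n.-tuple T]
    (fun y : n.-tuple T => [tuple of z :: y]) by apply: measurable_cons.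
exact: (measurableT_comp mg mz).
Qed.

Section param.
Context d' (X : measurableType d').
Implicit Types (M : probability X R) (g : X -> seq T -> \bar R).

Definition ptmeas n g :=
  measurable_fun [set: (X * n.-tuple T)%type] (fun q => g q.1 (tval q.2)).

Lemma ptmeas1 n g x : ptmeas n g -> tmeas n (g x).
Proof. by move=> mg; apply: (measurableT_comp mg (measurable_pair1 x)). Qed.

Lemma nest_meas P n g : ptmeas n g -> (forall x s, 0 <= g x s) ->
  measurable_fun [set: X] (fun x => nest P n (g x)).
Proof.
move=> mg g0; have [Q HQ] := nest_prob P n.
have -> : (fun x => nest P n (g x)) = (fun x => \int[Q]_y g x (tval y)).
  by apply/funext => x; rewrite HQ//; apply: ptmeas1.
exact: (@measurable_fun_fubini_tonelli_F _ _ _ _ _ _ _ mg).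
Qed.

Lemma nest_integralC P n g M : ptmeas n g -> (forall x s, 0 <= g x s) ->
  \int[M]_x nest P n (g x) = nest P n (fun s => \int[M]_x g x s).
Proof.
move=> mg g0; have [Q HQ] := nest_prob P n.
rewrite HQ; last 2 first.
- exact: (@measurable_fun_fubini_tonelli_G _ _ _ _ _ _ _ mg).
- by move=> s; apply: integral_ge0.
have := @fubini_tonelli _ _ _ _ R M Q _ mg (fun q => g0 q.1 (tval q.2)).
move=> /= <-; apply: eq_integral => x _; rewrite HQ//; exact: ptmeas1.
Qed.
End param.

Lemma nestD P n (g1 g2 : seq T -> \bar R) : tmeas n g1 -> tmeas n g2 ->
  (forall s, 0 <= g1 s) -> (forall s, 0 <= g2 s) ->
  nest P n (fun s => g1 s + g2 s) = nest P n g1 + nest P n g2.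
Proof.
move=> m1 m2 g1_ge0 g2_ge0; have [Q HQ] := nest_prob P n; rewrite !HQ//.
- exact: ge0_integralD.
- exact: emeasurable_funD.
- by move=> s; exact: adde_ge0.
Qed.

Lemma nestZ P n (g : seq T -> \bar R) (c : \bar R) : tmeas n g ->
  (forall s, 0 <= g s) -> 0 <= c ->
  nest P n (fun s => c * g s) = c * nest P n g.
Proof.
move=> mg g0 c0; have [Q HQ] := nest_prob P n; rewrite !HQ//.
- exact: ge0_integralZl.
- exact: measurable_funeM.
- by move=> s; exact: mule_ge0.
Qed.

(** Draws attached to discarded entries integrate out, because [P] has total mass 1. *)
Lemma nest_filter P (V : Type) (q : pred V) (h : seq V) (g : seq (T * V) -> \bar R) :
  nest P (size (seq.filter q h)) (fun r => g (zip r (seq.filter q h))) =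
  nest P (size h) (fun r => g (seq.filter (q \o snd) (zip r h))).
Proof.
elim: h g => //= v h IH g; case: ifPn => qv /=.
  by apply: eq_integral => z _; rewrite (IH (fun l => g ((z, v) :: l))).
by rewrite IH integral_cst// [X in _ * X]probability_setT mule1.
Qed.

(** By induction [v] reaches the second place. Tonelli's theorem then exchanges the first two
    integrals, and the symmetry of [g] exchanges the two entries. *)
Lemma nest_pull P (V : eqType) (v : V) (v1 v2 : seq V) (g : seq (T * V) -> \bar R) :
  (forall l l', perm_eq l l' -> g l = g l') ->
  (forall vs, tmeas (size vs) (fun r => g (zip r vs))) ->
  (forall l, 0 <= g l) ->
  nest P (size (v1 ++ v :: v2)) (fun r => g (zip r (v1 ++ v :: v2))) =
  nest P (size (v :: v1 ++ v2)) (fun r => g (zip r (v :: v1 ++ v2))).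
Proof.
elim: v1 g => // v' v1 IH g gsym mg g0 /=.
under eq_integral => z' _.
  rewrite (IH (fun l => g ((z', v') :: l))); last 3 first.
  - by move=> l l' ll'; apply: gsym; rewrite perm_cons.
  - by move=> vs; apply: (tmeas_cons z' (mg (v' :: vs))).
  - by [].
  over.
rewrite /=.
pose n := size (v1 ++ v2).
pose F (p : T * T) := nest P n (fun r => g [:: (p.1, v'), (p.2, v) & zip r (v1 ++ v2)]).
have mF : measurable_fun [set: (T * T)%type] F.
  apply: nest_meas => //; rewrite /ptmeas.
  have mc : measurable_fun [set: (T * T * n.-tuple T)%type]
     (fun q : T * T * n.-tuple T => [tuple of q.1.1 :: [tuple of q.1.2 :: q.2]]).
    apply: measurable_cons; first exact: measurableT_comp.
    by apply: measurable_cons => //; exact: measurableT_comp.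
  exact: (measurableT_comp (mg (v' :: v :: (v1 ++ v2))) mc).
have F0 p : 0 <= F p by apply: nest_ge0.
rewrite -/(size _) -/n.
transitivity (\int[P]_x \int[P]_y F (x, y)) => //.
rewrite fubini_tonelli//.
apply: eq_integral => z _; apply: eq_integral => z' _; apply: eq_nest => s _.
by apply: gsym; apply/permPl; exact: (perm_catCA [:: _] [:: _]).
Qed.

Lemma nest_perm P (V : eqType) (vs vs' : seq V) (g : seq (T * V) -> \bar R) :
  (forall l l', perm_eq l l' -> g l = g l') ->
  (forall vs, tmeas (size vs) (fun r => g (zip r vs))) ->
  (forall l, 0 <= g l) ->
  perm_eq vs vs' ->
  nest P (size vs) (fun r => g (zip r vs)) = nest P (size vs') (fun r => g (zip r vs')).
Proof.
elim: vs vs' g => [|v vs IH] vs' g gsym mg g0.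
  by rewrite perm_sym => /perm_nilP ->.
move=> pvs; have vin : v \in vs' by rewrite -(perm_mem pvs) mem_head.
move: pvs; case/splitPr : vin => v1 v2 pvs.
rewrite nest_pull//; apply: eq_integral => z _.
apply: (IH _ (fun l => g ((z, v) :: l))) => //.
- by move=> l l' ll'; apply: gsym; rewrite perm_cons.
- by move=> us; apply: (tmeas_cons z (mg (v :: us))).
- move: pvs; rewrite perm_sym -[v :: v2]cat1s.
  by rewrite (perm_catCA v1 [:: v] v2) perm_cons perm_sym.
Qed.

(** A condition on each draw given the earlier ones, which [pre] lists latest first. The dependence
    on [pre] is what lets almost sure distinctness be expressed one draw at a time. *)
Fixpoint okl (ok : seq T -> T -> Prop) pre s : Prop :=
  if s is z :: s' then ok pre z /\ okl ok (z :: pre) s' else True.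

Lemma nest_ae_le P n (ok : seq T -> T -> Prop) pre (g1 g2 : seq T -> \bar R) :
  (forall pr, {ae P, forall z, ok pr z}) ->
  tmeas n g1 -> tmeas n g2 -> (forall s, 0 <= g1 s) -> (forall s, 0 <= g2 s) ->
  (forall s, size s = n -> okl ok pre s -> g1 s <= g2 s) ->
  nest P n g1 <= nest P n g2.
Proof.
move=> aeok; elim: n pre g1 g2 => [|n IH] pre g1 g2 m1 m2 g10 g20 g12 /=.
  exact: g12.
have mc : measurable_fun [set: (T * n.-tuple T)%type]
     (fun q : T * n.-tuple T => [tuple of q.1 :: q.2]).
  exact: measurable_cons.
apply: ae_ge0_le_integral => //.
- by move=> z _; exact: nest_ge0.
- by apply: nest_meas => //; exact: (measurableT_comp m1 mc).
- by move=> z _; exact: nest_ge0.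
- by apply: nest_meas => //; exact: (measurableT_comp m2 mc).
- apply: filterS (aeok pre) => z okz _; apply: (IH (z :: pre)) => //.
  + exact: tmeas_cons.
  + exact: tmeas_cons.
  + by move=> s sn oks; apply: g12 => //=; rewrite sn.
Qed.

End nest.

Lemma nestC d1 d2 (T1 : measurableType d1) (T2 : measurableType d2) (R : realType)
    (P1 : probability T1 R) (P2 : probability T2 R) m n (g : seq T1 -> seq T2 -> \bar R) :
  measurable_fun [set: (m.-tuple T1 * n.-tuple T2)%type]
    (fun q => g (tval q.1) (tval q.2)) ->
  (forall s r, 0 <= g s r)%E ->
  nest P1 m (fun s => nest P2 n (g s)) = nest P2 n (fun r => nest P1 m (g ^~ r)).
Proof.
move=> mg g0; have [Q HQ] := nest_prob P1 m.
rewrite HQ; last 2 first.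
- exact: (@nest_meas _ _ _ _ _ P2 n (fun s : m.-tuple T1 => g s)).
- by move=> s; apply: nest_ge0.
rewrite nest_integralC//; apply: eq_nest => r rn; rewrite HQ//.
have mr : measurable_fun [set: m.-tuple T1] (fun y : m.-tuple T1 => (y, tcast rn (in_tuple r))).
  exact: measurable_pair2.
rewrite /tmeas.
have -> : (fun y : m.-tuple T1 => g y r) = (fun y : m.-tuple T1 => g y (tcast rn (in_tuple r))).
  by apply/funext => y; rewrite val_tcast.
exact: (measurableT_comp mg mr).
Qed.

(** * Measurability of list predicates *)

Section boolmeas.
Context d (X : measurableType d) d' (A : measurableType d') (R : realType).

Lemma measurable_of_bool (f : bool -> \bar R) : measurable_fun [set: bool] f.
Proof. by move=> _ Y _; exact: I. Qed.

Lemma measurable_ind (b : X -> bool) : measurable_fun [set: X] b ->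
  measurable_fun [set: X] (fun x => ((b x)%:R : R)%:E).
Proof.
move=> mb; exact: (measurableT_comp (@measurable_of_bool (fun b => (b%:R)%:E)) mb).
Qed.

Lemma measurable_imply (b c : X -> bool) : measurable_fun [set: X] b ->
  measurable_fun [set: X] c -> measurable_fun [set: X] (fun x => b x ==> c x).
Proof.
move=> mb mc; rewrite (_ : (fun _ => _) = fun x => ~~ b x || c x).
  by apply: measurable_or => //; apply: measurable_neg.
by apply/funext => x; rewrite implybE.
Qed.

(** A random list of fixed length, measurable coordinate by coordinate: list predicates can be shown
    measurable without being restated on tuples. *)
Definition mseq n (L : X -> seq A) := exists c : 'I_n -> X -> A,
  (forall i, measurable_fun [set: X] (c i)) /\
  forall x, L x = [seq c i x | i <- enum 'I_n].

Lemma mseq_tuple n (f : X -> n.-tuple A) : measurable_fun [set: X] f ->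
  mseq n (fun x => tval (f x)).
Proof.
move=> /measurable_fun_tnthP mf; exists (fun i x => tnth (f x) i); split => // x.
by rewrite map_tnth_enum.
Qed.

Lemma measurable_has n (L : X -> seq A) (phi : X -> A -> bool) : mseq n L ->
  measurable_fun [set: (X * A)%type] (fun q => phi q.1 q.2) ->
  measurable_fun [set: X] (fun x => has (phi x) (L x)).
Proof.
move=> [c [mc LE]] mphi.
rewrite (_ : (fun _ => _) = fun x => has (fun i => phi x (c i x)) (enum 'I_n)).
  elim: (enum 'I_n) => //= i r IH; apply: measurable_or => //.
  apply: (measurableT_comp mphi (_ : measurable_fun setT (fun x => (x, c i x)))).
  exact: measurable_fun_pair.
by apply/funext => x; rewrite LE has_map.
Qed.

Lemma measurable_all n (L : X -> seq A) (phi : X -> A -> bool) : mseq n L ->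
  measurable_fun [set: (X * A)%type] (fun q => phi q.1 q.2) ->
  measurable_fun [set: X] (fun x => all (phi x) (L x)).
Proof.
move=> mL mphi.
rewrite (_ : (fun _ => _) = fun x => ~~ has (predC (phi x)) (L x)).
  by apply: measurable_neg; apply: measurable_has mL _; exact: measurable_neg.
by apply/funext => x; rewrite has_predC negbK.
Qed.

Lemma measurable_prodl n (L : X -> seq A) (f : X -> A -> R) : mseq n L ->
  measurable_fun [set: (X * A)%type] (fun q => f q.1 q.2) ->
  measurable_fun [set: X] (fun x => \prod_(a <- L x) f x a).
Proof.
move=> [c [mc LE]] mf.
rewrite (_ : (fun _ => _) = fun x => \prod_(i <- enum 'I_n) f x (c i x)).
  apply: measurable_prod => i _.
  apply: (measurableT_comp mf (_ : measurable_fun setT (fun x => (x, c i x)))).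
  exact: measurable_fun_pair.
by apply/funext => x; rewrite LE big_map.
Qed.

End boolmeas.

Lemma mseq_map d (X : measurableType d) d1 (A : measurableType d1)
    d2 (B : measurableType d2) n (L : X -> seq A) (h : A -> B) :
  mseq n L -> measurable_fun [set: A] h -> mseq n (fun x => [seq h a | a <- L x]).
Proof.
move=> [c [mc LE]] mh; exists (fun i x => h (c i x)); split=> [i|x].
  exact: measurableT_comp.
by rewrite LE -map_comp.
Qed.

Lemma mseq_zip d (X : measurableType d) d1 (A : measurableType d1)
    d2 (B : measurableType d2) n (L : X -> seq A) (M : X -> seq B) :
  mseq n L -> mseq n M -> mseq n (fun x => zip (L x) (M x)).
Proof.
move=> [c [mc LE]] [e [me ME]]; exists (fun i x => (c i x, e i x)); split=> [i|x].
  exact: measurable_fun_pair.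
by rewrite LE ME zip_map.
Qed.

Lemma mseq_comp d (X : measurableType d) d0 (Y : measurableType d0)
    d1 (A : measurableType d1) n (L : X -> seq A) (h : Y -> X) :
  mseq n L -> measurable_fun [set: Y] h -> mseq n (fun y => L (h y)).
Proof.
move=> [c [mc LE]] mh; exists (fun i y => c i (h y)); split=> [i|x //].
exact: measurableT_comp.
Qed.

Lemma mseq_fst d (X : measurableType d) d0 (Y : measurableType d0)
    d1 (A : measurableType d1) n (L : X -> seq A) :
  mseq n L -> mseq n (fun y : X * Y => L y.1).
Proof. by move=> mL; apply: (mseq_comp mL). Qed.

Lemma mseq_tval d (A : measurableType d) n : mseq n (@tval n A).
Proof. by apply: (mseq_tuple (f := id)); exact: measurable_id. Qed.

Lemma mseq_meas d (X : measurableType d) d1 (A : measurableType d1) d2 (B : measurableType d2)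
    n (L : X -> seq A) (g : seq A -> B) :
  mseq n L -> measurable_fun [set: n.-tuple A] (fun y => g (tval y)) ->
  measurable_fun [set: X] (fun x => g (L x)).
Proof.
move=> [c [mc LE]] mg.
pose f x : n.-tuple A := [tuple c i x | i < n].
have mf : measurable_fun setT f.
  apply/measurable_fun_tnthP => i; rewrite (_ : _ \o _ = c i)//.
  by apply/funext => x /=; rewrite tnth_mktuple.
rewrite (_ : (fun _ => _) = (fun y => g (tval y)) \o f); first exact: measurableT_comp.
by apply/funext => x /=; rewrite LE.
Qed.

Lemma mseq_cons d (X : measurableType d) d1 (A : measurableType d1)
    n (L : X -> seq A) (h : X -> A) :
  mseq n L -> measurable_fun [set: X] h -> mseq n.+1 (fun x => h x :: L x).
Proof.
move=> [c [mc LE]] mh.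
pose f x : n.-tuple A := [tuple c i x | i < n].
have mf : measurable_fun setT f.
  apply/measurable_fun_tnthP => i; rewrite (_ : _ \o _ = c i)//.
  by apply/funext => x /=; rewrite tnth_mktuple.
have [e [me EE]] := mseq_tuple (measurable_cons mh mf).
by exists e; split => // x; rewrite -EE /= LE.
Qed.

(** * The uniform law, and [iterE] as nested expectations *)

Section uniform.
Variable R : realType.
Local Open Scope ereal_scope.

Definition idTR : measurableTypeR R -> R := idfun.

HB.instance Definition _ :=
  @isMeasurableFun.Build _ _ _ _ idTR (@measurable_id _ _ setT).

(* The uniform law transported from [measurableTypeR R] to the display of
   [probability R R]. *)
Definition U : probability R R :=
  distribution (uniform_prob (@ltr01 R)) (idTR : {RV uniform_prob (@ltr01 R) >-> R}).

Lemma integralU (f : R -> \bar R) : measurable_fun [set: R] f -> (forall x, 0 <= f x) ->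
  \int[U]_x f x = \int[lebesgue_measure]_(x in `[0%R, 1%R]) f x.
Proof.
move=> mf f0; rewrite ge0_integral_distribution//=.
by rewrite integral_uniform// subr0 invr1 mul1e.
Qed.

Lemma le_iterE (F : probability R R) n (g1 g2 : seq (R * R) -> \bar R) :
  (forall s, size s = n -> 0 <= g1 s) -> (forall s, size s = n -> g1 s <= g2 s) ->
  iterE F n g1 <= iterE F n g2 /\ 0 <= iterE F n g1.
Proof.
elim: n g1 g2 => [|n IH] g1 g2 g0 g12 /=; first by split; [exact: g12|exact: g0].
have h z : iterE F n (fun s => g1 (z :: s)) <= iterE F n (fun s => g2 (z :: s)) /\
    0 <= iterE F n (fun s => g1 (z :: s)).
  by apply: IH => s sn; [apply: g0|apply: g12]; rewrite /= sn.
split.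
  apply: integral_mono => x _.
    by apply: integral_ge0 => t _; have [] := h (t, x).
  by apply: integral_mono => t _; have [] := h (t, x).
by apply: integral_ge0 => x _; apply: integral_ge0 => t _; have [] := h (t, x).
Qed.

Lemma iterE_mono (F : probability R R) n (g1 g2 : seq (R * R) -> \bar R) :
  (forall s, size s = n -> 0 <= g1 s) -> (forall s, size s = n -> g1 s <= g2 s) ->
  iterE F n g1 <= iterE F n g2.
Proof. by move=> g0 g12; have [] := le_iterE F g0 g12. Qed.

Lemma iterE_ge0 (F : probability R R) n (g : seq (R * R) -> \bar R) :
  (forall s, size s = n -> 0 <= g s) -> 0 <= iterE F n g.
Proof. by move=> g0; have [] := @le_iterE F n g g g0 (fun _ _ => lexx _). Qed.

(** [iterE] alternates values and times; Tonelli's theorem collects all values outside and all times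
    inside, so that the values can be fixed first. *)
Lemma iterE_nest (F : probability R R) n (g : seq (R * R) -> \bar R) :
  tmeas n g -> (forall s, 0 <= g s) ->
  iterE F n g = nest F n (fun xs => nest U n (fun ts => g (zip ts xs))).
Proof.
elim: n g => //= n IH g mg g0; apply: eq_integral => x _.
have mz : mseq n (fun q : R * n.-tuple R * n.-tuple R => zip q.2 q.1.2).
  apply: mseq_zip; first exact: (mseq_comp (@mseq_tval _ _ n)).
  apply: (mseq_comp (@mseq_tval _ _ n)); exact: measurableT_comp.
have mg' : measurable_fun [set: (R * n.-tuple R * n.-tuple R)%type]
    (fun q => g ((q.1.1, x) :: zip q.2 q.1.2)).
  apply: (@mseq_meas _ _ _ _ _ _ n.+1 (fun q : R * n.-tuple R * n.-tuple R => (q.1.1, x) :: zip q.2 q.1.2) g) => //.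
  by apply: mseq_cons => //; apply: measurable_fun_pair => //; exact: measurableT_comp.
under eq_integral => t _.
  rewrite (IH _ (tmeas_cons (t, x) mg))//.
  over.
have mn : measurable_fun [set: (R * n.-tuple R)%type]
   (fun q => nest U n (fun ts => g ((q.1, x) :: zip ts q.2))).
  by apply: (@nest_meas _ _ _ _ _ U n (fun (q : R * n.-tuple R) ts => g ((q.1, x) :: zip ts q.2))).
rewrite -integralU//=; last 2 first.
- apply: (@nest_meas _ _ _ _ _ F n (fun t xs => nest U n (fun ts => g ((t, x) :: zip ts xs)))) => //.
  by move=> *; apply: nest_ge0.
- by move=> t; apply: nest_ge0 => *; apply: nest_ge0.
rewrite (@nest_integralC _ _ _ _ _ F n (fun t xs => nest U n (fun ts => g ((t, x) :: zip ts xs))))//.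
by move=> t xs; apply: nest_ge0.
Qed.

End uniform.

(** * The threshold rule and its runs *)

Lemma mem_zip2 (S T : eqType) (s : seq S) (t : seq T) p :
  p \in zip s t -> p.2 \in t.
Proof.
elim: s t => [|x s IH] [|y t] //=; rewrite inE => /predU1P[->|/IH pt].
  exact: mem_head.
by rewrite ?in_cons pt orbT.
Qed.

Section rule.
Variable R : realType.
Implicit Types (t x rho w : R).

Definition lexle (a b : R * R) := (a.1 < b.1) || ((a.1 == b.1) && (a.2 <= b.2)).

Lemma lexle_refl : reflexive lexle.
Proof. by move=> a; rewrite /lexle eqxx lexx orbT. Qed.

Lemma lexle_total : total lexle.
Proof.
by move=> a b; rewrite /lexle; case: ltgtP => //= _; exact: le_total.
Qed.

Lemma lexle_trans : transitive lexle.
Proof.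
move=> b a c; rewrite /lexle => /orP[ab|/andP[/eqP ab ab2]] /orP[bc|/andP[/eqP bc bc2]].
- by rewrite (lt_trans ab bc).
- by rewrite -bc ab.
- by rewrite ab bc.
- by rewrite ab bc eqxx (le_trans ab2 bc2) orbT.
Qed.

Lemma lexle_anti : antisymmetric lexle.
Proof.
move=> [a1 a2] [b1 b2]; rewrite /lexle /=; case: ltgtP => //= -> /andP[ab ba].
by congr pair; apply/eqP; rewrite eq_le ab.
Qed.

(* Items are encoded as (arrival time, (value, tie-breaker)). *)
Definition mkitem (p : R * (R * R)) : R * (R * R) := (p.2.1, (p.2.2, p.1)).

Definition titems (r : seq R) (h : seq (R * R)) := [seq mkitem p | p <- zip r h].

Variable tau : R * R -> R.

(* [stopd l]: the rule accepting the first record [a] of [l] that arrives after its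
   threshold [tau a.2] accepts some item; [evt l]: it accepts the best item. *)
Definition stopd (l : seq (R * (R * R))) : bool :=
  has (fun a => (tau a.2 <= a.1) &&
     all (fun b => (b.1 < a.1) ==> lexle b.2 a.2) l) l.

Definition evt (l : seq (R * (R * R))) : bool :=
  has (fun a => [&& 0 <= a.2.1, tau a.2 <= a.1, all (fun b => lexle b.2 a.2) l &
     ~~ stopd [seq b <- l | b.1 < a.1]]) l.

Lemma stopd_perm l l' : perm_eq l l' -> stopd l = stopd l'.
Proof.
move=> ll'; rewrite /stopd (perm_has _ ll'); apply: eq_has => a.
by rewrite (perm_all _ ll').
Qed.

Lemma evt_perm l l' : perm_eq l l' -> evt l = evt l'.
Proof.
move=> ll'; rewrite /evt (perm_has _ ll'); apply: eq_has => a.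
by rewrite (perm_all _ ll') (stopd_perm (perm_filter _ ll')).
Qed.

(** The length of a filtered list depends on the sample, so [mseq] does not apply to it. With the
    filter moved into the predicates, the list keeps its fixed length. *)
Lemma stopd_filterE q l : stopd (seq.filter q l) =
  has (fun a => [&& q a, tau a.2 <= a.1 &
    all (fun b => q b ==> ((b.1 < a.1) ==> lexle b.2 a.2)) l]) l.
Proof.
rewrite /stopd; apply/hasP/hasP => [[a]|[a al /and3P[qa ta ha]]].
  rewrite mem_filter => /andP[qa al] /andP[ta].
  by rewrite all_filter => ha; exists a => //; rewrite qa ta.
by exists a; rewrite ?mem_filter ?qa// all_filter ta.
Qed.

(** An accepted record remains a record when none of the added items arrives before it. *)
Lemma stopd_filter_mono q1 q2 l : subpred q1 q2 ->
  (forall a b, q1 a -> q2 b -> ~~ q1 b -> a.1 <= b.1) ->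
  stopd (seq.filter q1 l) -> stopd (seq.filter q2 l).
Proof.
move=> q12 q12t; rewrite !stopd_filterE => /hasP[a al /and3P[qa ta /allP ha]].
apply/hasP; exists a => //; rewrite q12// ta/=; apply/allP => b bl.
apply/implyP => qb; apply/implyP => ba; move: (ha b bl) => /implyP.
case q1b : (q1 b); first by move=> /(_ isT); rewrite ba.
by have := q12t a b qa qb (negbT q1b); rewrite leNgt ba.
Qed.

Lemma stopd_cat l1 l2 : (forall a b, a \in l1 -> b \in l2 -> a.1 <= b.1) ->
  stopd l1 -> stopd (l1 ++ l2).
Proof.
move=> h /hasP[a al /andP[ta /allP ha]]; apply/hasP; exists a.
  by rewrite mem_cat al.
rewrite ta/=; apply/allP => b; rewrite mem_cat => /orP[|bl]; first exact: ha.
by apply/implyP => ba; have := h a b al bl; rewrite leNgt ba.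
Qed.

Lemma titems_cat r1 r2 h1 h2 : size r1 = size h1 ->
  titems (r1 ++ r2) (h1 ++ h2) = titems r1 h1 ++ titems r2 h2.
Proof. by move=> e; rewrite /titems zip_cat// map_cat. Qed.

Definition ind (b : bool) : \bar R := (b%:R)%:E.

Lemma ind_ge0 b : (0 <= ind b)%E.
Proof. by case: b; rewrite /ind lee_fin. Qed.

Lemma le_ind (b c : bool) : (b -> c) -> (ind b <= ind c)%E.
Proof. by move=> h; rewrite /ind lee_fin ler_nat; case: b h => // ->. Qed.

Lemma ind_le1 b : (ind b <= 1)%E.
Proof. exact: (@le_ind b true). Qed.

(* Probability, over independent uniform tie-breakers, that the threshold rule has
   stopped by the end of the history [h].  It grows along a run, so accepting as soon
   as the single seed [w] satisfies [w < psto h] reproduces the law of that rule. *)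
Definition psto (h : seq (R * R)) : \bar R :=
  nest (U R) (size h) (fun r => ind (stopd (titems r h))).

Lemma psto_cat h1 h2 : (forall a b, a \in h1 -> b \in h2 -> a.1 <= b.1) ->
  (psto h1 <= psto (h1 ++ h2))%E.
Proof.
move=> hh; rewrite /psto size_cat nest_cat.
apply: nest_mono => s sn; first exact: ind_ge0.
rewrite -[leLHS](nest_cst (U R) (size h2)).
apply: nest_mono => r rn; first exact: ind_ge0.
rewrite titems_cat//; apply: le_ind; apply: stopd_cat => a b.
move=> /mapP[[u p] /mem_zip2/= ph ->] /mapP[[v q] /mem_zip2/= qh ->].
exact: hh.
Qed.

Lemma psto_filter (q : pred (R * R)) h : psto (seq.filter q h) =
  nest (U R) (size h) (fun r => ind (stopd [seq a <- titems r h | q (a.1, a.2.1)])).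
Proof.
rewrite /psto /titems.
rewrite (nest_filter (U R) q h (fun l => ind (stopd [seq mkitem p | p <- l]))).
apply: eq_nest => r _; rewrite filter_map; congr (ind (stopd (map _ _))).
by apply: eq_filter => -[a [b c]].
Qed.

Lemma psto_ge0 h : (0 <= psto h)%E.
Proof. by apply: nest_ge0 => *; exact: ind_ge0. Qed.

Lemma psto_le1 h : (psto h <= 1)%E.
Proof.
rewrite -(nest_cst (U R) (size h) 1); apply: nest_mono => *.
  exact: ind_ge0.
exact: ind_le1.
Qed.

End rule.

Arguments ind {R} b : simpl never.

(** * Runs of an algorithm in arrival order *)

Section running.
Variable R : realType.

Lemma run_accept (A : algorithm R) Ft w h l1 a l2 :
  (forall k, (k < size l1)%N -> ~~ decide A Ft (h ++ take k.+1 l1) w) ->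
  decide A Ft (h ++ rcons l1 a) w ->
  run A Ft w h (l1 ++ a :: l2) = a.2.
Proof.
elim: l1 h => [|b l1 IH] h hk ha /=.
  by rewrite -cats1 ha.
have := hk 0%N isT; rewrite /= take0 cats1 => /negbTE ->.
apply: IH => [k kl|]; last by rewrite cat_rcons.
by have := hk k.+1 kl; rewrite /= cat_rcons.
Qed.

Lemma x_optE (s : seq (R * R)) a : a \in s -> 0 <= a.2 ->
  all (fun b => b.2 <= a.2) s -> x_opt s = a.2.
Proof.
move=> ain a0 /allP h; rewrite /x_opt; apply/eqP; rewrite eq_le; apply/andP; split.
  elim: s h {ain} => [|b s IH] h; first by rewrite big_nil.
  rewrite big_cons ge_max h ?mem_head//= IH// => c cs.
  by apply: h; rewrite inE cs orbT.
elim: s ain {h} => // b s IH; rewrite inE big_cons le_max => /predU1P[<-|/IH ->].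
  by rewrite lexx.
by rewrite orbT.
Qed.

(** With distinct times, the stretch before [a] in the sorted list consists exactly of the items
    with a smaller time. Positions in a run thereby turn into filters on times, which [psto]
    handles. *)
Lemma arrivals_split (s : seq (R * R)) a : uniq [seq b.1 | b <- s] -> a \in s ->
  exists l1 l2, [/\ arrivals s = l1 ++ a :: l2,
    perm_eq [seq b <- s | b.1 < a.1] l1,
    perm_eq [seq b <- s | b.1 <= a.1] (rcons l1 a) &
    pairwise (fun b c => b.1 <= c.1) (rcons l1 a)].
Proof.
move=> us ain.
have tot : total (fun b c : R * R => b.1 <= c.1) by move=> b c; exact: le_total.
have tr : transitive (fun b c : R * R => b.1 <= c.1) by move=> b c e; exact: le_trans.
have ps : perm_eq s (arrivals s) by rewrite perm_sym /arrivals perm_sort.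
have so : sorted (fun b c => b.1 <= c.1) (arrivals s) by apply: sort_sorted.
move: us; rewrite (perm_uniq (perm_map _ ps)).
have : a \in arrivals s by rewrite -(perm_mem ps).
move: so; rewrite sorted_pairwise//.
move E : (arrivals s) ps => l ps + al; move: ps E; case/splitPr : al => l1 l2 ps E.
rewrite pairwise_cat => /and3P[]; rewrite allrel_consr => /andP[l1a l1l2] pl1 /= /andP[al2 pl2].
rewrite map_cat cat_uniq /= => /and3P[ul1 + /andP[+ ul2]].
rewrite negb_or => /andP[nal1 _] nal2.
have h1 b : b \in l1 -> b.1 < a.1.
  move=> bl; rewrite lt_neqAle (allP l1a _ bl) andbT; apply: contraNneq nal1 => <-.
  exact: map_f.
have h2 b : b \in l2 -> a.1 < b.1.
  move=> bl; rewrite lt_neqAle (allP al2 _ bl) andbT; apply: contraNneq nal2 => ->.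
  exact: map_f.
exists l1, l2; split => //.
- rewrite (perm_trans (perm_filter _ ps))// filter_cat/= ltxx.
  rewrite (eq_in_filter (a2 := predT)); last by move=> b /h1 ->.
  rewrite filter_predT (eq_in_filter (a2 := pred0)); last first.
    by move=> b /h2 ab; rewrite ltNge (ltW ab).
  by rewrite filter_pred0 cats0.
- rewrite (perm_trans (perm_filter _ ps))// filter_cat/= lexx.
  rewrite (eq_in_filter (a2 := predT)); last by move=> b /h1 /ltW ->.
  rewrite filter_predT (eq_in_filter (a2 := pred0)); last first.
    by move=> b /h2 ab; rewrite leNgt ab.
  by rewrite filter_pred0 cats1.
- by rewrite pairwise_rcons l1a.
Qed.

End running.

(** * From success of the algorithm to success of the rule *)

Section meas_events.
Variable R : realType.
Notation I := (R * (R * R))%type.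
Variable tau : R * R -> R.
Hypothesis mtau : measurable_fun [set: (R * R)%type] tau.

Lemma measurable_lexle d (X : measurableType d) (f g : X -> R * R) :
  measurable_fun [set: X] f -> measurable_fun [set: X] g ->
  measurable_fun [set: X] (fun x => lexle (f x) (g x)).
Proof.
move=> mf mg; apply: measurable_or.
  by apply: measurable_fun_ltr; exact: measurableT_comp.
apply: measurable_and; first by apply: measurable_fun_eqr; exact: measurableT_comp.
by apply: measurable_fun_ler; exact: measurableT_comp.
Qed.

Lemma measurable_stopd_filter d (X : measurableType d) n (L : X -> seq I) (q : X -> I -> bool) : mseq n L ->
  measurable_fun [set: (X * I)%type] (fun p => q p.1 p.2) ->
  measurable_fun [set: X] (fun x => stopd tau (seq.filter (q x) (L x))).
Proof.
move=> mL mq; rewrite (_ : (fun _ => _) = fun x =>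
  has (fun a => [&& q x a, tau a.2 <= a.1 &
    all (fun b => q x b ==> ((b.1 < a.1) ==> lexle b.2 a.2)) (L x)]) (L x)); last first.
  by apply/funext => x; rewrite stopd_filterE.
apply: (measurable_has mL); apply: measurable_and => //.
apply: measurable_and.
  apply: measurable_fun_ler; last exact: measurableT_comp.
  by apply: measurableT_comp => //; exact: measurableT_comp.
apply: (measurable_all (mseq_fst _ mL)).
have m1 : measurable_fun [set: (X * I * I)%type] (fun z => z.1.1) by exact: measurableT_comp.
have m12 : measurable_fun [set: (X * I * I)%type] (fun z => z.1.2) by exact: measurableT_comp.
apply: measurable_imply.
  apply: (measurableT_comp mq (_ : measurable_fun setT (fun z : X * I * I => (z.1.1, z.2)))).
  exact: measurable_fun_pair.
apply: measurable_imply.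
  by apply: measurable_fun_ltr; exact: measurableT_comp.
by apply: measurable_lexle; exact: measurableT_comp.
Qed.

Lemma measurable_stopd d (X : measurableType d) n (L : X -> seq I) : mseq n L ->
  measurable_fun [set: X] (fun x => stopd tau (L x)).
Proof.
move=> mL; rewrite (_ : (fun _ => _) = fun x => stopd tau (seq.filter predT (L x))).
  by apply: (measurable_stopd_filter (q := fun _ => predT) mL).
by apply/funext => x; rewrite filter_predT.
Qed.

Lemma measurable_evt d (X : measurableType d) n (L : X -> seq I) : mseq n L ->
  measurable_fun [set: X] (fun x => evt tau (L x)).
Proof.
move=> mL; apply: (measurable_has mL).
have m12 : measurable_fun [set: (X * I)%type] (fun z => z.2.1) by exact: measurableT_comp.
have m22 : measurable_fun [set: (X * I)%type] (fun z => z.2.2) by exact: measurableT_comp.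
apply: measurable_and.
  by apply: measurable_fun_ler => //; exact: measurableT_comp.
apply: measurable_and.
  by apply: measurable_fun_ler => //; exact: measurableT_comp.
apply: measurable_and.
  apply: (measurable_all (mseq_fst _ mL)).
  apply: measurable_lexle; first exact: measurableT_comp.
  by apply: measurableT_comp => //; exact: measurableT_comp.
apply: measurable_neg.
apply: (@measurable_stopd_filter _ (X * I)%type n (fun z => L z.1)
  (fun z b => b.1 < z.2.1)); first exact: mseq_fst.
by apply: measurable_fun_ltr; apply: measurableT_comp => //; exact: measurableT_comp.
Qed.

End meas_events.

Section success_bound.
Variable R : realType.
Notation I := (R * (R * R))%type.
Variable tau : R * R -> R.
Hypothesis mtau : measurable_fun [set: (R * R)%type] tau.

Lemma mseq_titems d (X : measurableType d) n (L : X -> seq R) (M : X -> seq (R * R)) :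
  mseq n L -> mseq n M -> mseq n (fun x => titems (L x) (M x)).
Proof.
move=> mL mM; apply: mseq_map; first exact: mseq_zip.
apply: measurable_fun_pair; first exact: measurableT_comp.
by apply: measurable_fun_pair => //; exact: measurableT_comp.
Qed.

Lemma mseq_size d (X : measurableType d) d' (A : measurableType d') n
  (L : X -> seq A) x : mseq n L -> size (L x) = n.
Proof. by move=> [c [_ ->]]; rewrite size_map size_enum_ord. Qed.

Lemma mseq_snd d (X : measurableType d) d0 (Y : measurableType d0)
    d1 (A : measurableType d1) n (L : X -> seq A) :
  mseq n L -> mseq n (fun y : Y * X => L y.2).
Proof. by move=> mL; apply: (mseq_comp mL). Qed.

Lemma measurable_psto_filter d (X : measurableType d) n (L : X -> seq (R * R))
    (q : X -> R * R -> bool) : mseq n L ->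
  measurable_fun [set: (X * (R * R))%type] (fun p => q p.1 p.2) ->
  measurable_fun [set: X] (fun x => psto tau (seq.filter (q x) (L x))).
Proof.
move=> mL mq.
rewrite (_ : (fun _ => _) = fun x => nest (U R) n (fun r =>
   ind (stopd tau [seq a <- titems r (L x) | q x (a.1, a.2.1)]))); last first.
  by apply/funext => x; rewrite psto_filter (mseq_size x mL).
apply: nest_meas; last by move=> *; exact: ind_ge0.
apply: measurable_ind.
apply: (@measurable_stopd_filter _ _ mtau _ (X * n.-tuple R)%type n
  (fun z => titems z.2 (L z.1)) (fun z a => q z.1 (a.1, a.2.1))).
  by apply: mseq_titems; [exact: (mseq_snd _ (@mseq_tval _ _ n))|exact: mseq_fst].
apply: (measurableT_comp mq (_ : measurable_fun setT
   (fun p : X * n.-tuple R * I => (p.1.1, (p.2.1, p.2.2.1))))).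
apply: measurable_fun_pair; first exact: measurableT_comp.
apply: measurable_fun_pair; first exact: measurableT_comp.
by apply: measurableT_comp => //; exact: measurableT_comp.
Qed.

Lemma measurable_psto d (X : measurableType d) n (L : X -> seq (R * R)) :
  mseq n L -> measurable_fun [set: X] (fun x => psto tau (L x)).
Proof.
move=> mL; rewrite (_ : (fun _ => _) = fun x => psto tau (seq.filter predT (L x))).
  by apply: (measurable_psto_filter (q := fun _ => predT) mL).
by apply/funext => x; rewrite filter_predT.
Qed.

Lemma psto_perm h h' : perm_eq h h' -> psto tau h = psto tau h'.
Proof.
apply: (@nest_perm _ _ _ (U R) _ h h'
  (fun l => ind (stopd tau [seq mkitem p | p <- l]))).
- by move=> l l' ll'; rewrite (stopd_perm _ (perm_map _ ll')).
- move=> vs; apply: measurable_ind; apply: (measurable_stopd mtau (n := size vs)).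
  apply: (mseq_titems (L := @tval _ _) (M := fun _ => vs)); first exact: mseq_tval.
  by exists (fun i _ => tnth (in_tuple vs) i); split => // x; rewrite map_tnth_enum.
- by move=> l; exact: ind_ge0.
Qed.

(** Consequence: the sets of seeds that accept two items with different arrival times do not
    overlap. *)
Lemma psto_lt_le (s : seq (R * R)) (a b : R * R) : a.1 < b.1 ->
  (psto tau [seq c <- s | (c.1 <= a.1)%R] <= psto tau [seq c <- s | (c.1 < b.1)%R])%E.
Proof.
move=> ab; rewrite !psto_filter; apply: nest_mono => r _; first exact: ind_ge0.
apply: le_ind; apply: stopd_filter_mono => [c /= ca|c e /= ca eb].
  exact: le_lt_trans ca ab.
by rewrite -ltNge => ae; rewrite (le_trans ca (ltW ae)).
Qed.

Definition uniqt (s : seq (R * R)) := uniq [seq b.1 | b <- s].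

(* With distinct arrival times, the item [a] is accepted by the seed [w] and has
   the maximal value. *)
Definition accB (w : R) (s : seq (R * R)) (a : R * R) :=
  [&& 0 <= a.2, all (fun b => b.2 <= a.2) s,
      (psto tau [seq b <- s | (b.1 < a.1)%R] <= w%:E)%E &
      (w%:E < psto tau [seq b <- s | (b.1 <= a.1)%R])%E].

Definition evB w s := uniqt s && has (accB w s) s.

Lemma measurable_uniq d (X : measurableType d) n (L : X -> seq R) : mseq n L ->
  measurable_fun [set: X] (fun x => uniq (L x)).
Proof.
move=> [c [mc LE]].
rewrite (_ : (fun _ => _) = fun x => uniq [seq c i x | i <- enum 'I_n]); last first.
  by apply/funext => x; rewrite LE.
elim: (enum 'I_n) => [//|i r IH] /=; apply: measurable_and => //.
rewrite (_ : (fun _ => _) = fun x => ~~ has (fun j => c j x == c i x) r); last first.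
  apply/funext => x; congr negb; apply/mapP/hasP => [[j jr ->]|[j jr /eqP ji]].
    by exists j.
  by exists j.
apply: measurable_neg; elim: r {IH} => //= j r IH; apply: measurable_or => //.
exact: measurable_fun_eqr.
Qed.

Lemma measurable_evB d (X : measurableType d) n (L : X -> seq (R * R)) (W : X -> R) :
  mseq n L -> measurable_fun [set: X] W ->
  measurable_fun [set: X] (fun x => evB (W x) (L x)).
Proof.
move=> mL mW; apply: measurable_and.
  by apply: measurable_uniq; exact: (mseq_map mL).
apply: (measurable_has mL).
have m21 : measurable_fun [set: (X * (R * R))%type] (fun z => z.2.1) by exact: measurableT_comp.
have m22 : measurable_fun [set: (X * (R * R))%type] (fun z => z.2.2) by exact: measurableT_comp.
have m12 : measurable_fun [set: (X * (R * R) * (R * R))%type] (fun z => z.1.2).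
  exact: measurableT_comp.
have mLf := mseq_fst (R * R)%type mL.
have mWE : measurable_fun [set: (X * (R * R))%type] (fun z => (W z.1)%:E).
  by apply/measurable_EFinP; exact: measurableT_comp.
apply: measurable_and; first by apply: measurable_fun_ler.
apply: measurable_and.
  apply: (measurable_all mLf).
  by apply: measurable_fun_ler; exact: measurableT_comp.
apply: measurable_and.
  apply: measurable_fun_lee => //.
  apply: (measurable_psto_filter (q := fun z b => b.1 < z.2.1) mLf).
  by apply: measurable_fun_ltr; exact: measurableT_comp.
apply: measurable_fun_lte => //.
apply: (measurable_psto_filter (q := fun z b => b.1 <= z.2.1) mLf).
by apply: measurable_fun_ler; exact: measurableT_comp.
Qed.

(** A prefix that ends before [a] has [psto] at most that of all items preceding [a], hence at most
    [w]: nothing is accepted so far. At [a] the value exceeds [w]. Permutation invariance of [psto]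
    identifies sorted prefixes with filters on times. *)
Lemma evB_accept (A : algorithm R) Ft w s :
  (forall h, decide A Ft h w = (w%:E < psto tau h)%E) ->
  evB w s -> success A Ft w s.
Proof.
move=> hA /andP[us /hasP[a ain /and4P[a0 amax wlo whi]]].
rewrite /success (x_optE ain a0 amax) /x_alg.
have [l1 [l2 [-> p1 p2 pw]]] := arrivals_split us ain.
apply/eqP; apply: run_accept => [k kl|]; rewrite hA cat0s; last by rewrite -(psto_perm p2).
rewrite -leNgt; apply: le_trans wlo; rewrite (psto_perm p1).
rewrite -[in leRHS](cat_take_drop k.+1 l1); apply: psto_cat => b c bt cd.
move: pw; rewrite pairwise_rcons => /andP[_].
rewrite -(cat_take_drop k.+1 l1) pairwise_cat => /and3P[/allrelP h _ _].
exact: h.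
Qed.

End success_bound.

Definition algo (R : realType) (tau : probability R R -> R * R -> R) : algorithm R :=
  Algorithm (fun Ft h w => (w%:E < psto (tau Ft) h)%E).

Lemma algo_measurable (R : realType) (tau : probability R R -> R * R -> R) :
  (forall Ft, measurable_fun [set: (R * R)%type] (tau Ft)) ->
  alg_measurable (algo tau).
Proof.
move=> mtau Ft k /=.
have : measurable_fun [set: (k.+1.-tuple (R * R) * R)%type]
    (fun p => (p.2%:E < psto (tau Ft) (tval p.1))%E).
  apply: measurable_fun_lte; first exact/measurable_EFinP.
  by apply: (measurable_psto (mtau Ft) (n := k.+1)); exact: (mseq_fst _ (@mseq_tval _ _ _)).
move=> /(_ measurableT [set true] I); rewrite setTI.
by congr measurable; apply/seteqP; split => p /=.
Qed.

(** * Integrating out the seed *)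

Section seed_integral.
Variable R : realType.
Notation I := (R * (R * R))%type.
Variable tau : R * R -> R.
Hypothesis mtau : measurable_fun [set: (R * R)%type] tau.

(** The length of [[a, b[], in additive form so as not to subtract extended reals. *)
Lemma integralU_itv (a b : \bar R) : (0 <= a)%E -> (a <= b)%E -> (b <= 1)%E ->
  (a + \int[U R]_w ind ((a <= w%:E)%E && (w%:E < b)%E) = b)%E.
Proof.
move=> a0 ab b1.
have bfin : b \is a fin_num.
  by rewrite ge0_fin_numE ?(le_lt_trans b1) ?ltry// (le_trans a0).
have afin : a \is a fin_num by rewrite ge0_fin_numE// (le_lt_trans ab)// -ge0_fin_numE// (le_trans a0).
rewrite -(fineK bfin) -(fineK afin).
rewrite -(fineK bfin) -(fineK afin) in a0 ab b1.
move: (fine a) (fine b) a0 ab b1 => {afin bfin} {}a {}b; rewrite !lee_fin => a0 ab b1.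
rewrite integralU; last 2 first.
- apply: measurable_ind; apply: measurable_and.
    by apply: measurable_fun_lee => //; exact/measurable_EFinP.
  by apply: measurable_fun_lte => //; exact/measurable_EFinP.
- by move=> w; exact: ind_ge0.
have -> : (fun w => ind ((a%:E <= w%:E)%E && (w%:E < b%:E)%E)) =
    (fun w => (\1_(`[a, b[%classic : set (measurableTypeR R)) w)%:E) :> (R -> \bar R).
  by apply/funext => w; rewrite indicE mem_setE /ind lee_fin lte_fin in_itv.
rewrite integral_indic//= setIidl.
  rewrite lebesgue_measure_itv/= lte_fin; case: ltP => [_|ba].
    by rewrite -EFinB -EFinD addrC subrK.
  by rewrite adde0; congr EFin; apply/eqP; rewrite eq_le ab.
move=> w /=; rewrite !in_itv /= => /andP[aw wb].
by rewrite (le_trans a0 aw) (le_trans (ltW wb) b1).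
Qed.

Lemma nest_sum d (T : measurableType d) (P : probability T R) n (K : Type) (s : seq K)
    (f : K -> seq T -> \bar R) :
  (forall k, tmeas n (f k)) -> (forall k r, 0 <= f k r)%E ->
  (nest P n (fun r => \sum_(k <- s) f k r) = \sum_(k <- s) nest P n (f k))%E.
Proof.
move=> mf f0; elim: s => [|k s IH].
  by under eq_nest do rewrite big_nil; rewrite nest_cst big_nil.
under eq_nest do rewrite big_cons.
rewrite nestD ?IH ?big_cons//; first exact: emeasurable_sum.
by move=> r; exact: sume_ge0.
Qed.

Lemma count_le1 (K : eqType) (phi : pred K) (s : seq K) : uniq s ->
  {in s &, forall a b, phi a -> phi b -> a = b} -> count phi s = has phi s.
Proof.
elim: s => //= a s IH /andP[as_ us] h.
rewrite IH//; last by move=> b c bs cs; apply: h; rewrite inE ?bs ?cs orbT.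
case pa : (phi a) => //=; case: hasP => // -[b bs pb].
have e : a = b by apply: h; rewrite ?mem_head// inE bs orbT.
by move: as_; rewrite e bs.
Qed.

Lemma uniqt_inj (s : seq (R * R)) a b : uniqt s -> a \in s -> b \in s -> a.1 = b.1 -> a = b.
Proof.
rewrite /uniqt; elim: s => //= c s IH /andP[ncs us].
rewrite !inE => /predU1P[->|as_] /predU1P[->|bs] // e.
- by move: ncs; rewrite e map_f.
- by move: ncs; rewrite -e map_f.
- exact: IH.
Qed.

Lemma accB_inj w s : uniqt s -> {in s &, forall a b, accB tau w s a -> accB tau w s b -> a = b}.
Proof.
move=> us a b as_ bs /and4P[_ _ lo hi] /and4P[_ _ lo' hi'].
have [ab|ba|/(uniqt_inj us as_ bs)//] := ltgtP a.1 b.1.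
- have := lt_le_trans hi (le_trans (psto_lt_le tau s ab) lo').
  by rewrite ltxx.
- have := lt_le_trans hi' (le_trans (psto_lt_le tau s ba) lo).
  by rewrite ltxx.
Qed.

Definition topx (s : seq (R * R)) (a : R * R) := (0 <= a.2) && all (fun b => b.2 <= a.2) s.

Definition stop_at (L : seq I) (t : R) :=
  stopd tau [seq b <- L | b.1 <= t] && ~~ stopd tau [seq b <- L | b.1 < t].

Lemma mseq_titems_cst n s : size s = n -> mseq n (fun r : n.-tuple R => titems (tval r) s).
Proof.
move=> sn; apply: (mseq_titems (L := @tval _ _) (M := fun _ => s)); first exact: mseq_tval.
exists (fun i _ => tnth (tcast sn (in_tuple s)) i); split => // x.
by rewrite map_tnth_enum val_tcast.
Qed.

Lemma measurable_stop_at s t :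
  measurable_fun [set: (size s).-tuple R] (fun r => stop_at (titems (tval r) s) t).
Proof.
have mL := mseq_titems_cst (erefl (size s)).
apply: measurable_and.
  apply: (measurable_stopd_filter mtau (q := fun _ b => b.1 <= t) mL).
  by apply: measurable_fun_ler => //; exact: measurableT_comp.
apply: measurable_neg.
apply: (measurable_stopd_filter mtau (q := fun _ b => b.1 < t) mL).
by apply: measurable_fun_ltr => //; exact: measurableT_comp.
Qed.

(** The seeds accepting [a] form the interval between two values of [psto]. Its length is the
    probability, over the tie-breakers, that the rule has stopped by time [a.1] but not strictly
    before: the single seed reproduces the randomized rule. *)
Lemma integral_accB s a : (\int[U R]_w ind (accB tau w s a) =
  nest (U R) (size s) (fun r => ind (topx s a && stop_at (titems r s) a.1)))%E.
Proof.
have -> : (fun w => ind (accB tau w s a) : \bar R) = (fun w => (ind (topx s a) *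
   ind ((psto tau [seq b <- s | (b.1 < a.1)%R] <= w%:E)%E &&
        (w%:E < psto tau [seq b <- s | (b.1 <= a.1)%R])%E))%E).
  apply/funext => w; rewrite /accB /topx andbA; case: (_ && all _ _) => /=.
    by rewrite /ind mul1e.
  by rewrite /ind mul0e.
case tx : (topx s a) => /=; last first.
  under eq_integral do rewrite /ind mul0e.
  by rewrite integral0 nest_cst.
under eq_integral do rewrite /ind mul1e.
have psplit : psto tau [seq b <- s | b.1 <= a.1] = (psto tau [seq b <- s | (b.1 < a.1)%R] +
    nest (U R) (size s) (fun r => ind (stop_at (titems r s) a.1)))%E.
  rewrite !psto_filter -nestD; last 4 first.
  - apply: measurable_ind.
    apply: (measurable_stopd_filter mtau (q := fun _ b => b.1 < a.1)
      (mseq_titems_cst (erefl (size s)))).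
    by apply: measurable_fun_ltr => //; exact: measurableT_comp.
  - by apply: measurable_ind; exact: measurable_stop_at.
  - by move=> r; exact: ind_ge0.
  - by move=> r; exact: ind_ge0.
  apply: eq_nest => r _; rewrite /stop_at /=.
  have : stopd tau [seq b <- titems r s | b.1 < a.1] -> stopd tau [seq b <- titems r s | b.1 <= a.1].
    apply: stopd_filter_mono => [c /= /ltW//|c e /= ca ea].
    by rewrite -leNgt; apply: le_trans; exact: ltW.
  case: (stopd _ _) => [->//=|_].
    by rewrite /ind -EFinD addr0.
  by rewrite andbT /ind -EFinD add0r.
have := @integralU_itv (psto tau [seq b <- s | (b.1 < a.1)%R]) (psto tau [seq b <- s | (b.1 <= a.1)%R])
   (psto_ge0 _ _) _ (psto_le1 _ _).
have P0 := psto_ge0 tau [seq b <- s | b.1 < a.1].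
have Pfin : psto tau [seq b <- s | b.1 < a.1] \is a fin_num.
  by rewrite ge0_fin_numE// (le_lt_trans (psto_le1 _ _))// ltry.
have N0 : (0 <= nest (U R) (size s) (fun r => ind (stop_at (titems r s) a.1)))%E.
  by apply: nest_ge0 => *; exact: ind_ge0.
move: psplit; set P' := psto tau [seq b <- s | b.1 <= a.1] => psplit.
have PP' : (psto tau [seq b <- s | (b.1 < a.1)%R] <= P')%E by rewrite psplit leeDl.
move=> /(_ PP'); rewrite {2}psplit => e; apply/eqP; rewrite eq_le.
by rewrite -(leeD2lE _ _ Pfin) e lexx -(leeD2lE _ _ Pfin) e lexx.
Qed.

(** Several items may share the maximal value. [evt] requires the lexicographically best of them,
    whereas success accepts any; this is why only one implication is stated and only a lower bound
    follows. *)
Lemma evt_top r s : size r = size s -> evt tau (titems r s) ->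
  has (fun a => topx s a && stop_at (titems r s) a.1) s.
Proof.
move=> rs /hasP[c cl /and4P[c0 tc /allP hc nst]].
have /mapP[[u a] pin ce] := cl.
apply/hasP; exists a; first exact: (mem_zip2 pin).
apply/andP; split.
  apply/andP; split; first by move: c0; rewrite ce.
  apply/allP => b; rewrite -[s in b \in s](@unzip2_zip _ _ r s) ?rs// => /mapP[p pz ->].
  have := hc (mkitem p) (map_f _ pz); rewrite ce /lexle /=.
  by move=> /orP[/ltW|/andP[/eqP->]].
have -> : a.1 = c.1 by rewrite ce.
rewrite /stop_at nst andbT; apply/hasP; exists c; first by rewrite mem_filter lexx.
rewrite tc/=; apply/allP => b; rewrite mem_filter => /andP[_ bl].
by apply/implyP => _; exact: hc.
Qed.

Lemma integral_evB s : (nest (U R) (size s) (fun r => ind (uniqt s && evt tau (titems r s))) <=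
  \int[U R]_w ind (evB tau w s))%E.
Proof.
rewrite /evB; case us : (uniqt s) => /=; last first.
  by rewrite nest_cst integral_ge0// => *; exact: ind_ge0.
have us' : uniq s by move: us; exact: map_uniq.
(* At most one item is accepted by a given seed, so the indicator of the union is the sum of the
   indicators. *)
have -> : (fun w => ind (has (accB tau w s) s) : \bar R) =
    (fun w => \sum_(a <- s) ind (accB tau w s a))%E.
  apply/funext => w; rewrite /ind sumEFin -natr_sum -big_mkcond/= sum1_count.
  by rewrite (count_le1 us' (accB_inj us)).
have mB a : measurable_fun [set: R] (fun w => ind (accB tau w s a)).
  have mp (h : seq (R * R)) : measurable_fun [set: R] (fun w : R => psto tau h).
    exact: measurable_cst.
  apply: measurable_ind; apply: measurable_and => //; apply: measurable_and => //.
  apply: measurable_and.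
    by apply: measurable_fun_lee => //; exact/measurable_EFinP.
  by apply: measurable_fun_lte => //; exact/measurable_EFinP.
rewrite ge0_integral_sum//; last by move=> *; exact: ind_ge0.
under eq_bigr do rewrite integral_accB.
rewrite -nest_sum; last 2 first.
- move=> a; apply: measurable_ind; apply: measurable_and => //; exact: measurable_stop_at.
- by move=> *; exact: ind_ge0.
apply: nest_mono => r rs; first exact: ind_ge0.
rewrite /ind sumEFin -natr_sum -big_mkcond/= sum1_count lee_fin ler_nat.
by case ev : (evt _ _) => //; rewrite -has_count; exact: evt_top.
Qed.

End seed_integral.

(** Tonelli's theorem moves the seed innermost, where for fixed values and times it is traded for
    [n] independent tie-breakers. *)
Lemma success_prob_ge (R : realType) (tau : probability R R -> R * R -> R)
    (mtau : forall Ft, measurable_fun [set: (R * R)%type] (tau Ft)) n (Ft F : probability R R) :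
  (nest F n (fun xs => nest (U R) n (fun ts => nest (U R) n (fun r =>
     ind (uniqt (zip ts xs) && evt (tau Ft) (titems r (zip ts xs)))))) <=
   success_prob (algo tau) n Ft F)%E.
Proof.
rewrite /success_prob.
apply: (@le_trans _ _ (\int[lebesgue_measure]_(w in `[0%R, 1%R])
     iterE F n (fun s => ind (evB (tau Ft) w s)))%E); last first.
  apply: integral_mono => w _.
    by apply: iterE_ge0 => *; exact: ind_ge0.
  apply: iterE_mono => s _; first exact: ind_ge0.
  by apply: le_ind; apply: evB_accept.
have mB w : tmeas n (fun s => ind (evB (tau Ft) w s)).
  apply: measurable_ind.
  by apply: (measurable_evB (mtau Ft) (W := fun _ => w)); [exact: mseq_tval|].
under eq_integral => w _.
  rewrite iterE_nest//; last by move=> *; exact: ind_ge0.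
  over.
rewrite /=.
have mz : mseq n (fun q : R * n.-tuple R * n.-tuple R => zip q.2 q.1.2).
  apply: mseq_zip; first exact: (mseq_snd _ (@mseq_tval _ _ n)).
  apply: (mseq_comp (@mseq_tval _ _ n)); exact: measurableT_comp.
have mBz : measurable_fun [set: (R * n.-tuple R * n.-tuple R)%type]
    (fun q => ind (evB (tau Ft) q.1.1 (zip q.2 q.1.2)) : \bar R).
  by apply: measurable_ind; apply: (measurable_evB (mtau Ft) mz); exact: measurableT_comp.
have mn : ptmeas n (fun w xs => nest (U R) n (fun ts => ind (evB (tau Ft) w (zip ts xs)))).
  apply: (@nest_meas _ _ _ _ _ (U R) n (fun (q : R * n.-tuple R) ts => ind (evB (tau Ft) q.1 (zip ts q.2)))) => //.
  by move=> *; exact: ind_ge0.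
have n0 w xs : (0 <= nest (U R) n (fun ts => ind (evB (tau Ft) w (zip ts xs))))%E.
  by apply: nest_ge0 => *; exact: ind_ge0.
rewrite -integralU; last 2 first.
- by apply: (@nest_meas _ _ _ _ _ F n (fun w xs => nest (U R) n (fun ts => ind (evB (tau Ft) w (zip ts xs))))).
- by move=> w; exact: nest_ge0.
rewrite (@nest_integralC _ _ _ _ _ F n (fun w xs => nest (U R) n (fun ts => ind (evB (tau Ft) w (zip ts xs)))))//.
apply: nest_mono => xs xsn.
  by apply: nest_ge0 => *; apply: nest_ge0 => *; exact: ind_ge0.
rewrite (@nest_integralC _ _ _ _ _ (U R) n (fun w ts => ind (evB (tau Ft) w (zip ts xs)))); last 2 first.
- rewrite /ptmeas.
  have m1 : measurable_fun [set: (R * n.-tuple R)%type]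
     (fun q : R * n.-tuple R => (q.1, tcast xsn (in_tuple xs), q.2)).
    by apply: measurable_fun_pair => //; apply: measurable_fun_pair.
  have := measurableT_comp mBz m1; congr measurable_fun; apply/funext => q /=.
  by rewrite val_tcast.
- by move=> *; exact: ind_ge0.
apply: nest_mono => ts tsn.
  by apply: nest_ge0 => *; exact: ind_ge0.
have zn : size (zip ts xs) = n by rewrite size_zip tsn xsn minnn.
by rewrite -[X in nest _ X]zn; exact: integral_evB.
Qed.

(** * Conditioning on the values: integration over arrival times *)

Section times.
Variable R : realType.
Notation leb01 f := (\int[lebesgue_measure]_(t in `[0%R, 1%R]) f t)%E.

Lemma measurable_ltc (c : R) : measurable_fun [set: R] (fun z : R => z < c).
Proof. by apply: measurable_fun_ltr. Qed.

Lemma leb01_lt (c : R) : 0 <= c -> c <= 1 ->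
  (\int[lebesgue_measure]_(t in `[0%R, 1%R]) ind (t < c)%R)%E = c%:E.
Proof.
move=> c0 c1.
have := @integralU_itv R 0%E c%:E (lexx _) c0 c1.
rewrite add0e integralU; last 2 first.
- apply: measurable_ind; apply: measurable_and.
    by apply: measurable_fun_lee => //; exact/measurable_EFinP.
  by apply: measurable_fun_lte => //; exact/measurable_EFinP.
- by move=> w; exact: ind_ge0.
move=> <-; apply: eq_integral => t; rewrite inE/= in_itv/= => /andP[t0 _].
by rewrite lee_fin lte_fin t0.
Qed.

Lemma leb01_cst (c : R) : (\int[lebesgue_measure]_(t in `[0%R, 1%R]) (c%:E : \bar R))%E = c%:E.
Proof.
rewrite integral_cst//= lebesgue_measure_itv/= lte_fin ltr01.
by rewrite sube0 mule1.
Qed.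

(* Given that the best item arrives at time [t], and with [l] the increasing list of
   thresholds of the other items, the probability that no item is accepted before [t]. *)
Fixpoint Ir (t : R) (l : seq R) : R :=
  if l is th :: l' then Num.min th t + (1 - t) * Ir t l' else 1.

Lemma Ir_ge0 t l : 0 <= t <= 1 -> all (>= 0) l -> 0 <= Ir t l.
Proof.
move=> /andP[t0 t1]; elim: l => //= th l IH /andP[th0 l0].
by rewrite addr_ge0 ?le_min ?th0// mulr_ge0 ?subr_ge0// IH.
Qed.

(** [th / t] is the fixed point of [c = th + (1 - t) * c]. Thresholds that are all at least [th]
    keep the recursion of [Ir] above it, starting from [1 >= th / t]. *)
Lemma Ir_ge t th l : 0 < t <= 1 -> 0 <= th <= t -> all (>= th) l -> th / t <= Ir t l.
Proof.
move=> /andP[t0 t1] /andP[th0 tht]; elim: l => /= [_|x l IH /andP[thx thl]].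
  by rewrite ler_pdivrMr ?mul1r.
have h := IH thl.
have e : th / t = th + (1 - t) * (th / t) by field; rewrite gt_eqF.
rewrite e lerD ?le_min ?thx// ler_wpM2l// subr_ge0.
exact: t1.
Qed.

(** Let [th] be the least threshold. For [s < t] the integrand is [t * [s < th]] plus [1 - t] times
    the same product without [th]: below [th] all factors are 1, by sortedness, and
    [1 = t + (1 - t)]. Integrating turns this into [t] times the recursion of [Ir]. *)
Lemma leb01_prod t l : 0 <= t <= 1 -> sorted <=%R l -> all (fun th => 0 <= th <= 1) l ->
  (\int[lebesgue_measure]_(s in `[0%R, 1%R])
    (if (s < t)%R then \prod_(th <- l) (if (th <= s)%R then 1 - t else 1)%R else 0)%R%:E)%E =
  (t * Ir t l)%:E.
Proof.
move=> /andP[t0 t1]; elim: l => /= [_ _|th l IH thl /andP[/andP[th0 th1] l01]].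
  rewrite mulr1 -[RHS]leb01_lt//; apply: eq_integral => s _.
  by rewrite big_nil /ind; case: ifP.
have sl : sorted <=%R l by exact: path_sorted thl.
have thall : all (fun x => th <= x) l by rewrite (order_path_min _ thl)//; exact: le_trans.
set m := Num.min th t.
have m0 : 0 <= m by rewrite le_min th0.
have m1 : m <= 1 by rewrite ge_min th1.
have mI (c : R) : measurable_fun [set: measurableTypeR R] (fun s => (ind (s < c) : \bar R)).
  exact: measurable_ind (measurable_ltc c).
pose G s := if s < t then \prod_(x <- l) (if x <= s then 1 - t else 1) else 0 : R.
have mG : measurable_fun [set: measurableTypeR R] (EFin \o G).
  apply/measurable_EFinP; apply: measurable_fun_ifT => //; first exact: measurable_ltc.
  apply: measurable_prod => x _; apply: measurable_fun_ifT => //.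
  by apply: measurable_fun_ler.
have G0 s : 0 <= G s.
  rewrite /G; case: ifP => // _; apply: prodr_ge0 => x _.
  by case: ifP => // _; rewrite subr_ge0.
transitivity (leb01 (fun s => (t%:E * ind (s < m)%R + (1 - t)%:E * (G s)%:E)%E)).
  apply: eq_integral => s; rewrite inE/= in_itv/= => /andP[s0 s1].
  rewrite big_cons /G lt_min; case: (ltP s t) => st; rewrite /ind; last first.
    by rewrite andbF !mule0 adde0.
  rewrite andbT; case: ltP => sth.
    rewrite mul1r.
    have -> : \prod_(x <- l) (if x <= s then 1 - t else 1) = 1.
      rewrite big_seq; apply: big1 => x xl; rewrite ifF// leNgt.
      by rewrite (lt_le_trans sth (allP thall _ xl)).
    by rewrite -!EFinM -EFinD !mulr1 addrC subrK.
  by rewrite -!EFinM -EFinD mulr0 add0r.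
transitivity (leb01 (fun s => (t%:E * ind (s < m)%R)%E) +
              leb01 (fun s => ((1 - t)%:E * (G s)%:E)%E))%E.
  apply: ge0_integralD => //.
  - by move=> s _; rewrite mule_ge0// ?lee_fin// ind_ge0.
  - by apply: measurable_funTS; exact: measurable_funeM.
  - by move=> s _; rewrite mule_ge0// lee_fin ?subr_ge0.
  - by apply: measurable_funTS; exact: measurable_funeM.
have -> : leb01 (fun s => (t%:E * ind (s < m)%R)%E) = (t * m)%:E.
  transitivity (t%:E * leb01 (fun s => ind (s < m)%R))%E.
    apply: ge0_integralZl => //; first exact: measurable_funTS (mI m).
    by move=> s _; exact: ind_ge0.
  by rewrite EFinM; congr mule; exact: leb01_lt.
have -> : leb01 (fun s => ((1 - t)%:E * (G s)%:E)%E) = ((1 - t) * (t * Ir t l))%:E.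
  transitivity ((1 - t)%:E * leb01 (fun s => (G s)%:E))%E.
    apply: ge0_integralZl => //; first exact: measurable_funTS mG.
      by move=> s _; rewrite lee_fin.
    by rewrite lee_fin subr_ge0.
  by rewrite [RHS]EFinM; congr mule; exact: IH.
by rewrite -EFinD; congr EFin; rewrite mulrDr mulrCA.
Qed.

End times.

Section core.
Variable R : realType.
Notation leb01 f := (\int[lebesgue_measure]_(t in `[0%R, 1%R]) f t)%E.

Lemma intU_lt (c : R) : 0 <= c -> c <= 1 -> (\int[U R]_z ind (z < c)%R)%E = c%:E.
Proof.
move=> c0 c1; rewrite integralU; first exact: leb01_lt.
  exact: measurable_ind (measurable_ltc c).
by move=> z; exact: ind_ge0.
Qed.

Lemma intU_split (m t c : R) : 0 <= m -> m <= 1 -> 0 <= t -> t <= 1 -> 0 <= c ->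
  (\int[U R]_z (ind (z < m)%R + c%:E * ind (~~ (z < t)%R)))%E = (m + (1 - t) * c)%:E.
Proof.
move=> m0 m1 t0 t1 c0.
have mI (b : R) : measurable_fun [set: R] (fun s : R => (ind (s < b) : \bar R)).
  exact: measurable_ind (measurable_ltc b).
have mN (b : R) : measurable_fun [set: R] (fun s : R => (ind (~~ (s < b)) : \bar R)).
  by apply: measurable_ind; apply: measurable_neg; exact: measurable_ltc.
transitivity (\int[U R]_z ind (z < m)%R + \int[U R]_z (c%:E * ind (~~ (z < t)%R)))%E.
  apply: ge0_integralD => //.
  - by move=> *; exact: ind_ge0.
  - by move=> *; rewrite mule_ge0 ?lee_fin ?ind_ge0.
  - exact: measurable_funeM.
rewrite intU_lt// EFinD; congr adde.
transitivity (c%:E * \int[U R]_z ind (~~ (z < t)%R))%E.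
  by apply: ge0_integralZl => // *; exact: ind_ge0.
rewrite [in RHS]mulrC EFinM; congr mule.
have : (\int[U R]_z (ind (z < t)%R + ind (~~ (z < t)%R)) = 1)%E.
  under eq_integral => z _.
    have -> : (ind (z < t)%R + ind (~~ (z < t)%R) = 1 :> \bar R)%E.
      by case: (z < t) => /=; rewrite /ind -EFinD ?addr0 ?add0r.
    over.
  by rewrite integral_cst// mul1e [LHS]probability_setT.
have -> : (\int[U R]_z (ind (z < t)%R + ind (~~ (z < t)%R)) =
    \int[U R]_z ind (z < t)%R + \int[U R]_z ind (~~ (z < t)%R))%E.
  by apply: ge0_integralD => // *; exact: ind_ge0.
rewrite intU_lt// => /(congr1 (fun x => x - t%:E)%E).
by rewrite addeAC subee// add0e EFinB.
Qed.

Variable tau : R * R -> R.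
Hypothesis mtau : measurable_fun [set: (R * R)%type] tau.
Hypothesis tau01 : forall v, 0 <= tau v <= 1.
Hypothesis tau_anti : forall a b, lexle a b -> tau b <= tau a.

(* For [l] sorted by decreasing rank: the best item arriving before [t], if any,
   arrives before its own threshold. *)
Fixpoint goodb (t : R) (l : seq (R * (R * R))) : bool :=
  if l is a :: l' then if a.1 < t then a.1 < tau a.2 else goodb t l' else true.

(** Let [a] be the best item before [t], and suppose that a record [c] of lower rank is accepted
    before [t]. Then [c] does not arrive after [a], so [tau c <= c.1 <= a.1 < tau a], whereas a
    lower rank has a larger threshold. *)
Lemma goodb_stopd t l : pairwise (fun a b => lexle b.2 a.2 && ~~ lexle a.2 b.2) l ->
  goodb t l -> ~~ stopd tau [seq b <- l | b.1 < t].
Proof.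
elim: l => //= a l IH /andP[/allP al pl].
case: ifP => [at_ ga|_]; last exact: IH.
apply/hasPn => c; rewrite inE => /predU1P[->|].
  by rewrite leNgt ga.
rewrite mem_filter => /andP[ct cl]; have /andP[lca nac] := al _ cl.
apply/negP => /andP[tc /andP[+ _]]; rewrite (negbTE nac) implybF -leNgt => ca.
have := le_lt_trans (le_trans (le_trans (tau_anti lca) tc) ca) ga.
by rewrite ltxx.
Qed.

(** The recursion of [Ir] read on arrival times: the top item arrives before both [t] and its
    threshold, which settles the matter, or not before [t], with probability [1 - t], and the next
    item decides. *)
Lemma nest_goodb t vs : 0 <= t <= 1 ->
  nest (U R) (size vs) (fun r => ind (goodb t (zip r vs))) = (Ir t (map tau vs))%:E.
Proof.
move=> /andP[t0 t1]; elim: vs => //= v vs IH.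
have I0 : 0 <= Ir t (map tau vs).
  apply: Ir_ge0; first by rewrite t0.
  by apply/allP => _ /mapP[w _ ->]; have /andP[] := tau01 w.
have /andP[v0 v1] := tau01 v.
rewrite -intU_split ?le_min ?ge_min ?v0 ?v1//.
apply: eq_integral => z _; rewrite lt_min; case: (ltP z t) => zt /=.
  by rewrite nest_cst andbT {2}/ind mule0 adde0.
by rewrite IH andbF /ind mule1 add0e.
Qed.

Lemma measurable_evt_times n (vs : seq (R * R)) : size vs = n ->
  tmeas n (fun ts => ind (evt tau (zip ts vs)) : \bar R).
Proof.
move=> vn; apply: measurable_ind; apply: (measurable_evt mtau (n := n)).
apply: (mseq_zip (M := fun _ => vs)); first exact: mseq_tval.
exists (fun i _ => tnth (tcast vn (in_tuple vs)) i); split => // x.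
by rewrite map_tnth_enum val_tcast.
Qed.

Definition gtlex (a b : R * R) := lexle b a && ~~ lexle a b.

Lemma goodb_evt z v vs r : size r = size vs -> 0 <= v.1 -> pairwise gtlex (v :: vs) ->
  tau v <= z -> goodb z (zip r vs) -> evt tau ((z, v) :: zip r vs).
Proof.
move=> rs v0 /= /andP[/allP vtop pvs] tz gz.
rewrite /evt; apply/hasP; exists (z, v); first exact: mem_head.
rewrite /= v0 tz ltxx lexle_refl/=; apply/andP; split.
  by apply/allP => p /mem_zip2 /vtop /andP[].
apply: goodb_stopd => //; move: pvs.
by rewrite -{1}(@unzip2_zip _ _ r vs) ?rs// pairwise_map.
Qed.

(** Conditioning on the arrival time [t] of the best item [v]: once [tau v <= t], it suffices that
    nothing was accepted earlier, which [goodb] ensures. *)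
Lemma evt_lower v vs : 0 <= v.1 -> pairwise gtlex (v :: vs) ->
  (leb01 (fun t => ind (tau v <= t)%R * (Ir t (map tau vs))%:E) <=
   nest (U R) (size (v :: vs)) (fun ts => ind (evt tau (zip ts (v :: vs)))))%E.
Proof.
move=> v0 pv /=; rewrite integralU; last 2 first.
- apply: (@nest_meas _ _ _ _ _ (U R) (size vs) (fun z ts => ind (evt tau ((z, v) :: zip ts vs)) : \bar R)).
    have mc : measurable_fun [set: (R * (size vs).-tuple R)%type]
       (fun q => [tuple of q.1 :: q.2]) by exact: measurable_cons.
    exact: (measurableT_comp (@measurable_evt_times (size vs).+1 (v :: vs) erefl) mc).
  by move=> *; exact: ind_ge0.
- by move=> z; apply: nest_ge0 => *; exact: ind_ge0.
apply: integral_mono => z; rewrite /= in_itv/= => z01.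
  rewrite mule_ge0 ?ind_ge0// lee_fin Ir_ge0//.
  by apply/allP => _ /mapP[w _ ->]; have /andP[] := tau01 w.
case tz : (tau v <= z); last first.
  by rewrite /ind mul0e nest_ge0// => *; rewrite lee_fin.
rewrite {1}/ind mul1e -nest_goodb//; apply: nest_mono => r rs; first exact: ind_ge0.
by apply: le_ind; exact: goodb_evt.
Qed.

(** Arrival times are exchangeable and [evt] ignores the order of the list, so the items may be
    relabelled by decreasing rank. Distinct pairs make the order strict. *)
Lemma evt_sort vs : uniq vs -> exists vs', [/\ perm_eq vs vs', pairwise gtlex vs' &
  nest (U R) (size vs) (fun ts => ind (evt tau (zip ts vs))) =
  nest (U R) (size vs') (fun ts => ind (evt tau (zip ts vs')))].
Proof.
move=> us; pose ge := fun a b : R * R => lexle b a.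
have tot : total ge by move=> a b; exact: lexle_total.
have tr : transitive ge by move=> b a c ba cb; exact: lexle_trans cb ba.
have ps : perm_eq vs (sort ge vs) by rewrite perm_sym perm_sort.
exists (sort ge vs); split => //.
- have : pairwise (fun a b => ge a b && (a != b)) (sort ge vs).
    rewrite pairwise_relI -sorted_pairwise// sort_sorted//= -uniq_pairwise.
    by rewrite sort_uniq.
  apply: sub_pairwise => a b /andP[ab ne]; rewrite /gtlex; apply/andP; split => //.
  by apply: contra ne => ba; apply/eqP; apply: lexle_anti; rewrite ba.
- apply: (@nest_perm _ _ _ (U R) _ vs _ (fun l => ind (evt tau l))) => //.
  + by move=> l l' /evt_perm ->.
  + by move=> ws; exact: measurable_evt_times.
  + by move=> l; exact: ind_ge0.
Qed.

Lemma evt_robust vs : uniq vs -> vs != [::] -> all (fun v => 0 <= v.1) vs ->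
  exists2 th, (exists v, th = tau v) &
   (leb01 (fun t => ind (th <= t)%R * (th / t)%:E) <=
    nest (U R) (size vs) (fun ts => ind (evt tau (zip ts vs))))%E.
Proof.
move=> us vs0 vpos; have [[|v vs'] [pvs pv ->]] := evt_sort us.
  by move: vs0; rewrite -size_eq0 (perm_size pvs).
have v0 : 0 <= v.1 by apply: (allP vpos); rewrite (perm_mem pvs) mem_head.
exists (tau v); first by exists v.
apply: le_trans (evt_lower v0 pv).
have /andP[tv0 tv1] := tau01 v.
apply: integral_mono => t; rewrite /= in_itv/= => /andP[t0 t1].
  by rewrite mule_ge0 ?ind_ge0// lee_fin divr_ge0.
case tvt : (tau v <= t); last by rewrite /ind !mul0e.
rewrite /ind !mul1e lee_fin.
have tls : all (>= tau v) (map tau vs').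
  apply/allP => _ /mapP[w wv ->]; move: pv => /= /andP[/allP /(_ _ wv) /andP[wv' _] _].
  exact: tau_anti.
(* At [t = 0] the quotient [th / t] is 0 by convention. *)
case: (eqVneq t 0) => [->|tn0].
  rewrite invr0 mulr0 Ir_ge0// ?lexx ?ler01//.
  by apply: sub_all tls => x; apply: le_trans.
by apply: Ir_ge => //; rewrite ?t1 ?tv0 ?tvt// andbT lt_neqAle eq_sym tn0.
Qed.

(* With [N_s := #{v in vs | tau v <= s}], this is
   [1[1 <= N_t] * (1 - t) ^ (maxn N_s 1 - 1) / t] for [s < t < 1]: the conditional
   success density, written with products so that independence applies. *)
Definition Yf (vs : seq (R * R)) (s t : R) : R :=
  if [&& 0 <= s, s < t & t < 1] then
    ((\prod_(v <- vs) (if tau v <= s then 1 - t else 1)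
      - t * \prod_(v <- vs) (s < tau v)%R%:R) / (1 - t)
     - \prod_(v <- vs) (t < tau v)%R%:R) / t
  else 0.

Lemma prod_ind (K : Type) (p : pred K) (l : seq K) :
  \prod_(k <- l) (p k)%:R = (all p l)%:R :> R.
Proof.
elim: l => [|k l IH]; first by rewrite big_nil.
by rewrite big_cons IH /=; case: (p k); rewrite ?mul1r ?mul0r.
Qed.

Lemma Yf_ge0 vs s t : 0 <= Yf vs s t.
Proof.
rewrite /Yf; case: ifP => // /and3P[s0 st t1].
have t0 : 0 < t by exact: le_lt_trans st.
have t1' : 0 < 1 - t by rewrite subr_gt0.
rewrite divr_ge0 ?(ltW t0)// !prod_ind.
case as_ : (all (fun v => s < tau v) vs).
  rewrite big_seq big1 => [|v vv]; last by rewrite leNgt (allP as_ _ vv).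
  by rewrite mulr1 divff ?gt_eqF// subr_ge0 lern1 leq_b1.
have -> : all (fun v => t < tau v) vs = false.
  apply: contraFF as_ => /allP h; apply/allP => v /h; exact: lt_trans.
rewrite mulr0 !subr0 divr_ge0 ?(ltW t1')//; apply: prodr_ge0 => v _.
by case: ifP => // _; exact: ltW.
Qed.

(** [v] has the least threshold, and its position decides: above [t] both sides vanish; in []s, t]]
    the product over [vs] is 1; at most [s], dividing by [1 - t] removes the factor of [v] itself.
    Equality is lost only at [t = 1], where [Yf] is set to 0. *)
Lemma Yf_sorted v vs s t : 0 <= s -> t <= 1 -> pairwise gtlex (v :: vs) ->
  Yf (v :: vs) s t <= (tau v <= t)%R%:R * t^-1 *
   (if s < t then \prod_(w <- vs) (if tau w <= s then 1 - t else 1) else 0).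
Proof.
move=> s0 t1 pv; rewrite /Yf s0 /=; case: (ltP s t) => st /=; last by rewrite mulr0.
have t0 : 0 < t by exact: le_lt_trans st.
have vw w : w \in vs -> tau v <= tau w.
  by move: pv => /= /andP[/allP h _] /h /andP[+ _]; exact: tau_anti.
case: (ltP t 1) => [{}t1|_]; last first.
  rewrite !mulr_ge0 ?invr_ge0 ?(ltW t0)//; apply: prodr_ge0 => w _.
  by case: ifP => // _; rewrite subr_ge0.
have t1' : 1 - t != 0 by rewrite subr_eq0 gt_eqF.
have prod1 : s < tau v -> \prod_(w <- vs) (if tau w <= s then 1 - t else 1) = 1.
  move=> sv; rewrite big_seq big1// => w wv.
  by rewrite leNgt (lt_le_trans sv (vw _ wv)).
have all1 r : r < tau v -> \prod_(w <- vs) (r < tau w)%R%:R = 1 :> R.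
  move=> rv; rewrite big_seq big1// => w wv.
  by rewrite (lt_le_trans rv (vw _ wv)).
rewrite !big_cons; case: (ltP t (tau v)) => tv.
  rewrite (lt_trans st tv)/= (leNgt _ s) (lt_trans st tv)/=.
  rewrite prod1 ?(lt_trans st tv)// !all1 ?(lt_trans st tv)//.
  by rewrite !mul1r !mulr1 (divff t1') subrr !mul0r.
case: (ltP s (tau v)) => sv /=.
  by rewrite prod1// all1// !mul1r !mul0r !mulr1 subr0 (divff t1') mul1r.
by rewrite !mul0r mulr0 !subr0 mul1r [(1 - t) * _]mulrC mulfK// mulrC.
Qed.

Lemma Yf_perm vs vs' s t : perm_eq vs vs' -> Yf vs s t = Yf vs' s t.
Proof. by move=> p; rewrite /Yf !(perm_big _ p). Qed.

Lemma evt_density vs : uniq vs -> vs != [::] -> all (fun v => 0 <= v.1) vs ->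
  (leb01 (fun t => leb01 (fun s => (Yf vs s t)%:E)) <=
    nest (U R) (size vs) (fun ts => ind (evt tau (zip ts vs))))%E.
Proof.
move=> us vs0 vpos; have [[|v vs'] [pvs pv ->]] := evt_sort us.
  by move: vs0; rewrite -size_eq0 (perm_size pvs).
have v0 : 0 <= v.1 by apply: (allP vpos); rewrite (perm_mem pvs) mem_head.
apply: le_trans (evt_lower v0 pv).
apply: integral_mono => t; rewrite /= in_itv/= => /andP[t0 t1].
  apply: integral_ge0 => s; rewrite /= in_itv/= => /andP[s0 s1].
  by rewrite lee_fin Yf_ge0.
have c0 : 0 <= (tau v <= t)%R%:R * t^-1 by rewrite mulr_ge0 ?invr_ge0.
have mG : measurable_fun [set: measurableTypeR R] (fun s => (if s < t
   then \prod_(w <- map tau vs') (if w <= s then 1 - t else 1) else 0)%:E).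
  apply/measurable_EFinP; apply: measurable_fun_ifT => //; first exact: measurable_ltc.
  apply: measurable_prod => x _; apply: measurable_fun_ifT => //.
  by apply: measurable_fun_ler.
have G0 s : 0 <= (if s < t
   then \prod_(w <- map tau vs') (if w <= s then 1 - t else 1) else 0).
  case: ifP => // _; apply: prodr_ge0 => x _.
  by case: ifP => // _; rewrite subr_ge0.
apply: (@le_trans _ _ (leb01 (fun s => (((tau v <= t)%R%:R * t^-1)%:E * (if (s < t)%R
   then \prod_(w <- map tau vs') (if (w <= s)%R then 1 - t else 1)%R else 0)%R%:E)%E))).
  apply: integral_mono => s; rewrite /= in_itv/= => /andP[s0 s1].
    by rewrite lee_fin Yf_ge0.
  by rewrite (Yf_perm _ _ pvs) -EFinM lee_fin big_map; exact: Yf_sorted.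
have -> : leb01 (fun s => (((tau v <= t)%R%:R * t^-1)%:E * (if (s < t)%R
   then \prod_(w <- map tau vs') (if (w <= s)%R then 1 - t else 1)%R else 0)%R%:E)%E) =
   (((tau v <= t)%R%:R * t^-1)%:E * (t * Ir t (map tau vs'))%:E)%E.
  rewrite -leb01_prod ?t0 ?t1//.
  - apply: ge0_integralZl => //; first exact: measurable_funTS mG.
    by move=> s _; rewrite lee_fin.
  - rewrite sorted_pairwise; last exact: le_trans.
    rewrite pairwise_map; move: pv => /= /andP[_]; apply: sub_pairwise => a b /andP[+ _].
    exact: tau_anti.
  - by apply/allP => _ /mapP[w _ ->].
rewrite /ind -!EFinM lee_fin; case: (eqVneq t 0) => [->|tn0].
  rewrite mul0r mulr0 mulr_ge0 ?Ir_ge0 ?lexx ?ler01//.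
  by apply/allP => _ /mapP[w _ ->]; have /andP[] := tau01 w.
by rewrite -mulrA mulKf.
Qed.

End core.

(** * Discarding the null events: negative values, equal tie-breakers, equal times *)

Section combine.
Variable R : realType.

Lemma ae_notin (pre : seq R) : {ae U R, forall z, z \notin pre}.
Proof.
have cpre : countable ([set` pre] : set R).
  by apply: finite_set_countable; exact: finite_seq.
have mpre : measurable ([set` pre] : set (measurableTypeR R)).
  by apply: countable_measurable.
exists [set` pre]; split; first exact: mpre.
- have /null_content_dominatesP := @dominates_uniform_prob R 0 1 ltr01.
  by apply => //; exact: countable_lebesgue_measure0.
- by move=> z /= /negP; rewrite negbK.
Qed.

Lemma titems_zip (r ts xs : seq R) : size r = size xs -> size ts = size xs ->
  titems r (zip ts xs) = zip ts (zip xs r).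
Proof.
elim: xs r ts => [|x xs IH] [|a r] [|t ts] //= [rs] [ts'].
by rewrite /titems/= -/(titems r (zip ts xs)) IH.
Qed.

Lemma uniqt_zip (ts xs : seq R) : size ts = size xs -> uniqt (zip ts xs) = uniq ts.
Proof. by move=> e; rewrite /uniqt -/(unzip1 _) unzip1_zip// e. Qed.

Lemma okl_uniq pre (s : seq R) : okl (fun p z => z \notin p) pre s ->
  uniq s /\ {in s, forall z, z \notin pre}.
Proof.
elim: s pre => //= z s IH pre [zp /IH [us h]]; split.
  by rewrite us andbT; apply/negP => /h; rewrite inE eqxx.
move=> y; rewrite inE => /predU1P[->//|/h]; rewrite inE negb_or => /andP[_ ->] //.
Qed.

Lemma okl_all (p : R -> Prop) pre s : okl (fun _ => p) pre s -> forall z, z \in s -> p z.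
Proof.
elim: s pre => //= z s IH pre [zp /IH h] y; rewrite inE => /predU1P[->//|].
exact: h.
Qed.

Variable tau : probability R R -> R * R -> R.
Hypothesis mtau : forall Ft, measurable_fun [set: (R * R)%type] (tau Ft).

(** Reduces both guarantees to a bound for fixed nonnegative values and distinct tie-breakers.
    Tie-breakers are exchanged with arrival times by [nestC], so that [Phi] bounds a probability
    over the times alone. Distinct tie-breakers make the ranks distinct even when the values
    coincide. *)
Lemma success_lower n (Ft F : probability R R) (Phi : seq R -> seq R -> \bar R) :
  nonneg_dist F ->
  measurable_fun [set: (n.-tuple R * n.-tuple R)%type]
    (fun q => Phi (tval q.1) (tval q.2)) ->
  (forall xs r, 0 <= Phi xs r)%E ->
  (forall xs r, size xs = n -> size r = n -> all (>= 0) xs -> uniq r ->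
    (Phi xs r <= nest (U R) n (fun ts => ind (evt (tau Ft) (zip ts (zip xs r)))))%E) ->
  (nest F n (fun xs => nest (U R) n (Phi xs)) <= success_prob (algo tau) n Ft F)%E.
Proof.
move=> F0 mPhi Phi0 hPhi.
apply: le_trans (success_prob_ge mtau n Ft F).
pose X3 : measurableType _ := (n.-tuple R * n.-tuple R * n.-tuple R)%type.
have mi1 : measurable_fun [set: X3] (fun q : X3 => q.1.1) by exact: measurableT_comp.
have mi2 : measurable_fun [set: X3] (fun q : X3 => q.1.2) by exact: measurableT_comp.
have mt1 : mseq n (fun q : X3 => tval q.1.1) by exact: mseq_tuple.
have mt2 : mseq n (fun q : X3 => tval q.1.2) by exact: mseq_tuple.
have mt3 : mseq n (fun q : X3 => tval q.2) by exact: mseq_tuple.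
have mz : mseq n (fun q : X3 => titems q.2 (zip q.1.2 q.1.1)).
  by apply: mseq_titems => //; exact: mseq_zip.
have mE : measurable_fun [set: X3] (fun q : X3 =>
   ind (uniqt (zip q.1.2 q.1.1) && evt (tau Ft) (titems q.2 (zip q.1.2 q.1.1))) : \bar R).
  apply: measurable_ind; apply: measurable_and.
    by apply: measurable_uniq; apply: (mseq_map (mseq_zip mt2 mt1)).
  exact: (measurable_evt (mtau Ft) mz).
have aeF : {ae F, forall z, 0 <= z}.
  exists (~` `[0, +oo[%classic); split.
  - exact: measurableC.
  - by rewrite probability_setC// (F0 : F _ = _) subee.
  - by move=> z /=; rewrite in_itv/= andbT.
apply: (@nest_ae_le _ _ _ F n (fun _ z => 0 <= z) [::]) => //.
- exact: (@nest_meas _ _ _ _ _ (U R) n (fun xs : n.-tuple R => Phi xs)).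
- apply: (@nest_meas _ _ _ _ _ (U R) n (fun (xs : n.-tuple R) ts => nest (U R) n (fun r =>
      ind (uniqt (zip ts xs) && evt (tau Ft) (titems r (zip ts xs)))))).
    apply: (@nest_meas _ _ _ _ _ (U R) n (fun (q : n.-tuple R * n.-tuple R) r =>
      ind (uniqt (zip q.2 q.1) && evt (tau Ft) (titems r (zip q.2 q.1))))) => //.
    by move=> *; exact: ind_ge0.
  by move=> *; apply: nest_ge0 => *; exact: ind_ge0.
- by move=> *; exact: nest_ge0.
- by move=> *; apply: nest_ge0 => *; apply: nest_ge0 => *; exact: ind_ge0.
move=> xs xsn /okl_all xs0.
pose xt : n.-tuple R := tcast xsn (in_tuple xs).
have xtE : tval xt = xs by rewrite /xt val_tcast.
have mE2 : measurable_fun [set: (n.-tuple R * n.-tuple R)%type] (fun q =>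
   ind (uniqt (zip q.1 xs) && evt (tau Ft) (titems q.2 (zip q.1 xs))) : \bar R).
  have m3 : measurable_fun [set: (n.-tuple R * n.-tuple R)%type]
      (fun q => (xt, q.1, q.2) : X3).
    by apply: measurable_fun_pair => //; exact: measurable_fun_pair.
  have := measurableT_comp mE m3; congr measurable_fun; apply/funext => q /=.
  by rewrite xtE.
rewrite (nestC _ _ mE2); last by move=> *; exact: ind_ge0.
have mE2' : measurable_fun [set: (n.-tuple R * n.-tuple R)%type] (fun q =>
   ind (uniqt (zip q.2 xs) && evt (tau Ft) (titems q.1 (zip q.2 xs))) : \bar R).
  exact: (measurableT_comp mE2 (measurable_fun_pair measurable_snd measurable_fst)).
apply: (@nest_ae_le _ _ _ (U R) n (fun p z => z \notin p) [::]).
- exact: ae_notin.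
- rewrite /tmeas -xtE; exact: (measurableT_comp mPhi (measurable_pair1 xt)).
- apply: (@nest_meas _ _ _ _ _ (U R) n (fun (r : n.-tuple R) ts =>
    ind (uniqt (zip ts xs) && evt (tau Ft) (titems r (zip ts xs))))) => //.
  by move=> *; exact: ind_ge0.
- by [].
- by move=> *; apply: nest_ge0 => *; exact: ind_ge0.
move=> r rn /okl_uniq[ur _]; apply: le_trans (hPhi xs r xsn rn _ ur) _.
  by apply/allP => x /xs0.
have rt : exists y : n.-tuple R, tval y = r by exists (tcast rn (in_tuple r)); rewrite val_tcast.
have [y yE] := rt.
have szr : size (zip xs r) = n by rewrite size_zip xsn rn minnn.
apply: (@nest_ae_le _ _ _ (U R) n (fun p z => z \notin p) [::]).
- exact: ae_notin.
- exact: measurable_evt_times.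
- rewrite /tmeas -yE; exact: (measurableT_comp mE2' (measurable_pair1 y)).
- by move=> *; exact: ind_ge0.
- by move=> *; exact: ind_ge0.
move=> ts tsn /okl_uniq[uts _]; apply: le_ind.
by rewrite uniqt_zip ?tsn// uts titems_zip ?rn ?tsn.
Qed.

End combine.

(** * Robustness *)

Section robustness.
Variable R : realType.
Notation leb01 f := (\int[lebesgue_measure]_(t in `[0%R, 1%R]) f t)%E.

(** Inversion is discontinuous at 0; it is rebuilt piecewise from [ln] and [expR], with the
    convention that 0 inverts to 0. *)
Lemma measurable_invr : measurable_fun [set: R] (fun x : R => x^-1).
Proof.
have -> : (fun x : R => x^-1) = (fun x => if 0 < x then expR (- ln x)
    else if x < 0 then - expR (- ln (- x)) else 0).
  apply/funext => x; case: ltgtP => [x0|x0|<-]; last by rewrite invr0.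
    by rewrite expRN lnK ?posrE.
  by rewrite expRN lnK ?posrE ?oppr_gt0// invrN opprK.
apply: measurable_fun_ifT => //; first by apply: measurable_fun_ltr.
  apply: measurableT_comp => //; apply: measurableT_comp => //.
apply: measurable_fun_ifT => //; first by apply: measurable_fun_ltr.
apply: measurableT_comp => //; apply: measurableT_comp => //.
apply: measurableT_comp => //; exact: measurableT_comp.
Qed.

Lemma integral_inv (a b : R) : 0 < a -> a <= b ->
  (\int[lebesgue_measure]_(t in `[a, b]) (t^-1)%:E = (ln b - ln a)%:E)%E.
Proof.
move=> a0; rewrite le_eqVlt => /predU1P[->|ab].
  by rewrite set_itv1 integral_set1 subrr.
have c x : a <= x -> {for x, continuous (fun t : R => t^-1)}.
  move=> ax; apply: inv_continuous; rewrite gt_eqF//; exact: lt_le_trans ax.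
rewrite (@continuous_FTC2 _ _ (@ln R))//.
- apply: continuous_in_subspaceT => x; rewrite inE/= in_itv/= => /andP[ax _].
  exact: c.
- split.
  + move=> x; rewrite in_itv/= => /andP[ax _].
    by apply: ex_derive; apply: is_derive1_ln; exact: lt_trans ax.
  + by apply: cvg_at_right_filter; exact: continuous_ln.
  + by apply: cvg_at_left_filter; apply: continuous_ln; exact: lt_trans ab.
- move=> x; rewrite in_itv/= => /andP[ax _].
  have x0 : 0 < x by exact: lt_trans ax.
  by rewrite derive1E; have [_ ->] := is_derive1_ln x0.
Qed.

(** On [[th, 1]] the integrand is [th / t], of integral [- th * ln th], and [1 / t] is continuous
    there since [th > 0]. For [th = 0] the claim is mere nonnegativity. *)
Lemma leb01_inv (th : R) : 0 <= th -> th <= 1 ->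
  ((negxlnx th)%:E <= leb01 (fun t => ind (th <= t)%R * (th / t)%:E))%E.
Proof.
move=> th0 th1; have ge0 t : 0 <= t -> (0 <= ind (th <= t)%R * (th / t)%:E)%E.
  by move=> t0; rewrite mule_ge0 ?ind_ge0// lee_fin divr_ge0.
rewrite /negxlnx; case: eqVneq => [_|thn0].
  by apply: integral_ge0 => t; rewrite /= in_itv/= => /andP[t0 _]; exact: ge0.
have th0' : 0 < th by rewrite lt_neqAle eq_sym thn0.
have mi : measurable_fun [set: measurableTypeR R] (fun t : R => ((th / t)%:E : \bar R)).
  by apply/measurable_EFinP; apply: measurable_funM => //; exact: measurable_invr.
have -> : (- (th * ln th))%:E = (\int[lebesgue_measure]_(t in `[th, 1%R]) (th / t)%:E)%E.
  transitivity (th%:E * \int[lebesgue_measure]_(t in `[th, 1%R]) (t^-1)%:E)%E.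
    by rewrite integral_inv// ln1 sub0r -EFinM mulrN.
  under [RHS]eq_integral do rewrite EFinM.
  apply/esym; apply: ge0_integralZl => //.
  - by apply: measurable_funTS; apply/measurable_EFinP; exact: measurable_invr.
  - move=> t; rewrite /= in_itv/= => /andP[tht _].
    by rewrite lee_fin invr_ge0; exact: le_trans tht.
apply: (@le_trans _ _ (\int[lebesgue_measure]_(t in `[th, 1%R])
    (ind (th <= t)%R * (th / t)%:E))%E).
  apply: integral_mono => t; rewrite /= in_itv/= => /andP[tht _].
    by rewrite lee_fin divr_ge0//; exact: le_trans tht.
  by rewrite tht /ind mul1e.
apply: ge0_subset_integral => //.
- apply: measurable_funTS; apply: emeasurable_funM; last exact: mi.
  by apply: measurable_ind; apply: measurable_fun_ler.
- by move=> t; rewrite /= in_itv/= => /andP[t0 _]; exact: ge0.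
- move=> t; rewrite /= !in_itv/= => /andP[tht ->].
  by rewrite (le_trans th0 tht).
Qed.

Lemma negxlnx_ge0 (x : R) : 0 <= x -> x <= 1 -> 0 <= negxlnx x.
Proof.
move=> x0 x1; rewrite /negxlnx; case: ifP => // _.
by rewrite oppr_ge0 mulr_ge0_le0// ln_le0.
Qed.

(* The graph of the concave function [negxlnx] lies below its tangents. *)
Lemma negxlnx_tangent (x y : R) : 0 < x -> 0 < y ->
  negxlnx y <= negxlnx x - (ln x + 1) * (y - x).
Proof.
move=> x0 y0; rewrite /negxlnx !gt_eqF//.
have h : ln x - ln y <= x / y - 1.
  rewrite -ln_div ?posrE//.
  have := @le_ln1Dx R (x / y - 1); rewrite [1 + _]addrC subrK; apply.
  by rewrite ltrBrDl subrr divr_gt0.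
have : y * (ln x - ln y) <= y * (x / y - 1) by rewrite ler_wpM2l// ltW.
rewrite (_ : y * (x / y - 1) = x - y); last by field; rewrite gt_eqF.
lra.
Qed.

(** Concavity, through the tangent at [x]: according to the sign of its slope it is evaluated at
    [l2] or at [l1], where it is at least [beta] and at most the value at [x]. The case [l1 = 0],
    where [beta = 0], is separate because [negxlnx_tangent] asks for positive points. *)
Lemma negxlnx_between (l1 l2 beta x : R) : 0 <= l1 -> l2 <= 1 ->
  negxlnx l1 = beta -> negxlnx l2 = beta -> l1 <= x <= l2 -> beta <= negxlnx x.
Proof.
move=> l10 l21 h1 h2 /andP[l1x xl2].
have x0 : 0 <= x by exact: le_trans l1x.
case: (eqVneq l1 0) => [l1E|l1n0].
  rewrite -h1 l1E {1}/negxlnx eqxx; apply: negxlnx_ge0 => //; exact: le_trans l21.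
have l1p : 0 < l1 by rewrite lt_neqAle eq_sym l1n0.
have xp : 0 < x by exact: lt_le_trans l1x.
have t1 := negxlnx_tangent xp l1p; have t2 := negxlnx_tangent xp (lt_le_trans xp xl2).
rewrite h1 in t1; rewrite h2 in t2.
have [c0|c0] := leP 0 (ln x + 1).
  have : 0 <= (ln x + 1) * (l2 - x) by rewrite mulr_ge0// subr_ge0.
  lra.
have : 0 <= (ln x + 1) * (l1 - x) by apply: mulr_le0; [exact: ltW|rewrite subr_le0].
lra.
Qed.

Variable tau : probability R R -> R * R -> R.
Hypothesis mtau : forall Ft, measurable_fun [set: (R * R)%type] (tau Ft).
Hypothesis tau_anti : forall Ft a b, lexle a b -> tau Ft b <= tau Ft a.
Variables (l1 l2 beta : R).
Hypotheses (l10 : 0 <= l1) (l21 : l2 <= 1).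
Hypothesis tau_itv : forall Ft v, l1 <= tau Ft v <= l2.
Hypotheses (h1 : negxlnx l1 = beta) (h2 : negxlnx l2 = beta).

Lemma tau_01 Ft v : 0 <= tau Ft v <= 1.
Proof. by have /andP[a b] := tau_itv Ft v; rewrite (le_trans l10 a) (le_trans b l21). Qed.

Lemma zip_uniqr (xs r : seq R) : size xs = size r -> uniq r -> uniq (zip xs r).
Proof.
move=> e ur; have : uniq (unzip2 (zip xs r)) by rewrite unzip2_zip// e.
exact: map_uniq.
Qed.

Lemma zip_all1 (xs r : seq R) : all (>= 0) xs -> all (fun v => 0 <= v.1) (zip xs r).
Proof. by elim: xs r => [|x xs IH] [|a r] //= /andP[-> /IH ->]. Qed.

Lemma algo_robust n : (0 < n)%N -> robust (algo tau) n beta%:E.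
Proof.
move=> n0 F Ft F0 _.
have b0 : 0 <= beta.
  rewrite -h1; apply: negxlnx_ge0 => //; have /andP[a b] := tau_itv F (0, 0).
  exact: le_trans a (le_trans b l21).
have := @success_lower R tau mtau n Ft F (fun _ _ => beta%:E) F0.
rewrite nest_cst nest_cst; apply => //.
move=> xs r xsn rn xs0 ur.
have szr : size (zip xs r) = n by rewrite size_zip xsn rn minnn.
have [] := @evt_robust R (tau Ft) (mtau Ft) (tau_01 Ft) (@tau_anti Ft) (zip xs r).
- by apply: zip_uniqr => //; rewrite xsn.
- by rewrite -size_eq0 szr -lt0n.
- exact: zip_all1.
move=> th [v ->]; rewrite szr; apply: le_trans.
have /andP[t0 t1] := tau_01 Ft v.
apply: le_trans (leb01_inv t0 t1).
by rewrite lee_fin; apply: negxlnx_between h1 h2 _.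
Qed.

End robustness.

(** * Expectation over the values *)

Section expectation.
Variable R : realType.
Variable F : probability R R.

Section product.
Variable f : R * R -> R.
Hypothesis mf : measurable_fun [set: (R * R)%type] f.
Hypothesis f01 : forall v, 0 <= f v <= 1.

Let fb x : R := fine (\int[U R]_r (f (x, r))%:E)%E.

Let f0 v : 0 <= f v. Proof. by have /andP[] := f01 v. Qed.

Let fbE x : ((fb x)%:E = \int[U R]_r (f (x, r))%:E)%E.
Proof.
rewrite fineK// ge0_fin_numE; last by apply: integral_ge0 => r _; rewrite lee_fin.
apply: (@le_lt_trans _ _ (\int[U R]_r 1)%E).
  by apply: integral_mono => r _; rewrite lee_fin// ; have /andP[] := f01 (x, r).
by rewrite integral_cst// mul1e [X in (X < _)%E]probability_setT ltry.
Qed.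

Let fb0 x : 0 <= fb x.
Proof. by rewrite -lee_fin fbE integral_ge0// => r _; rewrite lee_fin. Qed.

Let mfb : measurable_fun [set: R] fb.
Proof.
apply/measurable_EFinP.
rewrite (_ : _ \o _ = (fun x => \int[U R]_r (f (x, r))%:E)%E).
  apply: (@measurable_fun_fubini_tonelli_F _ _ _ _ _ (U R) (EFin \o f)).
  - exact/measurable_EFinP.
  - by move=> x; rewrite lee_fin.
by apply/funext => x /=; rewrite fbE.
Qed.

Lemma nest_prod1 (xs : seq R) n : size xs = n ->
  nest (U R) n (fun r => (\prod_(v <- zip xs r) f v)%:E) = (\prod_(x <- xs) fb x)%:E.
Proof.
move=> <-{n}; elim: xs => [|x xs IH] /=; first by rewrite !big_nil.
have mprod : tmeas (size xs) (fun r => (\prod_(v <- zip xs r) f v)%:E).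
  apply/measurable_EFinP; apply: (@measurable_prodl _ _ _ _ _ (size xs) (fun y : (size xs).-tuple R => zip xs y) (fun _ => f)).
    apply: (mseq_zip (L := fun _ => xs)); last exact: mseq_tval.
    by exists (fun i _ => tnth (in_tuple xs) i); split => // y; rewrite map_tnth_enum.
  exact: measurableT_comp.
under eq_integral => z _.
  under eq_nest do rewrite big_cons EFinM.
  rewrite nestZ ?lee_fin//; last by move=> r; rewrite lee_fin; apply: prodr_ge0.
  rewrite IH muleC.
  over.
rewrite big_cons EFinM fbE muleC; apply: ge0_integralZl => //.
- by apply/measurable_EFinP; exact: (measurableT_comp mf (measurable_pair1 x)).
- by move=> r _; rewrite lee_fin.
- by rewrite lee_fin; apply: prodr_ge0 => y _.
Qed.

Lemma nest_prod2 n (c : R) : (\int[F]_x \int[U R]_r (f (x, r))%:E = c%:E)%E ->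
  nest F n (fun xs => (\prod_(x <- xs) fb x)%:E) = (c ^+ n)%:E.
Proof.
move=> hc; elim: n => [|n IH] /=; first by rewrite big_nil.
have mprod : tmeas n (fun xs => (\prod_(x <- xs) fb x)%:E).
  apply/measurable_EFinP; apply: (@measurable_prodl _ _ _ _ _ n (fun y : n.-tuple R => tval y) (fun _ => fb)).
    exact: mseq_tval.
  exact: measurableT_comp.
have c0 : 0 <= c.
  by rewrite -lee_fin -hc; apply: integral_ge0 => x _; apply: integral_ge0 => r _; rewrite lee_fin.
under eq_integral => z _.
  under eq_nest do rewrite big_cons EFinM.
  rewrite nestZ ?lee_fin//; last by move=> xs; rewrite lee_fin; apply: prodr_ge0.
  rewrite IH muleC fbE.
  over.
rewrite exprS mulrC [RHS]EFinM -hc; apply: ge0_integralZl => //.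
- apply: (@measurable_fun_fubini_tonelli_F _ _ _ _ _ (U R) (EFin \o f)).
  + exact/measurable_EFinP.
  + by move=> x; rewrite lee_fin.
- by move=> x _; apply: integral_ge0 => r _; rewrite lee_fin.
- by rewrite lee_fin exprn_ge0.
Qed.

(** Independence in two stages: over the tie-breakers the product factors into the conditional means
    [fb], and over the values into equal factors [c]. *)
Lemma nest_prod n (c : R) : (\int[F]_x \int[U R]_r (f (x, r))%:E = c%:E)%E ->
  nest F n (fun xs => nest (U R) n (fun r => (\prod_(v <- zip xs r) f v)%:E)) =
  (c ^+ n)%:E.
Proof.
move=> hc; rewrite -(nest_prod2 n hc); apply: eq_nest => xs xsn.
by rewrite nest_prod1.
Qed.

End product.

Definition E2 n (g : seq (R * R) -> \bar R) : \bar R :=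
  nest F n (fun xs => nest (U R) n (fun r => g (zip xs r))).

Lemma ptmeas_zip n (g : seq (R * R) -> \bar R) : tmeas n g ->
  ptmeas n (fun (xs : n.-tuple R) r => g (zip xs r)).
Proof.
move=> mg; apply: (@mseq_meas _ _ _ _ _ _ n (fun q : n.-tuple R * n.-tuple R => zip q.1 q.2) g) => //.
by apply: mseq_zip; [exact: (mseq_fst _ (@mseq_tval _ _ n))|exact: (mseq_snd _ (@mseq_tval _ _ n))].
Qed.

Lemma tmeas_zip n (g : seq (R * R) -> \bar R) xs : size xs = n -> tmeas n g ->
  tmeas n (fun r => g (zip xs r)).
Proof.
move=> xsn mg; have := ptmeas1 (tcast xsn (in_tuple xs)) (ptmeas_zip mg).
by rewrite val_tcast.
Qed.

Lemma tmeas_nest_zip n (g : seq (R * R) -> \bar R) : tmeas n g -> (forall l, 0 <= g l)%E ->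
  tmeas n (fun xs => nest (U R) n (fun r => g (zip xs r))).
Proof.
by move=> mg g0; apply: (@nest_meas _ _ _ _ _ (U R) n (fun (xs : n.-tuple R) r => g (zip xs r)) (ptmeas_zip mg)).
Qed.

Lemma E2D n (g1 g2 : seq (R * R) -> \bar R) : tmeas n g1 -> tmeas n g2 ->
  (forall l, 0 <= g1 l)%E -> (forall l, 0 <= g2 l)%E ->
  (E2 n (fun l => g1 l + g2 l) = E2 n g1 + E2 n g2)%E.
Proof.
move=> m1 m2 p1 p2; rewrite /E2 -nestD; first last.
- by move=> xs; exact: nest_ge0.
- by move=> xs; exact: nest_ge0.
- exact: tmeas_nest_zip.
- exact: tmeas_nest_zip.
by apply: eq_nest => xs xsn; rewrite nestD//; exact: tmeas_zip.
Qed.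

Lemma E2Z n (g : seq (R * R) -> \bar R) (c : \bar R) : tmeas n g ->
  (forall l, 0 <= g l)%E -> (0 <= c)%E -> (E2 n (fun l => c * g l) = c * E2 n g)%E.
Proof.
move=> mg g0 c0; rewrite /E2 -nestZ//; first last.
- by move=> xs; exact: nest_ge0.
- exact: tmeas_nest_zip.
by apply: eq_nest => xs xsn; rewrite nestZ//; exact: tmeas_zip.
Qed.

Variable tau : R * R -> R.
Hypothesis mtau : measurable_fun [set: (R * R)%type] tau.
Variable q : R -> R.
Hypothesis q01 : forall s, 0 <= q s <= 1.
Hypothesis qE : forall s, 0 <= s -> s < 1 ->
  (\int[F]_x \int[U R]_r (s < tau (x, r))%R%:R%:E = (q s)%:E)%E.

(* Expectation of [Yf] when [q s] is the probability that a threshold exceeds [s]. *)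
Definition yn n s t : R :=
  ((((1 - t) + t * q s) ^+ n - t * q s ^+ n) / (1 - t) - q t ^+ n) / t.

Lemma measurable_ltau s : measurable_fun [set: (R * R)%type] (fun v => (s < tau v)%R%:R : R).
Proof.
have : measurable_fun [set: (R * R)%type] (fun v => s < tau v) by apply: measurable_fun_ltr.
by move=> /measurable_ind h; apply/measurable_EFinP; exact: h.
Qed.

Lemma E2_Yf n s t : 0 <= s -> s < t -> t < 1 ->
  E2 n (fun l => (Yf tau l s t)%:E) = (yn n s t)%:E.
Proof.
move=> s0 st t1; have t0 : 0 < t by exact: le_lt_trans st.
have t1' : 0 < 1 - t by rewrite subr_gt0.
pose A (l : seq (R * R)) := \prod_(v <- l) (if tau v <= s then 1 - t else 1).
pose B r (l : seq (R * R)) := \prod_(v <- l) (r < tau v)%R%:R : R.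
have mprod (f : R * R -> R) : measurable_fun [set: (R * R)%type] f ->
    tmeas n (fun l => (\prod_(v <- l) f v)%:E).
  move=> mf; apply/measurable_EFinP.
  apply: (@measurable_prodl _ _ _ _ _ n (fun y : n.-tuple (R * R) => tval y) (fun _ => f)).
    exact: mseq_tval.
  exact: measurableT_comp.
have mfA : measurable_fun [set: (R * R)%type] (fun v => if tau v <= s then 1 - t else 1).
  by apply: measurable_fun_ifT => //; apply: measurable_fun_ler.
have mA : tmeas n (fun l => (A l)%:E) by exact: mprod.
have mB r : tmeas n (fun l => (B r l)%:E) by apply: mprod; exact: measurable_ltau.
have A0 l : (0 <= (A l)%:E)%E.
  by rewrite lee_fin; apply: prodr_ge0 => v _; case: ifP => // _; exact: ltW.
have B0 r l : (0 <= (B r l)%:E)%E by rewrite lee_fin; apply: prodr_ge0.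
have Y0 l : (0 <= (Yf tau l s t)%:E)%E by rewrite lee_fin Yf_ge0.
have YE l : Yf tau l s t = ((A l - t * B s l) / (1 - t) - B t l) / t.
  by rewrite /Yf s0 st t1.
have mY : tmeas n (fun l => (Yf tau l s t)%:E).
  apply/measurable_EFinP.
  have mA' : measurable_fun [set: n.-tuple (R * R)] (fun y => A (tval y)) by apply/measurable_EFinP.
  have mB' r : measurable_fun [set: n.-tuple (R * R)] (fun y => B r (tval y)) by apply/measurable_EFinP; exact: mB.
  rewrite (_ : (fun _ => _) = fun y : n.-tuple (R * R) =>
     ((A y - t * B s y) / (1 - t) - B t y) / t); last by apply/funext => y; rewrite YE.
  apply: measurable_funM => //; apply: measurable_funB => //.
  apply: measurable_funM => //; apply: measurable_funB => //.
  exact: measurable_funM.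
have EB r : 0 <= r -> r < 1 -> E2 n (fun l => (B r l)%:E) = (q r ^+ n)%:E.
  move=> r0 r1; apply: nest_prod (measurable_ltau r) _ _ _ (qE r0 r1).
  by move=> v; case: (_ < _) => /=; rewrite ?lexx ?ler01.
(* Each factor equals [(1 - t) + t * [s < tau v]], of mean [(1 - t) + t * q s]. *)
have EA : E2 n (fun l => (A l)%:E) = (((1 - t) + t * q s) ^+ n)%:E.
  apply: nest_prod mfA _ _ _ _.
    by move=> v; case: ifP => _; rewrite ?ler01 ?lexx// subr_ge0 (ltW t1) gerBl (ltW t0).
  have split_if v : ((if tau v <= s then 1 - t else 1)%:E =
      (1 - t)%:E + t%:E * ((s < tau v)%R%:R)%:E)%E.
    by rewrite -EFinM -EFinD; case: leP => _ /=; rewrite ?mulr1 ?mulr0 ?addr0 ?subrK.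
  have mI x : measurable_fun [set: R] (fun r => ((s < tau (x, r))%R%:R%:E : \bar R)).
    by apply/measurable_EFinP; exact: (measurableT_comp (measurable_ltau s) (measurable_pair1 x)).
  have inner x : (\int[U R]_r (if tau (x, r) <= s then 1 - t else 1)%R%:E =
      (1 - t)%:E + t%:E * \int[U R]_r (s < tau (x, r))%R%:R%:E)%E.
    under eq_integral do rewrite split_if.
    transitivity (\int[U R]_r (1 - t)%:E + \int[U R]_r (t%:E * (s < tau (x, r))%R%:R%:E))%E.
      apply: ge0_integralD => //.
      - by move=> *; rewrite lee_fin ltW.
      - by move=> *; rewrite mule_ge0 ?lee_fin ?(ltW t0).
      - exact: measurable_funeM.
    congr adde; first by rewrite integral_cst// [X in (_ * X)%E]probability_setT mule1.
    by apply: ge0_integralZl => // *; rewrite lee_fin ?ltW.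
  under eq_integral do rewrite inner.
  have mO : measurable_fun [set: R] (fun x => (\int[U R]_r (s < tau (x, r))%R%:R%:E)%E).
    apply: (@measurable_fun_fubini_tonelli_F _ _ _ _ _ (U R) (fun v => ((s < tau v)%R%:R)%:E)).
    + by apply/measurable_EFinP; exact: measurable_ltau.
    + by move=> x; rewrite lee_fin.
  transitivity (\int[F]_x (1 - t)%:E + \int[F]_x (t%:E * \int[U R]_r (s < tau (x, r))%R%:R%:E))%E.
    apply: ge0_integralD => //.
    - by move=> *; rewrite lee_fin ltW.
    - by move=> *; rewrite mule_ge0 ?lee_fin ?(ltW t0)// integral_ge0// => *; rewrite lee_fin.
    - exact: measurable_funeM.
  rewrite [RHS]EFinD; congr adde; first by rewrite integral_cst// [X in (_ * X)%E]probability_setT mule1.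
  rewrite [RHS]EFinM -(qE s0 (lt_trans st t1)).
  apply: ge0_integralZl => //; last by rewrite lee_fin ltW.
  by move=> *; apply: integral_ge0 => *; rewrite lee_fin.
(* Multiplied by [t * (1 - t)], the definition of [Yf] rearranges into an identity between
   nonnegative terms. It can be integrated termwise and then solved for the mean of [Yf]. *)
have key : (E2 n (fun l => (A l)%:E) = (t * (1 - t))%:E * E2 n (fun l => (Yf tau l s t)%:E) +
    (t%:E * E2 n (fun l => (B s l)%:E) + (1 - t)%:E * E2 n (fun l => (B t l)%:E)))%E.
  have tt0 : (0 <= (t * (1 - t))%:E)%E by rewrite lee_fin mulr_ge0// ltW.
  have tE : (0 <= t%:E)%E by rewrite lee_fin ltW.
  have tE' : (0 <= (1 - t)%:E)%E by rewrite lee_fin ltW.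
  have mZ g (c : \bar R) : tmeas n g -> tmeas n (fun l : seq (R * R) => (c * g l)%E).
    by move=> mg; exact: measurable_funeM.
  have mD g h : tmeas n g -> tmeas n h -> tmeas n (fun l : seq (R * R) => (g l + h l)%E).
    by move=> mg mh; exact: emeasurable_funD.
  rewrite -!E2Z// -!E2D//; first last.
  - by move=> l; rewrite mule_ge0.
  - by move=> l; rewrite mule_ge0.
  - exact: mZ.
  - exact: mZ.
  - by move=> l; rewrite adde_ge0// mule_ge0.
  - by move=> l; rewrite mule_ge0.
  - by apply: mD; exact: mZ.
  - exact: mZ.
  apply: eq_nest => xs _; apply: eq_nest => r _.
  rewrite -!EFinM -!EFinD YE; congr EFin; field.
  by rewrite !gt_eqF.
move: key; rewrite EA !EB// ?(lt_trans st)//; last exact: ltW.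
have : (0 <= E2 n (fun l => (Yf tau l s t)%:E))%E.
  by apply: nest_ge0 => *; exact: nest_ge0.
(* An infinite mean would make the right side of [key] infinite, against the finite power on the
   left. *)
case: (E2 n _) => [y _||//]; last first.
  by move=> _; rewrite gt0_muley ?lte_fin ?mulr_gt0// addye.
rewrite -!EFinM -!EFinD => -[e]; congr EFin; rewrite /yn.
apply: (mulfI (_ : t * (1 - t) != 0)); first by rewrite gt_eqF// mulr_gt0.
rewrite e; field.
by rewrite !gt_eqF.
Qed.

End expectation.

(** * From the conditional density to the success probability *)

Section consistency.
Variable R : realType.
Notation leb01 f := (\int[lebesgue_measure]_(t in `[0%R, 1%R]) f t)%E.

Lemma measurable_Yf (tau : R * R -> R) d (X : measurableType d) n (L : X -> seq (R * R))
    (s t : X -> R) : measurable_fun [set: (R * R)%type] tau -> mseq n L ->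
  measurable_fun [set: X] s -> measurable_fun [set: X] t ->
  measurable_fun [set: X] (fun x => Yf tau (L x) (s x) (t x)).
Proof.
move=> mtau mL ms mt.
have mB (u : X -> R) : measurable_fun [set: X] u ->
    measurable_fun [set: X] (fun x => \prod_(v <- L x) (u x < tau v)%R%:R : R).
  move=> mu; apply: (@measurable_prodl _ _ _ _ _ n L (fun x v => (u x < tau v)%R%:R)) => //.
  have : measurable_fun [set: (X * (R * R))%type] (fun z => u z.1 < tau z.2).
    by apply: measurable_fun_ltr; exact: measurableT_comp.
  by move=> /measurable_ind h; apply/measurable_EFinP; exact: h.
have mi (u : X -> R) : measurable_fun [set: X] u -> measurable_fun [set: X] (fun x => (u x)^-1).
  by move=> mu; apply: measurableT_comp mu; exact: measurable_invr.
have m1t : measurable_fun [set: X] (fun x => 1 - t x) by exact: measurable_funB.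
apply: measurable_fun_ifT => //.
  apply: measurable_and; first by apply: measurable_fun_ler.
  by apply: measurable_and; apply: measurable_fun_ltr.
apply: measurable_funM; last exact: mi.
apply: measurable_funB; last exact: mB.
apply: measurable_funM; last exact: mi.
apply: measurable_funB; last by apply: measurable_funM => //; exact: mB.
apply: (@measurable_prodl _ _ _ _ _ n L (fun x v => if tau v <= s x then 1 - t x else 1)) => //.
apply: measurable_fun_ifT => //; last exact: (measurableT_comp m1t measurable_fst).
by apply: measurable_fun_ler; exact: measurableT_comp.
Qed.

Variable tau : probability R R -> R * R -> R.
Hypothesis mtau : forall Ft, measurable_fun [set: (R * R)%type] (tau Ft).
Hypothesis tau_anti : forall Ft a b, lexle a b -> tau Ft b <= tau Ft a.
Hypothesis tau01 : forall Ft v, 0 <= tau Ft v <= 1.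

Definition ynd (q : R -> R) n s t : R := if [&& 0 <= s, s < t & t < 1] then yn q n s t else 0.

(** [Phi] is the double integral of the conditional density [Yf]. Tonelli's theorem moves [s] and
    [t] outside tie-breakers and values, so that [E2_Yf] applies at each [(s, t)]. *)
Lemma success_yn n (F : probability R R) (q : R -> R) : (0 < n)%N -> nonneg_dist F ->
  (forall s, 0 <= s -> s < 1 ->
  (\int[F]_x \int[U R]_r (s < tau F (x, r))%R%:R%:E = (q s)%:E)%E) ->
  (\int[U R]_t \int[U R]_s (ynd q n s t)%:E <= success_prob (algo tau) n F F)%E.
Proof.
move=> n0 F0 qE.
pose Y := fun (xs r : seq R) s t => (Yf (tau F) (zip xs r) s t)%:E : \bar R.
have Y0 xs r s t : (0 <= Y xs r s t)%E by rewrite lee_fin Yf_ge0.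
have mY d (X : measurableType d) (xs r : X -> seq R) (s t : X -> R) :
    mseq n xs -> mseq n r -> measurable_fun [set: X] s -> measurable_fun [set: X] t ->
    measurable_fun [set: X] (fun x => Y (xs x) (r x) (s x) (t x)).
  move=> mx mr ms mt; apply/measurable_EFinP; by apply: (measurable_Yf (n := n)) => //; exact: mseq_zip.
have mcst d (X : measurableType d) (xs : seq R) : size xs = n -> mseq n (fun _ : X => xs).
  move=> xsn; exists (fun i _ => tnth (tcast xsn (in_tuple xs)) i); split => // x.
  by rewrite map_tnth_enum val_tcast.
have mI d (X : measurableType d) (xs r : X -> seq R) (t : X -> R) :
    mseq n xs -> mseq n r -> measurable_fun [set: X] t ->
    measurable_fun [set: X] (fun x => \int[U R]_s Y (xs x) (r x) s (t x))%E.
  move=> mx mr mt.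
  apply: (@measurable_fun_fubini_tonelli_F _ _ _ _ _ (U R)
    (fun z : X * R => Y (xs z.1) (r z.1) z.2 (t z.1))) => //.
  by apply: mY => //; [exact: mseq_fst|exact: mseq_fst|exact: measurableT_comp].
have mII d (X : measurableType d) (xs r : X -> seq R) :
    mseq n xs -> mseq n r ->
    measurable_fun [set: X] (fun x => \int[U R]_t \int[U R]_s Y (xs x) (r x) s t)%E.
  move=> mx mr.
  apply: (@measurable_fun_fubini_tonelli_F _ _ _ _ _ (U R)
    (fun z : X * R => \int[U R]_s Y (xs z.1) (r z.1) s z.2)%E) => //.
    by apply: mI => //; exact: mseq_fst.
  by move=> z; exact: integral_ge0.
pose Phi (xs r : seq R) : \bar R := (\int[U R]_t \int[U R]_s Y xs r s t)%E.
have I0 xs r t : (0 <= \int[U R]_s Y xs r s t)%E by exact: integral_ge0.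
have Phi0 xs r : (0 <= Phi xs r)%E by exact: integral_ge0.
have mseq1 : mseq n (fun q : n.-tuple R * n.-tuple R => tval q.1) by exact: mseq_tuple.
have mseq2 : mseq n (fun q : n.-tuple R * n.-tuple R => tval q.2) by exact: mseq_tuple.
have S : (nest F n (fun xs => nest (U R) n (Phi xs)) <= success_prob (algo tau) n F F)%E.
  apply: (success_lower mtau F0) => //; first exact: mII.
  move=> xs r xsn rn xs0 ur.
    have szr : size (zip xs r) = n by rewrite size_zip xsn rn minnn.
    have := @evt_density R (tau F) (mtau F) (tau01 F) (@tau_anti F) (zip xs r).
    rewrite szr /Phi => h.
    rewrite integralU//; last first.
      exact: (mI _ R (fun _ => xs) (fun _ => r) id (mcst _ _ _ xsn) (mcst _ _ _ rn)).
    under eq_integral => t _.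
      rewrite integralU//; last first.
        exact: (mY _ R (fun _ => xs) (fun _ => r) id (fun _ => t) (mcst _ _ _ xsn) (mcst _ _ _ rn)).
      over.
    apply: h.
    + by apply: zip_uniqr => //; rewrite xsn.
    + by rewrite -size_eq0 szr -lt0n.
    + exact: zip_all1.
apply: le_trans S.
have m3a : mseq n (fun q : R * n.-tuple R * n.-tuple R => tval q.1.2).
  by apply: mseq_tuple; exact: measurableT_comp.
have m3b : mseq n (fun q : R * n.-tuple R * n.-tuple R => tval q.2) by exact: mseq_tuple.
rewrite le_eqVlt; apply/orP; left; apply/eqP.
transitivity (nest F n (fun xs => \int[U R]_t nest (U R) n (fun r => \int[U R]_s Y xs r s t)))%E; last first.
  apply: eq_nest => xs xsn.
  rewrite (@nest_integralC _ _ _ _ _ (U R) n (fun t r => \int[U R]_s Y xs r s t)%E)//.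
  rewrite /ptmeas.
  apply: (mI _ (R * n.-tuple R)%type (fun _ => xs) (fun q => tval q.2) fst) => //.
    exact: mcst.
  exact: mseq_tuple.
have mN1 d (X : measurableType d) (xs : X -> seq R) (s t : X -> R) :
    mseq n xs -> measurable_fun [set: X] s -> measurable_fun [set: X] t ->
    measurable_fun [set: X] (fun x => nest (U R) n (fun r => Y (xs x) r (s x) (t x))).
  move=> mx ms mt.
  apply: (@nest_meas _ _ _ _ _ (U R) n (fun (x : X) r => Y (xs x) r (s x) (t x))) => //.
  apply: mY; [exact: mseq_fst|exact: mseq_tuple|exact: measurableT_comp|exact: measurableT_comp].
have E1 xs t : size xs = n -> (nest (U R) n (fun r => \int[U R]_s Y xs r s t) =
    \int[U R]_s nest (U R) n (fun r => Y xs r s t))%E.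
  move=> xsn; rewrite (@nest_integralC _ _ _ _ _ (U R) n (fun s r => Y xs r s t))//.
  apply: (mY _ (R * n.-tuple R)%type (fun _ => xs) (fun q => tval q.2) fst (fun _ => t)) => //.
    exact: mcst.
  exact: mseq_tuple.
have N0 xs s t : (0 <= nest (U R) n (fun r => Y xs r s t))%E by exact: nest_ge0.
transitivity (nest F n (fun xs => \int[U R]_t \int[U R]_s nest (U R) n (fun r => Y xs r s t)))%E; last first.
  by apply: eq_nest => xs xsn; apply: eq_integral => t _; rewrite E1.
have mN2 : measurable_fun [set: (R * n.-tuple R)%type]
    (fun q => \int[U R]_s nest (U R) n (fun r => Y (tval q.2) r s q.1))%E.
  apply: (@measurable_fun_fubini_tonelli_F _ _ _ _ _ (U R)
    (fun z : R * n.-tuple R * R => nest (U R) n (fun r => Y z.1.2 r z.2 z.1.1))%E) => //.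
  apply: mN1 => //; last exact: measurableT_comp.
  by apply: mseq_tuple; exact: measurableT_comp.
rewrite -(@nest_integralC _ _ _ _ _ F n (fun t xs => \int[U R]_s nest (U R) n (fun r => Y xs r s t))%E)//; last first.
  by move=> *; exact: integral_ge0.
apply: eq_integral => t _.
rewrite -(@nest_integralC _ _ _ _ _ F n (fun s xs => nest (U R) n (fun r => Y xs r s t)))//; last first.
  apply: (mN1 _ (R * n.-tuple R)%type (fun q => tval q.2) fst (fun _ => t)) => //.
  exact: mseq_tuple.
apply: eq_integral => s _; rewrite /ynd; case: ifP => [/and3P[s0 st t1]|nst].
  by rewrite -(@E2_Yf R F (tau F) (mtau F) q qE n s t s0 st t1).
have -> : (fun xs => nest (U R) n (fun r => Y xs r s t)) = (fun _ => 0%E).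
  apply/funext => xs; rewrite -[RHS](nest_cst (U R) n); apply: eq_nest => r _.
  by rewrite /Y /Yf nst.
by rewrite nest_cst.
Qed.

End consistency.

(** * Quantiles and thresholds *)

Section quantile.
Variable R : realType.
Variable F : probability R R.

Definition Fl (x : R) : R := fine (F `]-oo, x[%classic).
Definition Fr (x : R) : R := fine (F `]-oo, x]%classic).

Lemma FlE x : (Fl x)%:E = F `]-oo, x[%classic.
Proof. by rewrite fineK// fin_num_measure. Qed.

Lemma FrE x : (Fr x)%:E = F `]-oo, x]%classic.
Proof. by rewrite fineK// fin_num_measure. Qed.

Lemma Fl_le_Fr x : Fl x <= Fr x.
Proof.
rewrite -lee_fin FlE FrE le_measure ?inE// => y /=; rewrite !in_itv/=; exact: ltW.
Qed.

Lemma Fr_le_Fl x y : x < y -> Fr x <= Fl y.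
Proof.
move=> xy; rewrite -lee_fin FlE FrE le_measure ?inE// => z /=; rewrite !in_itv/= => zx.
exact: le_lt_trans xy.
Qed.

Lemma Fl_ge0 x : 0 <= Fl x. Proof. by rewrite -lee_fin FlE. Qed.

Lemma Fl_nd : {homo Fl : x y / x <= y}.
Proof.
move=> x y; rewrite le_eqVlt => /predU1P[->//|/Fr_le_Fl]; apply: le_trans.
exact: Fl_le_Fr.
Qed.

Lemma Fr_nd : {homo Fr : x y / x <= y}.
Proof.
move=> x y; rewrite le_eqVlt => /predU1P[->//|/Fr_le_Fl] h; apply: le_trans h _.
exact: Fl_le_Fr.
Qed.

Lemma Fatom x : F [set x] = (Fr x - Fl x)%:E.
Proof.
have : F `]-oo, x]%classic = (F `]-oo, x[%classic + F [set x])%E.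
  rewrite -measureU//; last by apply/seteqP; split => // y /= [+ yx]; rewrite yx in_itv/= ltxx.
  congr (F _); apply/seteqP; split => y /=; rewrite !in_itv/=.
    by rewrite le_eqVlt => /predU1P[->|]; [right|left].
  by move=> [/ltW//|->].
by rewrite -FlE -FrE => e; rewrite EFinB e addeAC subee// add0e.
Qed.

(** Pointwise statements range over all real tie-breakers. Clamping keeps [uq] between [Fl] and [Fr]
    for all of them, and changes nothing on [[0, 1]], where [U] is carried. *)
Definition clamp01 (r : R) : R := Num.max 0 (Num.min r 1).

Definition uq (v : R * R) : R := Fl v.1 + clamp01 v.2 * (Fr v.1 - Fl v.1).

Lemma clamp01_itv r : 0 <= clamp01 r <= 1.
Proof.
by rewrite /clamp01 le_max lexx/= ge_max ler01/= ge_min lexx orbT.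
Qed.

Lemma uq_ge v : Fl v.1 <= uq v.
Proof.
rewrite /uq lerDl mulr_ge0// ?subr_ge0 ?Fl_le_Fr//.
by have /andP[] := clamp01_itv v.2.
Qed.

Lemma uq_le v : uq v <= Fr v.1.
Proof.
rewrite /uq -lerBrDl ler_piMl// ?subr_ge0 ?Fl_le_Fr//.
by have /andP[] := clamp01_itv v.2.
Qed.

Lemma uq_ge0 v : 0 <= uq v. Proof. exact: le_trans (Fl_ge0 _) (uq_ge v). Qed.

Lemma uq_mono a b : lexle a b -> uq a <= uq b.
Proof.
move=> /orP[ab|/andP[/eqP e ab]].
  exact: le_trans (uq_le a) (le_trans (Fr_le_Fl ab) (uq_ge b)).
rewrite /uq e lerD2l ler_wpM2r// ?subr_ge0 ?Fl_le_Fr//.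
by rewrite /clamp01 ge_max le_max lexx/= le_max le_min !ge_min ab lexx !orbT.
Qed.

Lemma measurable_uq : measurable_fun [set: (R * R)%type] uq.
Proof.
have ml : measurable_fun [set: R] Fl by apply: nondecreasing_measurable => // ? ?; exact: Fl_nd.
have mr : measurable_fun [set: R] Fr by apply: nondecreasing_measurable => // ? ?; exact: Fr_nd.
have mc : measurable_fun [set: R] clamp01.
  by apply: measurable_maxr => //; exact: measurable_minr.
apply: measurable_funD; first exact: (measurableT_comp ml).
apply: measurable_funM; first exact: (measurableT_comp mc).
by apply: measurable_funB; [exact: (measurableT_comp mr)|exact: (measurableT_comp ml)].
Qed.

(** [x0] is the generalized inverse of the cdf at [q], the infimum of the points with [q <= Fr x].
    The limits of the cdf at both infinities, together with [0 < q < 1], make this set nonempty and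
    bounded below. *)
Lemma quantile_point (q : R) : 0 < q -> q < 1 -> exists x0,
  [/\ forall x, x < x0 -> Fr x < q, forall x, x0 < x -> q <= Fl x,
      Fl x0 <= q & q <= Fr x0].
Proof.
move=> q0 q1; pose S := [set x | q <= Fr x].
pose X : {RV F >-> R} := HB.pack (idfun : R -> R)
  (isMeasurableFun.Build _ _ _ _ (idfun : R -> R) (@measurable_id _ _ setT)).
have XE x : cdf X x = (Fr x)%:E by rewrite FrE.
have Fr1 : Fr x @[x --> +oo] --> (1 : R) by exact: fine_cvg (cvg_cdfy1 X).
have FrN : Fr x @[x --> -oo] --> (0 : R) by exact: fine_cvg (cvg_cdfNy0 X).
have S0 : S !=set0.
  have [M [_ hM]] := cvgr_gt _ Fr1 _ q1.
  by exists (M + 1); apply: ltW; apply: hM; rewrite ltrDl.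
have [L SL] : exists L, forall x, S x -> L < x.
  have [M [_ hM]] := cvgr_lt _ FrN _ q0.
  exists (M - 1) => x; rewrite /S/= => qx.
  rewrite ltNge; apply/negP => xM.
  have xlt : x < M by rewrite (le_lt_trans xM)// gtrBl.
  by have /= := hM x xlt; rewrite ltNge qx.
have lbS : has_lbound S by exists L => x /SL /ltW.
have hS : has_inf S by split.
pose x0 := inf S.
have hlt x : x < x0 -> Fr x < q.
  move=> xx0; rewrite ltNge; apply/negP => qx.
  by have := ge_inf lbS qx; rewrite leNgt xx0.
have hgt x : x0 < x -> exists2 y, S y & y < x.
  by move=> xx0; have /inf_adherent := hS => /(_ _ (_ : 0 < x - x0)); rewrite subr_gt0 => /(_ xx0)[y Sy]; rewrite subrKC => yx; exists y.
exists x0; split => //.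
- by move=> x /hgt[y Sy yx]; exact: le_trans Sy (Fr_le_Fl yx).
- rewrite -lee_fin FlE.
  (* Continuity from below: the open half-line is an increasing union of closed ones ending before
     [x0], each of mass less than [q]. *)
  have E : `]-oo, x0[%classic = \bigcup_k `]-oo, x0 - k.+1%:R^-1]%classic :> set R.
    apply/seteqP; split => y /=; rewrite ?in_itv/=.
      move=> yx; have d0 : 0 < x0 - y by rewrite subr_gt0.
      exists (Num.truncn (x0 - y)^-1) => //=; rewrite in_itv/= lerBrDr -lerBrDl.
      rewrite invf_ple ?posrE ?ltr0n//; exact/ltW/truncnS_gt.
    move=> [k _]; rewrite /= in_itv/= => /le_lt_trans; apply.
    by rewrite gtrBl invr_gt0.
  have /cvg_lim <- // : F (`]-oo, x0 - k.+1%:R^-1]%classic) @[k --> \oo] --> F `]-oo, x0[%classic.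
    rewrite [in X in _ --> X]E; apply: nondecreasing_cvg_mu => //.
      exact: bigcup_measurable.
    move=> m n mn; apply/subsetPset => y /=; rewrite !in_itv/= => /le_trans; apply.
    by rewrite lerB// lef_pV2 ?posrE ?ltr0n// ler_nat.
  apply: lime_le.
    apply: ereal_nondecreasing_is_cvgn => m n mn; apply: le_measure; rewrite ?inE//.
    move=> y /=; rewrite !in_itv/= => /le_trans; apply.
    by rewrite lerB// lef_pV2 ?posrE ?ltr0n// ler_nat.
  near=> k; rewrite -FrE lee_fin; apply/ltW/hlt.
  by rewrite gtrBl invr_gt0.
- rewrite -lee_fin -XE; have := @cdf_right_continuous _ _ _ F X x0.
  move=> rc; apply: cvge_ge rc.
  near=> x; rewrite XE lee_fin.
  have /hgt[y Sy yx] : x0 < x by near: x; exact: nbhs_right_gt.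
  exact: le_trans Sy (Fr_nd (ltW yx)).
Unshelve. all: by end_near. Qed.

Lemma clamp01_id r : 0 <= r -> r <= 1 -> clamp01 r = r.
Proof.
by move=> r0 r1; rewrite /clamp01 (min_idPl r1) (max_idPr r0).
Qed.

(* Probability integral transform, atoms being split by the tie-breaker. *)
Lemma quantile_uniform (q : R) : 0 < q -> q < 1 ->
  (\int[F]_x \int[U R]_r (uq (x, r) < q)%R%:R%:E = q%:E)%E.
Proof.
move=> q0 q1; have [x0 [hlt hgt Fl0 Fr0]] := quantile_point q0 q1.
have minner x : measurable_fun [set: R] (fun r => ((uq (x, r) < q)%R%:R%:E : \bar R)).
  apply: measurable_ind; apply: measurable_fun_ltr => //.
  exact: (measurableT_comp measurable_uq (measurable_pair1 x)).
(* [c] is the share of the atom at [x0] that lies below level [q]. Without an atom, [q = Fl x0] and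
   [c = 0]. *)
have [c [c0 cE cI]] : exists c : R, [/\ 0 <= c, Fl x0 + c * (Fr x0 - Fl x0) = q &
    (\int[U R]_r (uq (x0, r) < q)%R%:R%:E = c%:E)%E].
  have := Fl_le_Fr x0; rewrite le_eqVlt => /predU1P[e|m0].
    have qE : q = Fl x0 by apply/eqP; rewrite eq_le Fl0 e Fr0.
    exists 0; split => //; first by rewrite mul0r addr0.
    rewrite -[RHS](@integral0 _ _ _ (U R) setT); apply: eq_integral => r _.
    by rewrite ltNge qE (uq_ge (x0, r)).
  have m0' : 0 < Fr x0 - Fl x0 by rewrite subr_gt0.
  pose c := (q - Fl x0) / (Fr x0 - Fl x0).
  have c0 : 0 <= c by rewrite divr_ge0 ?subr_ge0// ltW.
  have c1 : c <= 1 by rewrite ler_pdivrMr// mul1r lerD2r.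
  exists c; split => //; first by rewrite /c divfK ?gt_eqF// addrC subrK.
  rewrite integralU//.
  rewrite -[RHS]leb01_lt//; apply: eq_integral => r; rewrite inE/= in_itv/= => /andP[r0 r1].
  rewrite /ind; congr ((_%:R)%:E); rewrite /uq /= clamp01_id//.
  by rewrite /c ltr_pdivlMr// ltrBrDl.
transitivity (\int[F]_x ((\1_(`]-oo, x0[%classic : set R) x)%:E + c%:E * (\1_[set x0] x)%:E))%E.
  apply: eq_integral => x _; rewrite !indicE.
  case: (ltgtP x x0) => [xx0|xx0|->].
  - rewrite mem_set/=; last by rewrite in_itv/=.
    rewrite memNset/=; last by move=> e; rewrite e ltxx in xx0.
    rewrite mule0 adde0 -[RHS](_ : \int[U R]_r 1%:E = 1%:E)%E; last first.
      by rewrite integral_cst// mul1e [LHS]probability_setT.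
    apply: eq_integral => r _; by rewrite (le_lt_trans (uq_le (x, r)) (hlt _ xx0)).
  - rewrite memNset/=; last by rewrite in_itv/=; apply/negP; rewrite -leNgt ltW.
    rewrite memNset/=; last by move=> e; rewrite e ltxx in xx0.
    rewrite mule0 adde0 -[RHS](@integral0 _ _ _ (U R) setT); apply: eq_integral => r _.
    by rewrite ltNge (le_trans (hgt _ xx0) (uq_ge (x, r))).
  - rewrite memNset/=; last by rewrite in_itv/= ltxx.
    by rewrite mem_set//= add0e mule1.
rewrite ge0_integralD//; last 3 first.
- by apply/measurable_EFinP.
- by move=> x _; rewrite mule_ge0 ?lee_fin.
- by apply: measurable_funeM; apply/measurable_EFinP.
rewrite ge0_integralZl//; last by apply/measurable_EFinP.
rewrite !integral_indic// !setIT.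
transitivity ((Fl x0)%:E + c%:E * (Fr x0 - Fl x0)%:E)%E; first by rewrite FlE -Fatom.
by rewrite -EFinM -EFinD cE.
Qed.

End quantile.

(** * The threshold function and its law *)

Section threshold.
Variable R : realType.
Variables (n : nat) (kappa l1 l2 : R).
Hypotheses (n0 : (0 < n)%N) (k0 : 0 < kappa) (l12 : l1 <= l2) (l21 : l2 <= 1).

(* [s < thr u] iff [u < exp (- kappa / (n (1 - s)))] for [s] in [l1, l2[ (lemma [lt_thr]);
   the case [1 <= u] is separate because [ln 1 = 0] would make the quotient a junk [0]. *)
Definition thr (u : R) : R :=
  if 1 <= u then l1 else Num.max l1 (Num.min l2 (1 + kappa / (n%:R * ln u))).

Definition ptau (F : probability R R) (v : R * R) : R := thr (uq F v).

Definition qmid (s : R) : R := expR (- (kappa / (n%:R * (1 - s)))).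

(** Survival function of one threshold under a correct prediction; its jumps at [l1] and [l2] come
    from the truncation in [thr]. *)
Definition qf (s : R) : R := if s < l1 then 1 else if s < l2 then qmid s else 0.

Lemma thr_itv u : l1 <= thr u <= l2.
Proof.
rewrite /thr; case: ifP => _; first by rewrite lexx.
by rewrite le_max lexx ge_max l12 ge_min lexx.
Qed.

Let nR0 : 0 < n%:R :> R. Proof. by rewrite ltr0n. Qed.

Lemma qmid_itv s : s < 1 -> 0 < qmid s < 1.
Proof.
move=> s1; rewrite expR_gt0/= /qmid -[ltRHS]expR0 ltr_expR oppr_lt0.
by rewrite divr_gt0// mulr_gt0// subr_gt0.
Qed.

(** For [0 < u < 1] the logarithm is negative, and [s < 1 + kappa / (n * ln u)] rearranges to the
    bound on [u]; the truncations are invisible for [l1 <= s < l2]. At [u = 0], the conventions for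
    [ln 0] and the inverse of 0 give the value 1 before truncation, which makes both sides true. *)
Lemma lt_thr s u : l1 <= s -> s < l2 -> 0 <= u -> (s < thr u) = (u < qmid s).
Proof.
move=> l1s sl2 u0; have s1 : s < 1 by exact: lt_le_trans l21.
have /andP[q0 q1] := qmid_itv s1; have s1' : 0 < 1 - s by rewrite subr_gt0.
rewrite /thr; case: (leP 1 u) => u1.
  by rewrite (ltNge s) l1s/= (ltNge u) (ltW (lt_le_trans q1 u1)).
rewrite lt_max (ltNge s l1) l1s/= lt_min sl2/=.
move: u0; rewrite le_eqVlt => /predU1P[<-|u0].
  by rewrite ln0// mulr0 invr0 mulr0 addr0 s1 q0.
have lu : ln u < 0 by rewrite ln_lt0// u0 u1.
rewrite -[in RHS](lnK (_ : u \is Num.pos)) ?posrE// /qmid ltr_expR.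
pose L := - ln u; have L0 : 0 < L by rewrite oppr_gt0.
have -> : ln u = - L by rewrite opprK.
rewrite mulrN invrN mulrN ltrBrDr -ltrBrDl ltrN2 !ltr_pdivrMr ?mulr_gt0//.
by congr (_ < _); ring.
Qed.

(** [lt_thr] at the level [s = thr u]: if [thr u < thr u'], then [u' < qmid s <= u]. *)
Lemma thr_anti u u' : 0 <= u -> u <= u' -> thr u' <= thr u.
Proof.
move=> u0 uu'; rewrite leNgt; apply/negP => h.
have /andP[a _] := thr_itv u; have /andP[_ b] := thr_itv u'.
have := lt_thr a (lt_le_trans h b) u0; rewrite ltxx => /esym/negbT; rewrite -leNgt => q1.
have := lt_thr a (lt_le_trans h b) (le_trans u0 uu').
by rewrite h => /esym; rewrite ltNge (le_trans q1 uu').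
Qed.

Lemma ptau_itv F v : l1 <= ptau F v <= l2. Proof. exact: thr_itv. Qed.

Lemma ptau_anti F a b : lexle a b -> ptau F b <= ptau F a.
Proof. by move=> ab; apply: thr_anti; [exact: uq_ge0|exact: uq_mono]. Qed.

Lemma measurable_ptau F : measurable_fun [set: (R * R)%type] (ptau F).
Proof.
have mt : measurable_fun [set: R] thr.
  apply: measurable_fun_ifT => //; first by apply: measurable_fun_ler.
  apply: measurable_maxr => //; apply: measurable_minr => //.
  apply: measurable_funD => //; apply: measurable_funM => //.
  by apply: (measurableT_comp (@measurable_invr R)); apply: measurable_funM.
exact: (measurableT_comp mt (measurable_uq F)).
Qed.

Lemma ptau_law (F : probability R R) (s : R) : 0 <= s -> s < 1 ->
  (\int[F]_x \int[U R]_r (s < ptau F (x, r))%R%:R%:E = (qf s)%:E)%E.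
Proof.
move=> s0 s1; rewrite /qf; case: ltP => sl1.
  have -> : (fun x => \int[U R]_r (s < ptau F (x, r))%R%:R%:E)%E = (fun=> 1%E).
    apply/funext => x; under eq_integral => r _.
      have -> : s < ptau F (x, r) by have /andP[h _] := ptau_itv F (x, r); exact: lt_le_trans h.
      over.
    by rewrite integral_cst// mul1e [LHS]probability_setT.
  by rewrite integral_cst// mul1e [LHS]probability_setT.
case: ltP => sl2; last first.
  have -> : (fun x => \int[U R]_r (s < ptau F (x, r))%R%:R%:E)%E = (fun=> 0%E).
    apply/funext => x; under eq_integral => r _.
      have -> : (s < ptau F (x, r)) = false.
        by apply/negbTE; rewrite -leNgt; have /andP[_ h] := ptau_itv F (x, r); exact: le_trans sl2.
      over.
    by rewrite integral0.
  by rewrite integral0.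
have /andP[q0 q1] := qmid_itv s1.
rewrite -(quantile_uniform F q0 q1); apply: eq_integral => x _; apply: eq_integral => r _.
by rewrite lt_thr// uq_ge0.
Qed.

End threshold.

(** * The consistency integral *)

Section pointwise.
Variable R : realType.
Variables (n : nat) (kappa l1 l2 : R).
Hypotheses (n0 : (0 < n)%N) (k0 : 0 < kappa) (l10 : 0 <= l1) (l12 : l1 <= l2) (l21 : l2 <= 1).

Notation q := (qf n kappa l1 l2).
Definition qm (s : R) : R := expR (- (kappa / (1 - s))).
Definition qmt (s t : R) : R := expR (- (kappa * t / (1 - s))).

(** The reason for the factor [n] in [qmid]: the probability that all [n] thresholds exceed [s]
    becomes free of [n]. *)
Lemma qmidX s : qmid n kappa s ^+ n = qm s.
Proof.
rewrite /qmid /qm -expRM_natl; congr expR.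
by rewrite mulrN invfM mulrCA mulVKf// pnatr_eq0 -lt0n.
Qed.

(** Weighted AM-GM between 1 and [expR (- y)]. After multiplication by [expR (y * t)], the bound
    [1 + x <= expR x] is used at [y * t] and [y * t - y], whose mean with weights [1 - t] and [t] is
    0. *)
Lemma expR_amgm (y t : R) : 0 <= t -> t <= 1 ->
  expR (- (n%:R * y * t)) <= ((1 - t) + t * expR (- y)) ^+ n.
Proof.
move=> t0 t1.
have h : expR (- (y * t)) <= (1 - t) + t * expR (- y).
  have a := expR_ge1Dx (y * t); have b := expR_ge1Dx (y * t - y).
  have e1 : expR (- (y * t)) * expR (y * t) = 1 by rewrite -expRD addNr expR0.
  have e2 : expR (- (y * t)) * expR (y * t - y) = expR (- y) by rewrite -expRD addrA addNr add0r.
  have E0 := expR_gt0 (- (y * t)).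
  have c : 1 <= (1 - t) * expR (y * t) + t * expR (y * t - y).
    have : (1 - t) * (1 + y * t) + t * (1 + (y * t - y)) <= (1 - t) * expR (y * t) + t * expR (y * t - y).
      by rewrite lerD ?ler_wpM2l ?subr_ge0.
    by apply: le_trans; rewrite le_eqVlt; apply/orP; left; apply/eqP; ring.
  rewrite -[X in _ <= X]mulr1.
  have : expR (- (y * t)) * 1 <= expR (- (y * t)) * ((1 - t) * expR (y * t) + t * expR (y * t - y)).
    by rewrite ler_pM2l.
  by rewrite mulr1 mulrDr !(mulrCA (expR (- (y * t)))) e1 e2 !mulr1.
rewrite -mulrA -mulrN expRM_natl lerXn2r ?nnegrE ?expR_ge0//.
exact: le_trans (expR_ge0 _) h.
Qed.

(** Lower bound, free of [n], for [yn] without its last term, which is [Wf]: exact for [s < l1], the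
    Poisson form on [[l1, l2[], and 0 beyond. *)
Definition Zf (s t : R) : R :=
  if [&& 0 <= s, s < t & t < 1] then
    if s < l1 then t^-1
    else if s < l2 then qmt s t / t + (qmt s t - qm s) / (1 - t) else 0
  else 0.

Definition Wf (s t : R) : R := if [&& 0 <= s, s < t & t < 1] then q t ^+ n / t else 0.

Lemma Zf_le s t : Zf s t <= ynd q n s t + Wf s t.
Proof.
rewrite /Zf /ynd /Wf; case: ifP => [/and3P[s0 st t1]|_]; last by rewrite addr0.
have t0 : 0 < t by exact: le_lt_trans st.
have t1' : 0 < 1 - t by rewrite subr_gt0.
have tn0 : t != 0 by rewrite gt_eqF.
have tn1 : 1 - t != 0 by rewrite gt_eqF.
rewrite /yn -mulrDl subrK {1 2}/qf; case: ltP => sl1.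
  by rewrite !expr1n !mulr1 subrK expr1n (divff tn1) mul1r.
case: ltP => sl2; last first.
  by rewrite mulr0 addr0 expr0n eqn0Ngt n0 mulr0 subr0 !divr_ge0 ?exprn_ge0 ?(ltW t0)// ltW.
(* Partial fractions: the first summand is the integrand of alpha, the second is the one governed by
   kappa. *)
have -> : qmt s t / t + (qmt s t - qm s) / (1 - t) = (qmt s t - t * qm s) / (1 - t) / t.
  by field; rewrite tn0.
rewrite ler_wpM2r ?invr_ge0 ?(ltW t0)// ler_wpM2r ?invr_ge0 ?(ltW t1')//.
rewrite qmidX lerB// /qmt /qmid.
have -> : kappa * t / (1 - s) = n%:R * (kappa / (n%:R * (1 - s))) * t.
  have s1 : s < 1 by exact: lt_trans st t1.
  by field; rewrite subr_eq0 gt_eqF//= pnatr_eq0 -lt0n.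
by apply: expR_amgm => //; exact: ltW.
Qed.

Lemma qm_le_qmt s t : s < 1 -> t <= 1 -> qm s <= qmt s t.
Proof.
move=> s1 t1; rewrite /qm /qmt ler_expR lerN2.
by rewrite ler_pM2r ?invr_gt0 ?subr_gt0// ler_piMr// ltW.
Qed.

Lemma Zf_ge0 s t : 0 <= Zf s t.
Proof.
rewrite /Zf; case: ifP => // /and3P[s0 st t1].
have t0 : 0 < t by exact: le_lt_trans st.
case: ifP => _; first by rewrite invr_ge0 ltW.
case: ifP => // _; rewrite addr_ge0 ?divr_ge0 ?expR_ge0 ?(ltW t0) ?subr_ge0//.
- by apply: qm_le_qmt; [exact: lt_trans t1|exact: ltW].
- exact: ltW.
Qed.

Lemma Wf_ge0 s t : 0 <= Wf s t.
Proof.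
rewrite /Wf; case: ifP => // /and3P[s0 st t1].
rewrite divr_ge0 ?(ltW (le_lt_trans s0 st))// exprn_ge0//.
by rewrite /qf; case: ifP => // _; case: ifP => // _; exact: expR_ge0.
Qed.

(* Truncations of the power series of [(expR (c * v) - 1) / v]. *)
Lemma expR_trunc (x : R) m : 0 <= x ->
  \sum_(1 <= j < m) x ^+ j / j`!%:R <= expR x - 1.
Proof.
move=> x0; rewrite lerBrDr.
case: m => [|m]; first by rewrite big_geq// add0r -expR0 ler_expR.
have -> : \sum_(1 <= j < m.+1) x ^+ j / j`!%:R + 1 = series (exp_coeff x) m.+1.
  rewrite /series/= [in RHS]big_nat_recl// [RHS]addrC /exp_coeff /= expr0 fact0 divr1.
  by congr (_ + _); rewrite big_add1.
apply: nondecreasing_cvgn_le; last exact: is_cvg_series_exp_coeff.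
apply/nondecreasing_seqP => k; rewrite /series/= big_nat_recr//= lerDl.
by rewrite /exp_coeff divr_ge0// exprn_ge0.
Qed.

End pointwise.

Section integrals.
Variable R : realType.
Notation mu := (@lebesgue_measure R).
Local Open Scope ereal_scope.

Lemma integral_onem_pow (s : R) j : (s < 1)%R ->
  \int[mu]_(t in `[s, 1%R]) ((1 - t) ^+ j)%:E = ((1 - s) ^+ j.+1 / j.+1%:R)%:E.
Proof.
move=> s1.
pose G : R -> R := ((- (j.+1%:R^-1)) *: ((cst 1 - id) ^+ j.+1 : R -> R))%R.
have GE t : G t = (- (j.+1%:R^-1) * (1 - t) ^+ j.+1)%R by rewrite /G fctE.
have dG (t : R) : is_derive t 1%R G ((1 - t) ^+ j)%R.
  apply: is_derive_eq; rewrite /GRing.scale/= !fctE/= -mulr_natl.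
  by field; rewrite addrC natr1 pnatr_eq0.
have cf : continuous (fun t : R => ((1 - t) ^+ j)%R).
  move=> t; apply: (@cvg_comp _ _ _ (fun t : R => 1 - t)%R (fun x : R => x ^+ j)%R _ (nbhs (1 - t)%R)).
    by apply: cvgB; [exact: cvg_cst|exact: cvg_id].
  exact: exprn_continuous.
have cG : continuous G.
  move=> t; apply: differentiable_continuous.
  by apply/derivable1_diffP; apply: ex_derive; exact: dG.
rewrite (@continuous_FTC2 _ (fun t => (1 - t) ^+ j)%R G)//.
- by rewrite !GE subrr expr0n mulr0 add0e -EFinN mulNr opprK mulrC.
- exact: continuous_subspaceT.
- split.
  + by move=> t _; apply: ex_derive; exact: dG.
  + by apply: cvg_at_right_filter; exact: cG.
  + by apply: cvg_at_left_filter; exact: cG.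
- by move=> t _; rewrite derive1E; have [_ ->] := dG t.
Qed.

Lemma integral_restrict (i : interval R) (g : R -> \bar R) :
  [set` i] `<=` `[0%R, 1%R] ->
  \int[mu]_(t in `[0%R, 1%R]) (if t \in i then g t else 0) = \int[mu]_(t in [set` i]) g t.
Proof.
move=> i01; rewrite [LHS]integral_mkcond [RHS]integral_mkcond; congr integral.
apply/funext => t; rewrite /patch mem_setE; case: ifPn => ti; last first.
  rewrite ifF//; apply: contraNF ti => ti.
  by rewrite inE; apply: i01; rewrite inE in ti.
by rewrite mem_setE.
Qed.


Variables (n : nat) (kappa l1 l2 : R).
Hypotheses (n0 : (0 < n)%N) (k0 : (0 < kappa)%R) (l10 : (0 <= l1)%R) (l12 : (l1 <= l2)%R) (l21 : (l2 <= 1)%R).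
Hypothesis kappa1 : kappa_series kappa @ \oo --> (1%R : R).

Lemma measurable_qmt (s : R) : measurable_fun [set: R] (qmt kappa s).
Proof.
apply: measurableT_comp => //; apply: measurableT_comp => //.
by apply: measurable_funM => //; exact: measurable_funM.
Qed.

Lemma measurable_onem : measurable_fun [set: R] (fun t : R => 1 - t)%R.
Proof. exact: measurable_funB. Qed.

Lemma measurable_onemV : measurable_fun [set: R] (fun t : R => (1 - t)^-1)%R.
Proof. exact: (measurableT_comp (@measurable_invr R) measurable_onem). Qed.

(* Only the inequality [1 <= \sum_k kappa ^ k / (k! k)] matters here. *)
Lemma integral_kappa (s : R) : (0 <= s)%R -> (s < 1)%R ->
  (qm kappa s)%:E <= \int[mu]_(t in `]s, 1%R[) ((qmt kappa s t - qm kappa s) / (1 - t))%:E.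
Proof.
move=> s0 s1; have s1' : (0 < 1 - s)%R by rewrite subr_gt0.
pose c := (kappa / (1 - s))%R; have c0 : (0 < c)%R by rewrite divr_gt0.
(* [qmt - qm] equals [qm * (expR (c * (1 - t)) - 1)], and [T m] truncates the series of
   [(expR (c * (1 - t)) - 1) / (1 - t)]. Since [c * (1 - s) = kappa], its integral over [[s, 1]] is
   a partial sum of the series of kappa, whatever [s] is. *)
pose T m (t : R) := (\sum_(1 <= j < m) c ^+ j / j`!%:R * (1 - t) ^+ j.-1)%R.
have mT j : measurable_fun [set: measurableTypeR R] (fun t : R => ((1 - t) ^+ j)%:E).
  by apply/measurable_EFinP; apply: measurable_funX; exact: measurable_onem.
have T0 j t : (t <= 1 -> 0 <= c ^+ j / j`!%:R * (1 - t) ^+ j.-1)%R.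
  by move=> t1; rewrite mulr_ge0 ?divr_ge0 ?exprn_ge0 ?subr_ge0// ltW.
have Tint m : \int[mu]_(t in `[s, 1%R]) (T m t)%:E = (kappa_series kappa m)%:E.
  rewrite /T /kappa_series.
  under eq_integral do rewrite -sumEFin.
  rewrite ge0_integral_sum//; last first.
  - by move=> j t; rewrite /= in_itv/= => /andP[_ t1]; rewrite lee_fin T0.
  - move=> j; apply: measurable_funTS; under eq_fun do rewrite EFinM.
    exact: measurable_funeM.
  rewrite -sumEFin; rewrite big_nat_cond [RHS]big_nat_cond.
  apply: eq_bigr => j /andP[/andP[j1 _] _].
  under eq_integral do rewrite EFinM.
  transitivity ((c ^+ j / j`!%:R)%:E * \int[mu]_(t in `[s, 1%R]) ((1 - t) ^+ j.-1)%:E).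
    apply: ge0_integralZl => //.
    - exact: measurable_funTS (mT _).
    - by move=> t; rewrite /= in_itv/= => /andP[_ t1]; rewrite lee_fin exprn_ge0// subr_ge0.
    - by rewrite lee_fin divr_ge0// exprn_ge0// ltW.
  rewrite integral_onem_pow// prednK// -EFinM; congr EFin.
  rewrite /c expr_div_n; field.
  by rewrite !pnatr_eq0 -!lt0n j1 fact_gt0 expf_neq0// gt_eqF.
have mTm m : measurable_fun [set: measurableTypeR R] (fun t : R => (T m t)%:E).
  rewrite /T; under eq_fun do rewrite -sumEFin.
  apply: emeasurable_sum => j; under eq_fun do rewrite EFinM.
  exact: measurable_funeM.
have low m : (qm kappa s * kappa_series kappa m)%:E <=
    \int[mu]_(t in `]s, 1%R[) ((qmt kappa s t - qm kappa s) / (1 - t))%:E.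
  have Tm0 t : (t <= 1 -> 0 <= T m t)%R.
    by move=> t1; apply: sumr_ge0 => j _; exact: T0.
  rewrite EFinM -Tint.
  have -> : (qm kappa s)%:E * \int[mu]_(t in `[s, 1%R]) (T m t)%:E =
      \int[mu]_(t in `[s, 1%R]) ((qm kappa s)%:E * (T m t)%:E).
    apply/esym; apply: ge0_integralZl => //.
    - exact: measurable_funTS (mTm m).
    - by move=> t; rewrite /= in_itv/= => /andP[_ t1]; rewrite lee_fin Tm0.
    - by rewrite lee_fin expR_ge0.
  rewrite integral_itv_bndoo; last first.
    by apply: measurable_funTS; apply: measurable_funeM; exact: mTm.
  apply: integral_mono => t; rewrite /= in_itv/= => /andP[st t1].
    by rewrite mule_ge0 ?lee_fin ?expR_ge0// Tm0// ltW.
  have t1' : (0 < 1 - t)%R by rewrite subr_gt0.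
  rewrite -EFinM lee_fin ler_pdivlMr// -mulrA.
  have -> : qmt kappa s t = (qm kappa s * expR (c * (1 - t)))%R.
    by rewrite /qmt /qm -expRD; congr expR; rewrite /c; field; rewrite gt_eqF.
  have ct0 : (0 <= c * (1 - t))%R by rewrite mulr_ge0// ltW.
  rewrite -[X in (_ <= _ - X)%R]mulr1 -mulrBr ler_wpM2l ?expR_ge0//.
  apply: le_trans (expR_trunc m ct0).
  rewrite /T mulr_suml big_nat_cond [leRHS]big_nat_cond.
  rewrite le_eqVlt; apply/orP; left; apply/eqP; apply: eq_bigr => j /andP[/andP[j1 _] _].
  have E : ((1 - t) ^+ j = (1 - t) ^+ j.-1 * (1 - t))%R by rewrite -exprSr prednK.
  by rewrite [((c * (1 - t)) ^+ j)%R]exprMn E -!mulrA; congr (_ * _)%R; rewrite mulrC -mulrA.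
(* The bound holds for every truncation, so only the numbers pass to the limit; sum and integral are
   not exchanged. *)
have : (qm kappa s * kappa_series kappa m)%:E @[m --> \oo] --> (qm kappa s * 1)%:E.
  by apply: cvg_EFin; [exact: nearW|apply: cvgMr].
rewrite mulr1; apply: cvge_le; exact: nearW.
Qed.

End integrals.

(** * Gain and loss integrals of the success density *)

Section success_integral.
Variable R : realType.
Notation mu := (@lebesgue_measure R).
Local Open Scope ereal_scope.

Variables (n : nat) (kappa l1 l2 : R).
Hypotheses (n0 : (0 < n)%N) (k0 : (0 < kappa)%R) (l10 : (0 <= l1)%R) (l12 : (l1 <= l2)%R) (l21 : (l2 <= 1)%R).
Hypothesis kappa1 : kappa_series kappa @ \oo --> (1%R : R).

Definition Ga (s t : R) : R :=
  (if [&& 0 <= s, s < t & t < 1] then qmt kappa s t / t else 0)%R.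

Definition Z1 (s t : R) : R :=
  (if [&& 0 <= s, s < t, t < 1 & s < l1] then t^-1 else 0)%R.

Definition Z2 (s t : R) : R :=
  (if [&& 0 <= s, s < t, t < 1, l1 <= s & s < l2] then
    qmt kappa s t / t + (qmt kappa s t - qm kappa s) / (1 - t) else 0)%R.

Lemma Zf_split s t : Zf kappa l1 l2 s t = (Z1 s t + Z2 s t)%R.
Proof.
rewrite /Zf /Z1 /Z2; case: (0 <= s)%R => /=; last by rewrite addr0.
case: (s < t)%R => /=; last by rewrite addr0.
case: (t < 1)%R => /=; last by rewrite addr0.
by case: ltP => sl1 /=; rewrite ?addr0 ?add0r.
Qed.

Lemma Z1_ge0 s t : (0 <= Z1 s t)%R.
Proof.
rewrite /Z1; case: ifP => // /and4P[s0 st _ _].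
by rewrite invr_ge0 ltW// (le_lt_trans s0).
Qed.

Lemma Z2_ge0 s t : (0 <= Z2 s t)%R.
Proof.
have : (0 <= Zf kappa l1 l2 s t)%R by exact: Zf_ge0.
rewrite Zf_split /Z1 /Z2.
case: ifP => [/and4P[s0 st t1 sl]|_]; last by rewrite add0r.
by rewrite s0 st t1 (leNgt l1 s) sl.
Qed.

Lemma Ga_ge0 s t : (0 <= Ga s t)%R.
Proof.
rewrite /Ga; case: ifP => // /and3P[s0 st _].
by rewrite divr_ge0 ?expR_ge0// ltW// (le_lt_trans s0).
Qed.

Section meas.
Context d (X : measurableType d) (s t : X -> R).
Hypotheses (ms : measurable_fun [set: X] s) (mt : measurable_fun [set: X] t).

Let minv (f : X -> R) : measurable_fun [set: X] f -> measurable_fun [set: X] (fun x => (f x)^-1)%R.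
Proof. by move=> mf; apply: measurableT_comp mf; exact: measurable_invr. Qed.

Let monem (f : X -> R) : measurable_fun [set: X] f -> measurable_fun [set: X] (fun x => 1 - f x)%R.
Proof. by move=> mf; exact: measurable_funB. Qed.

Lemma measurable_qmt2 : measurable_fun [set: X] (fun x => qmt kappa (s x) (t x)).
Proof.
apply: measurableT_comp => //; apply: measurableT_comp => //.
apply: measurable_funM; first exact: measurable_funM.
by apply: minv; exact: monem.
Qed.

Lemma measurable_qm2 : measurable_fun [set: X] (fun x => qm kappa (s x)).
Proof.
have m : measurable_fun [set: X] (fun x => - kappa * (1 - s x)^-1)%R.
  by apply: measurable_funM => //; apply: minv; exact: monem.
rewrite (_ : (fun _ => _) = fun x => expR (- kappa * (1 - s x)^-1)).
  exact: measurableT_comp.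
by apply/funext => x; rewrite /qm mulNr.
Qed.

Let mlt (f g : X -> R) : measurable_fun [set: X] f -> measurable_fun [set: X] g ->
  measurable_fun [set: X] (fun x => f x < g x)%R.
Proof. by move=> mf mg; exact: measurable_fun_ltr. Qed.

Let mle (f g : X -> R) : measurable_fun [set: X] f -> measurable_fun [set: X] g ->
  measurable_fun [set: X] (fun x => f x <= g x)%R.
Proof. by move=> mf mg; exact: measurable_fun_ler. Qed.

Lemma measurable_Ga : measurable_fun [set: X] (fun x => Ga (s x) (t x)).
Proof.
apply: measurable_fun_ifT => //.
  by apply: measurable_and; [exact: mle|apply: measurable_and; exact: mlt].
by apply: measurable_funM; [exact: measurable_qmt2|exact: minv].
Qed.

Lemma measurable_Z1 : measurable_fun [set: X] (fun x => Z1 (s x) (t x)).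
Proof.
apply: measurable_fun_ifT => //; last exact: minv.
apply: measurable_and; [exact: mle|apply: measurable_and; [exact: mlt|]].
by apply: measurable_and; exact: mlt.
Qed.

Lemma measurable_Z2 : measurable_fun [set: X] (fun x => Z2 (s x) (t x)).
Proof.
apply: measurable_fun_ifT => //.
  apply: measurable_and; [exact: mle|apply: measurable_and; [exact: mlt|]].
  apply: measurable_and; [exact: mlt|].
  by apply: measurable_and; [exact: mle|exact: mlt].
apply: measurable_funD.
  by apply: measurable_funM; [exact: measurable_qmt2|exact: minv].
apply: measurable_funM; last by apply: minv; exact: monem.
by apply: measurable_funB; [exact: measurable_qmt2|exact: measurable_qm2].
Qed.

Lemma measurable_qf : measurable_fun [set: X] (fun x => qf n kappa l1 l2 (s x)).
Proof.
apply: measurable_fun_ifT => //; first exact: mlt.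
apply: measurable_fun_ifT => //; first exact: mlt.
have m : measurable_fun [set: X] (fun x => - kappa * (n%:R * (1 - s x))^-1)%R.
  apply: measurable_funM => //; apply: minv; apply: measurable_funM => //.
  exact: monem.
rewrite (_ : (fun _ => _) = fun x => expR (- kappa * (n%:R * (1 - s x))^-1)).
  exact: measurableT_comp.
by apply/funext => x; rewrite /qmid mulNr.
Qed.
End meas.

Lemma measurable_Wf d (X : measurableType d) (s t : X -> R) :
  measurable_fun [set: X] s -> measurable_fun [set: X] t ->
  measurable_fun [set: X] (fun x => Wf n kappa l1 l2 (s x) (t x)).
Proof.
move=> ms mt; apply: measurable_fun_ifT => //.
  apply: measurable_and; first by apply: measurable_fun_ler.
  by apply: measurable_and; apply: measurable_fun_ltr.
apply: measurable_funM; first by apply: measurable_funX; exact: measurable_qf.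
by apply: measurableT_comp mt; exact: measurable_invr.
Qed.

Lemma measurable_ynd d (X : measurableType d) (s t : X -> R) :
  measurable_fun [set: X] s -> measurable_fun [set: X] t ->
  measurable_fun [set: X] (fun x => ynd (qf n kappa l1 l2) n (s x) (t x)).
Proof.
move=> ms mt; have m1t : measurable_fun [set: X] (fun x => 1 - t x)%R by exact: measurable_funB.
have minv (f : X -> R) : measurable_fun [set: X] f -> measurable_fun [set: X] (fun x => (f x)^-1)%R.
  by move=> mf; apply: measurableT_comp mf; exact: measurable_invr.
have mq := measurable_qf ms; have mqt := measurable_qf mt.
apply: measurable_fun_ifT => //.
  apply: measurable_and; first by apply: measurable_fun_ler.
  by apply: measurable_and; apply: measurable_fun_ltr.
apply: measurable_funM; last exact: minv.
apply: measurable_funB; last exact: measurable_funX.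
apply: measurable_funM; last exact: minv.
apply: measurable_funB.
  by apply: measurable_funX; apply: measurable_funD => //; exact: measurable_funM.
by apply: measurable_funM => //; exact: measurable_funX.
Qed.

Lemma measurable_intU (f : R -> R -> R) : (forall s t, 0 <= f s t)%R ->
  measurable_fun [set: (R * R)%type] (fun z => f z.2 z.1) ->
  measurable_fun [set: R] (fun t => \int[U R]_s (f s t)%:E).
Proof.
move=> f0 mf.
apply: (@measurable_fun_fubini_tonelli_F _ _ _ _ _ (U R) (fun z => (f z.2 z.1)%:E)).
- exact/measurable_EFinP.
- by move=> z; rewrite lee_fin.
Qed.

Lemma integralU2 (f : R -> R -> R) : (forall s t, 0 <= f s t)%R ->
  measurable_fun [set: (R * R)%type] (fun z => f z.2 z.1) ->
  \int[U R]_t \int[U R]_s (f s t)%:E =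
  \int[mu]_(t in `[0%R, 1%R]) \int[U R]_s (f s t)%:E.
Proof.
move=> f0 mf; rewrite integralU//; first exact: measurable_intU.
by move=> t; apply: integral_ge0 => s _; rewrite lee_fin.
Qed.

(* [\int_0^l1 \int_s^1 1/t dt ds = l1 - l1 ln l1], computed in the order [dt] last so
   that no integral is improper. *)
Lemma Z1_lower : (l1 + negxlnx l1)%:E <= \int[U R]_t \int[U R]_s (Z1 s t)%:E.
Proof.
have l11 : (l1 <= 1)%R by exact: le_trans l21.
rewrite integralU2; [|exact: Z1_ge0|by apply: measurable_Z1].
pose G t := \int[U R]_s (Z1 s t)%:E.
have mlt (c : R) : measurable_fun [set: measurableTypeR R] (fun t => (ind (t < c)%R : \bar R)).
  exact: measurable_ind (measurable_ltc c).
have mle : measurable_fun [set: measurableTypeR R] (fun t => (ind (l1 <= t)%R * (l1 / t)%:E : \bar R)).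
  apply: emeasurable_funM.
    by apply: measurable_ind; apply: measurable_fun_ler.
  by apply/measurable_EFinP; apply: measurable_funM => //; exact: measurable_invr.
(* Exactly the [s < min l1 t] contribute, so the inner integral is [min l1 t / t]. The endpoints,
   where this formula fails, are dropped below as null sets. *)
have G01 t : (0 < t)%R -> (t < 1)%R -> G t = ind (t < l1)%R + ind (l1 <= t)%R * (l1 / t)%:E.
  move=> t0 t1; pose m := Num.min l1 t.
  have -> : G t = (t^-1 * m)%:E.
    rewrite /G integralU; last 2 first.
    - by apply/measurable_EFinP; apply: measurable_Z1.
    - by move=> s; rewrite lee_fin Z1_ge0.
    rewrite EFinM -(@leb01_lt R m); last 2 first.
    - by rewrite le_min l10 ltW.
    - by rewrite ge_min l11.
    rewrite -ge0_integralZl//; last 3 first.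
    - exact: measurable_funTS (mlt m).
    - by move=> s _; exact: ind_ge0.
    - by rewrite lee_fin invr_ge0 ltW.
    apply: eq_integral => s; rewrite inE/= in_itv/= => /andP[s0 _].
    rewrite /Z1 s0 t1/= /m lt_min andbC /ind -EFinM; congr EFin.
    by case: ifP => _; rewrite ?mulr1 ?mulr0.
  rewrite /m; case: leP => lt; rewrite /ind /=.
    by rewrite add0e mul1e mulrC.
  by rewrite mul0e adde0 mulVf// gt_eqF.
rewrite EFinD; apply: (@le_trans _ _ (\int[mu]_(t in `[0%R, 1%R]) (ind (t < l1)%R + ind (l1 <= t)%R * (l1 / t)%:E))).
  have -> : \int[mu]_(t in `[0%R, 1%R]) (ind (t < l1)%R + ind (l1 <= t)%R * (l1 / t)%:E) =
      \int[mu]_(t in `[0%R, 1%R]) ind (t < l1)%R +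
      \int[mu]_(t in `[0%R, 1%R]) (ind (l1 <= t)%R * (l1 / t)%:E).
    apply: ge0_integralD => //.
    - by move=> *; exact: ind_ge0.
    - exact: measurable_funTS (mlt l1).
    - move=> t; rewrite /= in_itv/= => /andP[t0 _].
      by rewrite mule_ge0 ?ind_ge0// lee_fin divr_ge0.
    - exact: measurable_funTS mle.
  by rewrite leb01_lt// leeD2l// leb01_inv.
rewrite integral_itv_bndoo; last first.
  by apply: measurable_funTS; apply: emeasurable_funD; [exact: mlt|exact: mle].
rewrite [leRHS]integral_itv_bndoo; last first.
  by apply: measurable_funTS; apply: measurable_intU; [exact: Z1_ge0|exact: measurable_Z1].
apply: integral_mono => t; rewrite /= in_itv/= => /andP[t0 t1].
  by rewrite adde_ge0 ?ind_ge0// mule_ge0 ?ind_ge0// lee_fin divr_ge0// ltW.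
by rewrite -/(G t) G01.
Qed.

End success_integral.

Section alpha_integral.
Variable R : realType.
Notation mu := (@lebesgue_measure R).
Local Open Scope ereal_scope.

Variables (n : nat) (kappa l1 l2 : R).
Hypotheses (n0 : (0 < n)%N) (k0 : (0 < kappa)%R) (l10 : (0 <= l1)%R) (l12 : (l1 <= l2)%R) (l21 : (l2 <= 1)%R).
Hypothesis kappa1 : kappa_series kappa @ \oo --> (1%R : R).

Let QI := \int[mu]_(t in `[l1, l2[) (qm kappa t)%:E.

Let sub01 : [set` `[l1, l2[] `<=` `[0%R, 1%R].
Proof.
move=> t; rewrite /= !in_itv/= => /andP[l1t tl2].
by rewrite (le_trans l10 l1t) (le_trans (ltW tl2) l21).
Qed.

Let mqm : measurable_fun [set: measurableTypeR R] (fun t : R => (qm kappa t)%:E).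
Proof. by apply/measurable_EFinP; apply: measurable_qm2. Qed.

(** For fixed [t] the admissible [s] have total length [t], which cancels [1 / t]. There remains
    [qf t ^ n]: 1 below [l1], [qm t] up to [l2], and 0 afterwards. *)
Lemma Wf_upper : \int[U R]_t \int[U R]_s (Wf n kappa l1 l2 s t)%:E <= l1%:E + QI.
Proof.
have l11 : (l1 <= 1)%R by exact: le_trans l21.
have W0 s t : (0 <= Wf n kappa l1 l2 s t)%R by exact: Wf_ge0.
rewrite integralU2//; last by apply: measurable_Wf.
have mlt (c : R) : measurable_fun [set: measurableTypeR R] (fun t => (ind (t < c)%R : \bar R)).
  exact: measurable_ind (measurable_ltc c).
apply: (@le_trans _ _ (\int[mu]_(t in `[0%R, 1%R])
    (ind (t < l1)%R + (if t \in `[l1, l2[ then (qm kappa t)%:E else 0)))).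
  apply: integral_mono => t; rewrite /= in_itv/= => /andP[t0 t1].
    by apply: integral_ge0 => s _; rewrite lee_fin.
  have rhs0 : 0 <= ind (t < l1)%R + (if t \in `[l1, l2[ then (qm kappa t)%:E else 0).
    by rewrite adde_ge0 ?ind_ge0//; case: ifP => // _; rewrite lee_fin expR_ge0.
  have [/andP[t0' t1']|nt] := boolP ((0 < t)%R && (t < 1)%R); last first.
    rewrite (_ : (fun s => _) = fun=> 0) ?integral0//; apply/funext => s.
    rewrite /Wf; case: ifP => // /and3P[s0 st t1'].
    by rewrite (le_lt_trans s0 st) t1' in nt.
  rewrite integralU; last 2 first.
  - by apply/measurable_EFinP; apply: measurable_Wf.
  - by move=> s; rewrite lee_fin.
  pose Q := (qf n kappa l1 l2 t ^+ n)%R.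
  have Q0 : (0 <= Q)%R.
    rewrite /Q exprn_ge0// /qf; case: ifP => // _; case: ifP => // _.
    exact: expR_ge0.
  have -> : \int[mu]_(s in `[0%R, 1%R]) (Wf n kappa l1 l2 s t)%:E = Q%:E.
    transitivity ((Q / t)%:E * \int[mu]_(s in `[0%R, 1%R]) ind (s < t)%R).
      transitivity (\int[mu]_(s in `[0%R, 1%R]) ((Q / t)%:E * ind (s < t)%R)).
        apply: eq_integral => s; rewrite inE/= in_itv/= => /andP[s0 _].
        rewrite /Wf s0 t1' andbT /ind -EFinM; congr EFin.
        by case: (s < t)%R; rewrite /= -/Q ?mulr1 ?mulr0.
      apply: ge0_integralZl => //.
      - exact: measurable_funTS (mlt t).
      - by move=> s _; exact: ind_ge0.
      - by rewrite lee_fin divr_ge0.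
    by rewrite leb01_lt// -EFinM divfK// gt_eqF.
  rewrite /Q /qf in_itv/=; case: (ltP t l1) => tl1 /=.
    by rewrite expr1n /ind adde0.
  case: (ltP t l2) => tl2; rewrite /ind add0e.
    by rewrite qmidX.
  by rewrite expr0n eqn0Ngt n0.
have -> : \int[mu]_(t in `[0%R, 1%R])
    (ind (t < l1)%R + (if t \in `[l1, l2[ then (qm kappa t)%:E else 0)) =
  \int[mu]_(t in `[0%R, 1%R]) ind (t < l1)%R +
  \int[mu]_(t in `[0%R, 1%R]) (if t \in `[l1, l2[ then (qm kappa t)%:E else 0).
  apply: ge0_integralD => //.
  - by move=> *; exact: ind_ge0.
  - exact: measurable_funTS (mlt l1).
  - by move=> t _; case: ifP => // _; rewrite lee_fin expR_ge0.
  - apply: measurable_funTS; apply: measurable_fun_ifT => //.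
    rewrite (_ : (fun _ => _) = fun t : R => (l1 <= t)%R && (t < l2)%R); last first.
      by apply/funext => t; rewrite in_itv.
    by apply: measurable_and; [apply: measurable_fun_ler|apply: measurable_fun_ltr].
by rewrite leb01_lt// integral_restrict.
Qed.

Let a (s : R) : \bar R := \int[U R]_t (Ga kappa s t)%:E.

Let ma : measurable_fun [set: R] a.
Proof.
apply: (@measurable_intU R (fun t s => Ga kappa s t)).
- by move=> *; exact: Ga_ge0.
- exact: measurable_Ga.
Qed.

Let a0 s : 0 <= a s. Proof. by apply: integral_ge0 => t _; rewrite lee_fin Ga_ge0. Qed.

Let sub1 (s : R) : (0 <= s)%R -> [set` `]s, 1%R[] `<=` `[0%R, 1%R].
Proof.
move=> s0 t; rewrite /= !in_itv/= => /andP[st t1].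
by rewrite (le_trans s0 (ltW st)) ltW.
Qed.

Let mqt (s : R) : measurable_fun [set: measurableTypeR R] (fun t : R => (qmt kappa s t / t)%:E).
Proof.
apply/measurable_EFinP; apply: measurable_funM; first exact: measurable_qmt.
exact: measurable_invr.
Qed.

Let aE (s : R) : (0 <= s)%R -> a s = \int[mu]_(t in `]s, 1%R[) (qmt kappa s t / t)%:E.
Proof.
move=> s0; rewrite /a integralU; last 2 first.
- by apply/measurable_EFinP; apply: measurable_Ga.
- by move=> t; rewrite lee_fin Ga_ge0.
rewrite -(integral_restrict _ (sub1 s0)); apply: eq_integral => t _.
by rewrite /Ga s0 in_itv/=; case: ifP.
Qed.

(** With [s] moved outside by Tonelli's theorem, the first summand integrates over [t] to the inner
    integral of alpha, and the second to at least [qm s], by [integral_kappa]. *)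
Lemma Z2_lower :
  \int[mu]_(s in `[l1, l2]) \int[mu]_(t in `[s, 1%R])
     (expR (- (kappa * t / (1 - s))) / t)%:E + QI <=
  \int[U R]_t \int[U R]_s (Z2 kappa l1 l2 s t)%:E.
Proof.
have Z0 s t : (0 <= Z2 kappa l1 l2 s t)%R by exact: Z2_ge0.
have -> : \int[mu]_(s in `[l1, l2]) \int[mu]_(t in `[s, 1%R])
     (expR (- (kappa * t / (1 - s))) / t)%:E = \int[mu]_(s in `[l1, l2[) a s.
  transitivity (\int[mu]_(s in `[l1, l2]) a s).
    apply: eq_integral => s; rewrite inE/= in_itv/= => /andP[l1s sl2].
    rewrite aE ?(le_trans l10 l1s)// -[LHS]/(\int[mu]_(t in `[s, 1%R]) (qmt kappa s t / t)%:E).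
    by rewrite integral_itv_bndoo//; exact: measurable_funTS (mqt s).
  rewrite integral_itv_bndoo; last exact: measurable_funTS ma.
  by rewrite [RHS]integral_itv_bndoo//; exact: measurable_funTS ma.
have -> : \int[mu]_(s in `[l1, l2[) a s + QI = \int[mu]_(s in `[l1, l2[) (a s + (qm kappa s)%:E).
  apply/esym; apply: ge0_integralD => //.
  - exact: measurable_funTS ma.
  - by move=> s _; rewrite lee_fin expR_ge0.
  - exact: measurable_funTS mqm.
have mZ : measurable_fun [set: (R * R)%type] (fun z => (Z2 kappa l1 l2 z.2 z.1)%:E).
  by apply/measurable_EFinP; apply: measurable_Z2.
have := @fubini_tonelli _ _ _ _ R (U R) (U R) _ mZ (fun z => Z0 z.2 z.1).
move=> /= ->.
rewrite (integralU2 (f := fun t s => Z2 kappa l1 l2 s t))//; last by apply: measurable_Z2.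
rewrite -(integral_restrict _ sub01); apply: integral_mono => s; rewrite /= in_itv/= => /andP[s0 s1].
  by case: ifP => // _; rewrite adde_ge0// lee_fin expR_ge0.
case: ifP; last by move=> _; apply: integral_ge0 => t _; rewrite lee_fin.
rewrite in_itv/= => /andP[l1s sl2].
have s1' : (s < 1)%R by exact: lt_le_trans l21.
rewrite integralU; last 2 first.
- by apply/measurable_EFinP; apply: measurable_Z2.
- by move=> t; rewrite lee_fin.
have -> : \int[mu]_(t in `[0%R, 1%R]) (Z2 kappa l1 l2 s t)%:E =
   \int[mu]_(t in `]s, 1%R[) ((qmt kappa s t / t)%:E + ((qmt kappa s t - qm kappa s) / (1 - t))%:E).
  rewrite -(integral_restrict _ (sub1 s0)); apply: eq_integral => t _.
  rewrite /Z2 s0 l1s sl2 in_itv/= andbT; case: (s < t)%R => //=.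
  by case: (t < 1)%R.
rewrite (aE s0).
have -> : \int[mu]_(t in `]s, 1%R[) ((qmt kappa s t / t)%:E + ((qmt kappa s t - qm kappa s) / (1 - t))%:E) =
  \int[mu]_(t in `]s, 1%R[) (qmt kappa s t / t)%:E +
  \int[mu]_(t in `]s, 1%R[) ((qmt kappa s t - qm kappa s) / (1 - t))%:E.
  apply: ge0_integralD => //.
  - move=> t; rewrite /= in_itv/= => /andP[st _].
    by rewrite lee_fin divr_ge0 ?expR_ge0// (le_trans s0 (ltW st)).
  - exact: measurable_funTS (mqt s).
  - move=> t; rewrite /= in_itv/= => /andP[st t1].
    by rewrite lee_fin divr_ge0 ?subr_ge0 ?(ltW t1)// qm_le_qmt// ltW.
  - apply: measurable_funTS; apply/measurable_EFinP; apply: measurable_funM.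
      by apply: measurable_funB => //; exact: measurable_qmt.
    exact: measurable_onemV.
by apply: leeD2l; exact: integral_kappa.
Qed.

(** [ynd + Wf >= Z1 + Z2] pointwise. The right side integrates to at least [l1 + beta] plus the
    double integral of alpha plus [QI], and [Wf] to at most [l1 + QI], which cancels. *)
Lemma alpha_lower (beta : R) : negxlnx l1 = beta ->
  (forall s t, 0 <= ynd (qf n kappa l1 l2) n s t)%R ->
  alpha_bound beta l1 l2 kappa <=
  \int[U R]_t \int[U R]_s (ynd (qf n kappa l1 l2) n s t)%:E.
Proof.
move=> hb y0; rewrite /alpha_bound.
set A := \int[_]_(s in _) _; set Y := (X in _ <= X).
have W0 s t : (0 <= Wf n kappa l1 l2 s t)%R by exact: Wf_ge0.
have Z10 s t : (0 <= Z1 l1 s t)%R by exact: Z1_ge0.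
have Z20 s t : (0 <= Z2 kappa l1 l2 s t)%R by exact: Z2_ge0.
have QI0 : 0 <= QI by apply: integral_ge0 => t _; rewrite lee_fin expR_ge0.
(* Cancelling [l1 + QI] in the extended reals requires it to be finite; the integrand of [QI] is at
   most 1. *)
have QI1 : QI < +oo.
  apply: (@le_lt_trans _ _ (\int[mu]_(t in `[l1, l2[) cst 1 t)).
    apply: integral_mono => t; rewrite /= in_itv/= => /andP[l1t tl2].
      by rewrite lee_fin expR_ge0.
    rewrite lee_fin -expR0 ler_expR oppr_le0 divr_ge0 ?(ltW k0)// subr_ge0.
    exact: le_trans (ltW tl2) l21.
  rewrite integral_cst//= mul1e lebesgue_measure_itv/=.
  by case: ifP => // _; rewrite -EFinB ltry.
have inner (f g : R -> R -> R) : (forall s t, 0 <= f s t)%R -> (forall s t, 0 <= g s t)%R ->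
    measurable_fun [set: (R * R)%type] (fun z => f z.2 z.1) ->
    measurable_fun [set: (R * R)%type] (fun z => g z.2 z.1) ->
    \int[U R]_t \int[U R]_s (f s t + g s t)%:E =
    \int[U R]_t \int[U R]_s (f s t)%:E + \int[U R]_t \int[U R]_s (g s t)%:E.
  move=> f0 g0 mf mg.
  rewrite -ge0_integralD//; last 4 first.
  - by move=> t _; apply: integral_ge0 => s _; rewrite lee_fin.
  - exact: measurable_intU.
  - by move=> t _; apply: integral_ge0 => s _; rewrite lee_fin.
  - exact: measurable_intU.
  apply: eq_integral => t _; under eq_integral do rewrite EFinD.
  apply: ge0_integralD => //.
  - by move=> s _; rewrite lee_fin.
  - by apply/measurable_EFinP; exact: (measurableT_comp mf (measurable_pair1 t)).
  - by move=> s _; rewrite lee_fin.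
  - by apply/measurable_EFinP; exact: (measurableT_comp mg (measurable_pair1 t)).
have key : \int[U R]_t \int[U R]_s (Z1 l1 s t + Z2 kappa l1 l2 s t)%:E <=
    \int[U R]_t \int[U R]_s (ynd (qf n kappa l1 l2) n s t + Wf n kappa l1 l2 s t)%:E.
  apply: integral_mono => t _.
    by apply: integral_ge0 => s _; rewrite lee_fin addr_ge0.
  apply: integral_mono => s _; first by rewrite lee_fin addr_ge0.
  by rewrite lee_fin -Zf_split; exact: Zf_le.
rewrite inner// in key; [|exact: measurable_Z1|exact: measurable_Z2].
rewrite inner// in key; [|exact: measurable_ynd|exact: measurable_Wf].
rewrite -/Y in key.
have h1 := @Z1_lower R l1 l2 l10 l12 l21; have h2 := Z2_lower; have h3 := Wf_upper.
rewrite -/A in h2; rewrite hb in h1.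
have fin : l1%:E + QI \is a fin_num by rewrite fin_numD/= ge0_fin_numE.
rewrite -(leeD2rE _ _ fin).
apply: le_trans (leeD2l Y h3); apply: le_trans key.
apply: le_trans (leeD h1 h2).
by rewrite EFinD addeACA [beta%:E + _]addeC.
Qed.

End alpha_integral.

(** * Final bounds, including the case of no values *)

Section algorithm_bounds.
Variable R : realType.

Lemma success_prob_le1 (A : algorithm R) n (Ft F : probability R R) :
  (success_prob A n Ft F <= 1)%E.
Proof.
have it1 : iterE F n (fun _ => 1%E) = 1%E.
  elim: n => //= n ->; rewrite leb01_cst integral_cst// mul1e.
  exact: probability_setT.
rewrite -(leb01_cst (1 : R)); apply: integral_mono => w _.
  by apply: iterE_ge0 => s _; rewrite lee_fin.
by rewrite -it1; apply: iterE_mono => s _; rewrite lee_fin// lern1 leq_b1.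
Qed.

Lemma success_prob0 (A : algorithm R) (Ft F : probability R R) :
  success_prob A 0 Ft F = 1%E.
Proof.
rewrite /success_prob -(leb01_cst (1 : R)); apply: eq_integral => w _ /=.
by rewrite /success /x_alg /x_opt /arrivals big_nil /= eqxx.
Qed.

Variables (beta l1 l2 kappa : R).
Hypotheses (l10 : 0 <= l1) (l12 : l1 <= l2) (l21 : l2 <= 1).
Hypotheses (h1 : negxlnx l1 = beta) (h2 : negxlnx l2 = beta).
Hypotheses (k0 : 0 < kappa) (kappa1 : kappa_series kappa @ \oo --> (1 : R)).

Section positive.
Variable n : nat.
Hypothesis n0 : (0 < n)%N.

Notation tau := (ptau n kappa l1 l2).

Let mtau F : measurable_fun [set: (R * R)%type] (tau F).
Proof. exact: measurable_ptau. Qed.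

Let tau01 F v : 0 <= tau F v <= 1.
Proof.
by have /andP[a b] := ptau_itv n kappa l12 F v; rewrite (le_trans l10 a) (le_trans b l21).
Qed.

Let tau_anti F a b : lexle a b -> tau F b <= tau F a.
Proof. exact: ptau_anti. Qed.

Lemma ptau_consistent : consistent (algo tau) n (alpha_bound beta l1 l2 kappa).
Proof.
move=> F F0; have law := ptau_law n0 k0 l12 l21 F.
apply: le_trans (success_yn mtau tau_anti tau01 n0 F0 law).
apply: alpha_lower => // s t; rewrite /ynd; case: ifP => // /and3P[s0 st t1].
rewrite -lee_fin -(@E2_Yf _ F _ (mtau F) _ law n s t s0 st t1).
by apply: nest_ge0 => *; apply: nest_ge0 => *; rewrite lee_fin Yf_ge0.
Qed.

Lemma ptau_robust : robust (algo tau) n beta%:E.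
Proof.
apply: (algo_robust mtau tau_anti l10 l21) => // F v; exact: ptau_itv.
Qed.

End positive.

(** Follows from consistency itself: for one value and the point mass at 0, alpha is at most a
    success probability. *)
Lemma alpha_bound_le1 : (alpha_bound beta l1 l2 kappa <= 1)%E.
Proof.
pose F : probability R R := \d_(0 : R).
have F0 : nonneg_dist F by rewrite /nonneg_dist [LHS]diracE mem_set//= in_itv/= lexx.
apply: le_trans (ptau_consistent (ltn0Sn 0) F0) _; exact: success_prob_le1.
Qed.

End algorithm_bounds.

Unset Implicit Arguments.

Theorem mainTheorem2 (R : realType) (beta l1 l2 kappa : R) :
  0 <= beta -> beta <= expR (-1) ->
  0 <= l1 -> l1 <= l2 -> l2 <= 1 ->
  negxlnx l1 = beta -> negxlnx l2 = beta ->
  (forall l : R, 0 <= l -> l <= 1 -> negxlnx l = beta -> l = l1 \/ l = l2) ->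
  0 < kappa -> kappa_series kappa @ \oo --> (1 : R) ->
  forall n : nat, exists A : algorithm R,
    alg_measurable A /\
    consistent A n (alpha_bound beta l1 l2 kappa) /\
    robust A n beta%:E.
Proof.
move=> b0 be l10 l12 l21 h1 h2 _ k0 k1 n.
exists (algo (ptau n kappa l1 l2)); split; first by apply: algo_measurable => F; exact: measurable_ptau.
(* With no values, accepted value and maximum are both 0 and success is certain, so it remains to
   see that alpha and beta are at most 1. *)
case: (posnP n) => [->|n0]; last by split; [exact: ptau_consistent|exact: ptau_robust].
split => [F _|F Ft _ _]; rewrite success_prob0; first exact: alpha_bound_le1.
by rewrite lee_fin (le_trans be)// -expR0 ler_expR lerN10.
Qed.
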